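(* Let $\Omega\subset\mathbb{C}^n$ be a bounded complete Reinhardt domain with smooth boundary such that $K_2(\zeta,z)$ is not zero-free, i.e. $K_2(\zeta,z)=0$ for some $\zeta,z\in\Omega$. Then the following properties hold: (1) For each $\alpha>0$, there exist $k\in\mathbb{Z}^+$ and $z\in\Omega$ such that $K_{2k}(\cdot,z)\notin C^\alpha(\overline\Omega)$. (2) For each $\alpha>0$, there exists $k\in\mathbb{Z}^+$ such that either $K_{2k}(\cdot,z)\notin C(\overline\Omega)$ for some $z\in\Omega$, or $K_{2k}(\zeta,\cdot)\notin C^\alpha_{\rm loc}(\Omega)$ for some $\zeta\in\partial\Omega$.
   Context: For a bounded domain $\Omega\subset\mathbb{C}^n$ and $1\le p<\infty$, let $A^p(\Omega)=\{f\in\mathcal{O}(\Omega):\|f\|_p^p=\int_\Omega|f|^p<\infty\}$. The $p$-Bergman kernel is $K_p(z):=\sup\{|f(z)|^p: f\in A^p(\Omega),\ \|f\|_p=1\}$. Let $m_p(z):=\inf\{\|f\|_p: f\in A^p(\Omega),\ f(z)=1\}$; it is known that this infimum is attained by a unique function $m_p(\cdot,z)\in A^p(\Omega)$, and $K_p(z)=m_p(z)^{-p}$. The off-diagonal $p$-Bergman kernel is $K_p(\zeta,z):=K_p(z)\,m_p(\zeta,z)$, $\zeta,z\in\Omega$; for $p=2$ it is the classical Bergman kernel. $C^\alpha$ means Hölder continuous with exponent $\alpha$: $u\in C^\alpha(E)$ if $|u(x)-u(y)|\le C|x-y|^\alpha$ on $E$ for some constant $C$, and $C^\alpha_{\rm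 loc}(\Omega)$ is the local version. A function on $\Omega$ is said to belong to $C(\overline\Omega)$ (resp. $C^\alpha(\overline\Omega)$) if it extends to a function in that class on $\overline\Omega$. In (2), in the second alternative (when $K_{2k}(\cdot,z)\in C(\overline\Omega)$ for all $z\in\Omega$), $K_{2k}(\zeta,z)$ for $\zeta\in\partial\Omega$ denotes the value of the continuous extension of $K_{2k}(\cdot,z)$ at $\zeta$. A domain $\Omega$ is complete Reinhardt if $z\in\Omega$ and $|w_j|\le|z_j|$ for all $j$ imply $w\in\Omega$. *)

(* Defs.v *)
From HB Require Import structures.
From mathcomp Require Import all_boot all_order all_algebra complex.
From mathcomp Require Import all_classical all_reals all_analysis.
Import Order.TTheory GRing.Theory Num.Theory.
Import numFieldNormedType.Exports.
Export Normc.

Set Implicit Arguments.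
Unset Strict Implicit.
Unset Printing Implicit Defensive.

Local Open Scope classical_set_scope.
Local Open Scope ring_scope.
Local Open Scope complex_scope.

(* C^n is 'rV[R[i]]_n, with the topology the library puts on matrices over a
   normed field. *)
HB.instance Definition _ (R : realType) := NormedModule.copy R[i] R[i]^o.

(* The product measure \x, with the sigma-finite structure that canonical
   structure inference does not find on \x itself (there it is shadowed by the
   instance for products of subprobabilities). *)
Section sigma_finite_product.
Local Open Scope ereal_scope.
Context d1 d2 (T1 : measurableType d1) (T2 : measurableType d2) (R : realType).
Variable m1 : {sigma_finite_measure set T1 -> \bar R}.
Variable m2 : {sigma_finite_measure set T2 -> \bar R}.

Definition product_measure : set (T1 * T2) -> \bar R := m1 \x m2.

HB.instance Definition _ := Measure.on product_measure.

Let product_measure_sigma_finite : sigma_finite setT product_measure.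
Proof.
have /sigma_finiteP[F [TF ndF Foo]] := sigma_finiteT m1.
have /sigma_finiteP[G [TG ndG Goo]] := sigma_finiteT m2.
exists (fun n => F n `*` G n).
  rewrite -setXTT TF TG predeqE => -[x y]; split.
    move=> [/= [n _ Fnx] [k _ Gky]]; exists (maxn n k) => //; split.
    - by move: x Fnx; exact/subsetPset/ndF/leq_maxl.
    - by move: y Gky; exact/subsetPset/ndG/leq_maxr.
  by move=> [n _ []/= ? ?]; split; exists n.
move=> k; have [? ?] := Foo k; have [? ?] := Goo k.
split; first exact: measurableX.
by rewrite /product_measure product_measure1E// lte_mul_pinfty// ge0_fin_numE.
Qed.

HB.instance Definition _ := Measure_isSigmaFinite.Build _ _ _ product_measure
  product_measure_sigma_finite.

End sigma_finite_product.

Section power_measure.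
Local Open Scope ereal_scope.
Context d (T : measurableType d) (R : realType).
Variable m : {sigma_finite_measure set T -> \bar R}.

Definition tuple_cons n (p : T * n.-tuple T) : n.+1.-tuple T :=
  [tuple of p.1 :: p.2].

Lemma measurable_tuple_cons n : measurable_fun setT (@tuple_cons n).
Proof. exact: measurable_cons. Qed.

Section step.
Context n (mu : {sigma_finite_measure set (n.-tuple T) -> \bar R}).

Definition power_step : set (n.+1.-tuple T) -> \bar R :=
  pushforward (product_measure m mu) (@tuple_cons n).

Let power_step0 : power_step set0 = 0.
Proof. by rewrite /power_step /pushforward preimage_set0 measure0. Qed.

Let power_step_ge0 A : 0 <= power_step A.
Proof. by rewrite /power_step /pushforward measure_ge0. Qed.

Let power_step_sigma_additive : semi_sigma_additive power_step.
Proof.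
have mc := @measurable_tuple_cons n.
move=> F mF tF mUF; rewrite /power_step /pushforward preimage_bigcup.
apply: measure_semi_sigma_additive.
- by move=> k; rewrite -[X in measurable X]setTI; exact: mc.
- apply/trivIsetP => /= i j _ _ ij; rewrite -preimage_setI.
  by move/trivIsetP : tF => /(_ _ _ _ _ ij) ->//; rewrite preimage_set0.
- by rewrite -preimage_bigcup -[X in measurable X]setTI; exact: mc.
Qed.

HB.instance Definition _ := isMeasure.Build _ _ _ power_step
  power_step0 power_step_ge0 power_step_sigma_additive.

Let power_step_sigma_finite : sigma_finite setT power_step.
Proof.
have [F FT Foo] := sigma_finiteT (product_measure m mu).
pose split (t : n.+1.-tuple T) : T * n.-tuple T := (thead t, [tuple of behead t]).
have consK p : split (@tuple_cons n p) = p.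
  by case: p => x t; congr pair; exact/val_inj.
have msplit : measurable_fun setT split.
  apply: measurable_fun_pair => /=; first exact: measurable_tnth.
  exact: measurable_behead.
exists (fun k => split @^-1` F k).
  by rewrite -preimage_bigcup -FT preimage_setT.
move=> k; have [mFk Fkoo] := Foo k; split.
  by rewrite -[X in measurable X]setTI; exact: msplit.
rewrite /power_step /pushforward (_ : _ @^-1` _ = F k)//.
by apply/seteqP; split=> p /=; rewrite consK.
Qed.

HB.instance Definition _ := Measure_isSigmaFinite.Build _ _ _ power_step
  power_step_sigma_finite.

End step.

Fixpoint power_measure n : {sigma_finite_measure set (n.-tuple T) -> \bar R} :=
  match n with
  | 0 => \d_([tuple] : 0.-tuple T)
  | n'.+1 => power_step (power_measure n')
  end.

End power_measure.

Definition to_Cn (R : realType) n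
    (t : n.-tuple (measurableTypeR R * measurableTypeR R)%type) : 'rV[R[i]]_n :=
  \row_j ((tnth t j).1 +i* (tnth t j).2).

Definition lebesgue_Cn (R : realType) n :=
  power_measure (product_measure (@lebesgue_measure R) (@lebesgue_measure R)) n.

Section bergman.
Context (R : realType) (n : nat).
Local Notation C := R[i].
Local Notation Cn := 'rV[R[i]]_n.
Implicit Types (Omega : set Cn) (p : R).

Definition enorm (v : Cn) : R := Num.sqrt (\sum_j normc (v 0 j) ^+ 2).

Definition boundary Omega : set Cn := closure Omega `\` interior Omega.

Definition bounded_domain Omega : Prop :=
  [/\ Omega !=set0, open Omega, connected Omega & bounded_set Omega].

Definition complete_Reinhardt Omega : Prop :=
  forall z w : Cn, Omega z -> (forall j, normc (w 0 j) <= normc (z 0 j)) ->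
    Omega w.

(* The coordinate vectors of C^n = R^(2n). *)
Definition real_coord_vector (v : Cn) : Prop :=
  exists j, v = delta_mx 0 j \/ v = (0 +i* 1) *: delta_mx 0 j.

Definition along (rho : Cn -> R) (v z : Cn) : R -> R :=
  fun t => rho (z + t%:C *: v).

Definition partial (v : Cn) (rho : Cn -> R) : Cn -> R :=
  fun z => derive1 (along rho v z) 0.

(* rho is of class C^k on the open set U, as a function of 2n real variables. *)
Fixpoint C_k (k : nat) (U : set Cn) (rho : Cn -> R) : Prop :=
  (forall z, U z -> {for z, continuous rho}) /\
  match k with
  | 0 => True
  | k'.+1 => forall v, real_coord_vector v ->
      (forall z, U z -> derivable (along rho v z) 0 1) /\
      C_k k' U (partial v rho)
  end.

Definition smooth_boundary Omega : Prop :=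
  forall a, boundary Omega a -> exists (U : set Cn) (rho : Cn -> R),
    [/\ open U, U a, (forall k, C_k k U rho),
        (exists2 v, real_coord_vector v & partial v rho a != 0) &
        Omega `&` U = [set z | U z /\ rho z < 0] ].

(* Functions on Omega are represented by total functions on C^n, whose values
   off Omega are irrelevant. *)
Definition holomorphic_on Omega (f : Cn -> C) : Prop :=
  forall z, Omega z -> differentiable f z.

Definition int_pow p Omega (f : Cn -> C) : \bar R :=
  (\int[@lebesgue_Cn R n]_(t in @to_Cn R n @^-1` Omega)
     ((normc (f (to_Cn t))) `^ p)%:E)%E.

Definition Ap p Omega (f : Cn -> C) : Prop :=
  holomorphic_on Omega f /\ (int_pow p Omega f < +oo)%E.

Definition Ap_norm p Omega (f : Cn -> C) : R :=
  (fine (int_pow p Omega f)) `^ p^-1.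

Definition K_diag p Omega (z : Cn) : R :=
  sup [set (normc (f z)) `^ p | f in [set f | Ap p Omega f /\
                                              Ap_norm p Omega f = 1]].

Definition m_inf p Omega (z : Cn) : R :=
  inf [set Ap_norm p Omega f | f in [set f | Ap p Omega f /\ f z = 1]].

Definition is_minimizer p Omega (z : Cn) (f : Cn -> C) : Prop :=
  [/\ Ap p Omega f, f z = 1 & Ap_norm p Omega f = m_inf p Omega z].

(* For z in Omega, xget picks a minimizer, and all of them agree on Omega. *)
Definition m_min p Omega (zeta z : Cn) : C :=
  xget (cst 0) [set f | is_minimizer p Omega z f] zeta.

Definition K_off p Omega (zeta z : Cn) : C :=
  (K_diag p Omega z)%:C * m_min p Omega zeta z.

Definition Holder (alpha : R) (E : set Cn) (u : Cn -> C) : Prop :=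
  exists M : R, forall x y, E x -> E y ->
    normc (u x - u y) <= M * (enorm (x - y)) `^ alpha.

Definition Holder_loc (alpha : R) Omega (u : Cn -> C) : Prop :=
  forall E : set Cn, compact E -> E `<=` Omega -> Holder alpha E u.

(* g is a continuous extension of u|Omega to the closure of Omega; its values
   on the closure are uniquely determined. *)
Definition continuous_extension Omega (u g : Cn -> C) : Prop :=
  {within closure Omega, continuous g} /\
  (forall x, Omega x -> g x = u x).

Definition C_closure Omega (u : Cn -> C) : Prop :=
  exists g, continuous_extension Omega u g.

Definition Holder_closure (alpha : R) Omega (u : Cn -> C) : Prop :=
  exists2 g : Cn -> C, Holder alpha (closure Omega) g &
    forall x, Omega x -> g x = u x.

End bergman.

(* Main.v *)
Require Import Defs.
From HB Require Import structures.
From mathcomp Require Import all_boot all_order all_algebra complex.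
From mathcomp Require Import all_classical all_reals all_analysis.
From mathcomp Require Import measurable_realfun ring lra.
Import Order.TTheory GRing.Theory Num.Theory.
Import numFieldNormedType.Exports.

(* Let F = K_2(., z1) have a zero in Omega. Since F(0) <> 0, there is a least t0
   in ]0, 1[ such that F(t0 zeta0) = 0 for some zeta0 in the closure of Omega;
   zeta0 is then a boundary point. Invariance under rotations and the maximum
   principle give K_2(t zeta, z) = K_2(zeta, t z) for t in [0, 1], so
   K_2(., t z1) = F(t .) has no zero in Omega for t <= t0. A zero-free function on
   Omega has holomorphic roots of order k = 2^j, and by uniqueness of the
   minimizers |K_2(., t z1)| is then a constant times |K_2k(., t z1)|^k; hence
   K_2k(zeta, t0 z1) tends to 0 as zeta tends to zeta0 radially. If all K_2k were
   Hoelder continuous with the same exponent alpha, in either variable, then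
   |F((1 - s) t0 zeta0)| = O(s^(alpha k)) for all k = 2^j. Therefore the function
   l |-> F(l t0 zeta0), holomorphic for |l| < 1/t0, vanishes to infinite order at
   the interior point l = 1, so F(0) = 0, a contradiction. *)

Set Implicit Arguments.
Unset Strict Implicit.
Unset Printing Implicit Defensive.

Local Open Scope classical_set_scope.
Local Open Scope ring_scope.
Local Open Scope complex_scope.
Local Notation Re := complex.Re.
Local Notation Im := complex.Im.

(** * Norms and differentiability over C *)

(** One number is seen in two ways. [K_2k(., t0 z1)] vanishes at [zeta0] only as a radial boundary
    value, whereas [K_2(., z1)] is holomorphic around [t0 zeta0], which lies inside [Omega] because
    [t0 < 1]. The identity between the two moduli is proved in the interior and carried to [zeta0]
    by radial limits; continuous extensions and Hoelder estimates both supply these. Orders [2 ^ j]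
    suffice because [alpha * 2 ^ j] is unbounded, and they call only for iterated square roots. Such
    roots can be built by continuation along the segments from [0], all of which lie in [Omega]. The
    constant in the identity is [N ^ (k - 1)], where [N] is the least squared norm for the point
    [t z1]. It varies with [t], which matters when the second variable moves; comparison with the
    constant function [1] bounds it by the volume of [Omega]. The decay at [l = 1] is known on a
    real segment only. It is exploited without power series: the mean value property gives a maximum
    principle, and repeated division by a Blaschke factor then forces the value at the center to
    vanish. *)

Section nr.
Variable R : realType.
Local Notation C := R[i].

Lemma normcD (x y : C) : normc (x + y) <= normc x + normc y.
Proof. exact: le_normcD. Qed.

Lemma normcNr (x : C) : normc (- x) = normc x.
Proof. exact: normcN. Qed.

Lemma normc_ge0 (x : C) : 0 <= normc x.
Proof. by case: x => a b; exact: sqrtr_ge0. Qed.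

Lemma normcB (x y : C) : normc (x - y) <= normc x + normc y.
Proof. by rewrite -(normcNr y) normcD. Qed.

Lemma distcC (x y : C) : normc (x - y) = normc (y - x).
Proof. by rewrite -normcNr opprB. Qed.

Lemma normcX (x : C) k : normc (x ^+ k) = normc x ^+ k.
Proof. by elim: k => [|k ih]; rewrite ?normc1// !exprS normcM ih. Qed.

Lemma normc_real (r : R) : normc r%:C = `|r|.
Proof. by rewrite /normc /= expr0n addr0 sqrtr_sqr. Qed.

Lemma normc_eq0 (x : C) : (normc x == 0) = (x == 0).
Proof. by apply/eqP/eqP => [/eq0_normc//|->]; exact: normc0. Qed.

Lemma normc_gt0 (x : C) : (0 < normc x) = (x != 0).
Proof. by rewrite lt_neqAle normc_ge0 andbT eq_sym normc_eq0. Qed.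

Lemma le_Re_normc (x : C) : Re x <= normc x.
Proof.
case: x => a b /=; apply: le_trans (ler_norm a) _.
by rewrite -sqrtr_sqr ler_wsqrtr// lerDl sqr_ge0.
Qed.

Lemma le_absRe_normc (x : C) : `|Re x| <= normc x.
Proof.
case: x => a b /=.
by rewrite -sqrtr_sqr ler_wsqrtr// lerDl sqr_ge0.
Qed.

Lemma le_absIm_normc (x : C) : `|Im x| <= normc x.
Proof.
case: x => a b /=.
by rewrite -sqrtr_sqr ler_wsqrtr// lerDr sqr_ge0.
Qed.

Lemma normc_le_ReIm (x : C) : normc x <= `|Re x| + `|Im x|.
Proof.
case: x => a b /=; rewrite -ler_sqr ?nnegrE ?addr_ge0 ?sqrtr_ge0//.
rewrite sqr_sqrtr ?addr_ge0 ?sqr_ge0// sqrrD !real_normK ?num_real//.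
by rewrite lerD2r lerDl mulrn_wge0// mulr_ge0.
Qed.

(* Norms over [C] take their values in [C]; [nr v] is the same number in [R]. *)
Definition nr (V : normedModType C) (v : V) : R := Re `|v|.

Section basic.
Variables V : normedModType C.
Implicit Types v w : V.

Lemma nrE v : `|v| = (nr v)%:C.
Proof. by rewrite /nr RRe_real// normr_real. Qed.

Lemma nr_ge0 v : 0 <= nr v.
Proof. by rewrite -lecR -nrE normr_ge0. Qed.

Lemma nrD v w : nr (v + w) <= nr v + nr w.
Proof. by rewrite -lecR rmorphD/= -!nrE ler_normD. Qed.

Lemma nrN v : nr (- v) = nr v.
Proof. by rewrite /nr normrN. Qed.

Lemma nrZ (c : C) v : nr (c *: v) = normc c * nr v.
Proof.
apply: (@complexI R); rewrite -nrE rmorphM/= normrZ nrE; congr (_ * _).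
Qed.

Lemma nr0 : nr (0 : V) = 0.
Proof. by rewrite /nr normr0. Qed.

Lemma nr_eq0 v : (nr v == 0) = (v == 0).
Proof. by rewrite -(inj_eq (@complexI R)) -nrE normr_eq0. Qed.

(** Balls have radii in [R[i]], but a positive element of [R[i]] is real, so real radii describe the
    same neighbourhoods. *)
Lemma nbhs_nrP (x : V) (P : set V) :
  nbhs x P <-> exists2 d : R, 0 < d & forall y, nr (y - x) < d -> P y.
Proof.
split=> [/nbhs_ballP[e e0 eP]|[d d0 dP]].
  have eE : e = (Re e)%:C by rewrite RRe_real// gtr0_real.
  exists (Re e); first by rewrite -ltcR -eE.
  move=> y yx; apply: eP; rewrite -ball_normE /ball_/= eE distrC nrE.
  by rewrite ltcR.
apply/nbhs_ballP; exists d%:C; first by rewrite /= (ltcR 0 d).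
move=> y; rewrite -ball_normE /ball_/= distrC nrE ltcR; exact: dP.
Qed.

Lemma open_nrP (U : set V) : open U <-> forall x, U x ->
  exists2 d : R, 0 < d & forall y, nr (y - x) < d -> U y.
Proof.
by rewrite openE; split => h x /h /nbhs_nrP.
Qed.

End basic.

Lemma nr_C (z : C) : nr z = normc z.
Proof. by case: z. Qed.

Lemma continuous_nrP (V W : normedModType C) (f : V -> W) x :
  {for x, continuous f} <-> forall e : R, 0 < e -> exists2 d : R, 0 < d &
    forall h, nr h < d -> nr (f (x + h) - f x) < e.
Proof.
split=> [fx e e0|h P /nbhs_nrP[e e0 eP]].
  have /fx/nbhs_nrP[d d0 dP] : nbhs (f x) [set y | nr (y - f x) < e].
    by apply/nbhs_nrP; exists e.
  by exists d => // h hd; apply: dP; rewrite [x + h]addrC addrK.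
have [d d0 dP] := h _ e0; apply/nbhs_nrP; exists d => // y yx.
by apply: eP; have := dP _ yx; rewrite subrKC.
Qed.

(** The linear map is existential, so that any candidate can be exhibited; [diff_unique] then
    identifies it with ['d f x]. *)
Lemma differentiable_nrP (V W : normedModType C) (f : V -> W) x :
  differentiable f x <-> exists L : {linear V -> W}, continuous L /\
    forall e : R, 0 < e -> exists2 d : R, 0 < d &
    forall h, nr h < d -> nr (f (x + h) - f x - L h) <= e * nr h.
Proof.
split=> [df|[L [Lc h]]].
  exists ('d f x); split; first exact: diff_continuous.
  have /eqaddoP hf := diff_locally df.
  move=> e e0; have e0' : 0 < e%:C by rewrite (ltcR 0 e).
  have /nbhs_nrP[d d0 dP] := hf _ e0'; exists d => // h hd.
  have := dP h; rewrite subr0 => /(_ hd) /=.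
  by rewrite /= !fctE !nrE -rmorphM lecR [h + x]addrC opprD addrA.
have fL : f \o shift x = cst (f x) + L +o_ 0 id.
  apply/eqaddoP => e e0.
  have eE : e = (Re e)%:C by rewrite RRe_real// gtr0_real.
  have [|d d0 dP] := h (Re e); first by rewrite -ltcR -eE.
  apply/nbhs_nrP; exists d => // y; rewrite subr0 => /dP /=.
  by rewrite eE !fctE/= !nrE -rmorphM lecR [y + x]addrC opprD addrA.
by apply/diff_locallyP; rewrite (diff_unique Lc fL).
Qed.

Lemma differentiable_eq_near (V W : normedModType C) (f g : V -> W) x :
  (exists2 d : R, 0 < d & forall h, nr h < d -> f (x + h) = g (x + h)) ->
  differentiable f x -> differentiable g x.
Proof.
move=> [d d0 fg] /differentiable_nrP[L [Lc h]].
apply/differentiable_nrP; exists L; split=> // e e0.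
have [d' d'0 hd'] := h _ e0; exists (Num.min d d'); first by rewrite lt_min d0.
move=> k; rewrite lt_min => /andP[kd kd'].
rewrite -fg// -[in g x](addr0 x) -fg ?nr0// addr0; exact: hd'.
Qed.

Lemma differentiable_mul (V : normedModType C) (f g : V -> C) x :
  differentiable f x -> differentiable g x -> differentiable (fun z => f z * g z) x.
Proof. exact: differentiableM. Qed.

Lemma differentiable_inv (V : normedModType C) (f : V -> C) x :
  differentiable f x -> f x != 0 -> differentiable (fun z => (f z)^-1) x.
Proof. exact: differentiableV. Qed.

Lemma differentiable_sub (V : normedModType C) (f g : V -> C) x :
  differentiable f x -> differentiable g x -> differentiable (fun z => f z - g z) x.
Proof. exact: differentiableB. Qed.

Lemma differentiable_add (V : normedModType C) (f g : V -> C) x :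
  differentiable f x -> differentiable g x -> differentiable (fun z => f z + g z) x.
Proof. exact: differentiableD. Qed.

Lemma differentiable_var (V : normedModType C) (x : V) : differentiable (fun z : V => z) x.
Proof. exact: ex_diff. Qed.

Lemma differentiable_pow (V : normedModType C) (f : V -> C) n x :
  differentiable f x -> differentiable (fun z => f z ^+ n) x.
Proof.
move=> df; elim: n => [|n ih]; first exact: differentiable_cst.
by under eq_fun do rewrite exprS; exact: differentiableM.
Qed.

Lemma continuous_sub (V : normedModType C) (f g : V -> C) x :
  {for x, continuous f} -> {for x, continuous g} ->
  {for x, continuous (fun z => f z - g z)}.
Proof. by move=> cf cg; exact: (continuousB cf cg). Qed.

Lemma continuous_mul (V : normedModType C) (f g : V -> C) x :
  {for x, continuous f} -> {for x, continuous g} ->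
  {for x, continuous (fun z => f z * g z)}.
Proof. by move=> cf cg; exact: (continuousM cf cg). Qed.

Lemma continuous_pow (V : normedModType C) (f : V -> C) n x :
  {for x, continuous f} -> {for x, continuous (fun z => f z ^+ n)}.
Proof.
move=> cf; elim: n => [|n ih]; first exact: cst_continuous.
suff : continuous_at x (fun z => f z ^+ n.+1) by [].
rewrite (_ : (fun z => _) = fun z => f z * f z ^+ n); last first.
  by apply/funext => z; rewrite exprS.
exact: (continuous_mul cf ih).
Qed.

End nr.

Section powers.
Variable R : realType.
Implicit Types x y z e : R.

Lemma divr2_gt0 e : 0 < e -> 0 < e / 2.
Proof. by move=> e0; rewrite divr_gt0. Qed.

Lemma expr_small z e : 0 <= z < 1 -> 0 < e -> exists n, z ^+ n < e.
Proof.
move=> /andP[z0 z1] e0; have /cvg_expr/cvgrPdist_lt/(_ e e0) : `|z| < 1 by rewrite ger0_norm.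
move=> [n _ /(_ n (leqnn n))] /=; rewrite sub0r normrN ger0_norm ?exprn_ge0// => h.
by exists n.
Qed.

Lemma expr_large x y : 1 < y -> exists n, x < y ^+ n.
Proof.
move=> y1; have y0 := lt_trans ltr01 y1.
have [||n hn] := @expr_small y^-1 (`|x| + 1)^-1.
- by rewrite invr_ge0 ltW//= invf_lt1.
- by rewrite invr_gt0 ltr_wpDl.
exists n; move: hn; rewrite exprVn ltf_pV2 ?posrE ?exprn_gt0 ?ltr_wpDl//.
by move=> h; have := ler_norm x; lra.
Qed.

End powers.

(** * Complex derivatives in one variable *)

Section disc.
Variable R : realType.
Local Notation C := R[i].

Definition cderiv (f : C -> C) (a l : C) := forall e : R, 0 < e ->
  exists2 d : R, 0 < d &
  forall h, normc h < d -> normc (f (a + h) - f a - l * h) <= e * normc h.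

Lemma differentiable_cderiv (f : C -> C) a :
  differentiable f a <-> exists l, cderiv f a l.
Proof.
rewrite differentiable_nrP; split=> [[L [_ h]]|[l h]].
  exists (L 1) => e e0; have [d d0 dP] := h _ e0; exists d => // k kd.
  have := dP k; rewrite !nr_C => /(_ kd).
  suff -> : L k = L 1 * k by [].
  by rewrite -[in LHS](mulr1 k) -[k * 1]/(k *: (1 : C^o)) linearZ/= mulrC.
have lL : linear (fun x : C => l * x) by move=> a' u v; rewrite /= mulrDr /GRing.scale /= mulrCA.
pose lM := GRing.isLinear.Build _ _ _ _ _ lL.
pose L : {linear C -> C} := HB.pack (fun x : C => l * x) lM.
exists L; split=> [x|e e0].
  exact: mulrl_continuous.
have [d d0 dP] := h _ e0; exists d => // k; rewrite !nr_C; exact: dP.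
Qed.

Lemma continuous_normcP (f : C -> C) a :
  {for a, continuous f} <-> forall e : R, 0 < e -> exists2 d : R, 0 < d &
    forall h, normc h < d -> normc (f (a + h) - f a) < e.
Proof. by rewrite continuous_nrP; split=> h e /h[d d0 dP]; exists d => // k; have := dP k; rewrite !nr_C. Qed.
End disc.

(** * Goursat's theorem and the mean value property *)

Section interval_integral.
Variable R : realType.
Implicit Types f g : R -> R.

Definition RI (a b : R) f : R := \int[@lebesgue_measure R]_(x in `[a, b]) f x.

(** Full continuity is demanded at the end points as well; the integrands below are all continuous
    beyond the segment. *)
Definition cts (a b : R) f := forall x, a <= x <= b -> {for x, continuous f}.

Lemma cts_integrable a b f : cts a b f ->
  (@lebesgue_measure R).-integrable `[a, b] (EFin \o f).
Proof.
move=> cf; apply: continuous_compact_integrable; first exact: segment_compact.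
apply: continuous_in_subspaceT => x; rewrite inE/= in_itv/=; exact: cf.
Qed.

Lemma ctsB a b f g : cts a b f -> cts a b g -> cts a b (fun x => f x - g x).
Proof. by move=> cf cg x xab; apply: continuousB; [exact: cf|exact: cg]. Qed.

Lemma RI_split a m b f : a <= m -> m <= b -> cts a b f ->
  RI a b f = RI a m f + RI m b f.
Proof.
move=> am mb cf; have := @Rintegral_itvB R f (BLeft a) (BRight b) m.
move=> /(_ (cts_integrable cf)); rewrite !bnd_simp => /(_ am mb).
rewrite Rintegral_itv_obnd_cbnd; last first.
  apply: integrableS (cts_integrable cf) => //.
  by apply: subset_itvr; rewrite bnd_simp.
by rewrite /RI => <-; rewrite subrKC.
Qed.

Lemma RI_B a b f g : cts a b f -> cts a b g ->
  RI a b (fun x => f x - g x) = RI a b f - RI a b g.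
Proof. by move=> cf cg; apply: RintegralB => //; exact: cts_integrable. Qed.

Lemma RI_cst a b (c : R) : a <= b -> RI a b (fun=> c) = c * (b - a).
Proof.
move=> ab; rewrite /RI Rintegral_cst//= lebesgue_measure_itv/= lte_fin.
by case: ltgtP ab => // [->]; rewrite subrr.
Qed.

Lemma RI_le a b f g : cts a b f -> cts a b g ->
  (forall x, a <= x <= b -> f x <= g x) -> RI a b f <= RI a b g.
Proof.
move=> cf cg fg; apply: (le_Rintegral _ (cts_integrable cf) (cts_integrable cg)) => // x; exact: fg.
Qed.

Lemma cts_cst a b (c : R) : cts a b (fun=> c).
Proof. by move=> x _; exact: cst_continuous. Qed.

Lemma RI_near_cst a b f (c e : R) : a <= b -> cts a b f ->
  (forall x, a <= x <= b -> `|f x - c| <= e) ->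
  `|RI a b f - c * (b - a)| <= e * (b - a).
Proof.
move=> ab cf fc; rewrite ler_distl -mulrBl -mulrDl -!RI_cst//.
apply/andP; split; apply: RI_le => // x xab; rewrite ?cts_cst//; try exact: cst_continuous;
by have := fc x xab; rewrite ler_distl => /andP[].
Qed.

End interval_integral.

Section goursat.
Variable R : realType.
Local Notation C := R[i].
Variables (F : R -> R -> C) (X0 : R).
(** [F x y] is a holomorphic function of [x + i y] on a left half-plane, and [beta] is its complex
    derivative. *)
Hypothesis dF : forall x y, x < X0 -> exists beta : C, forall e : R, 0 < e ->
  exists2 d : R, 0 < d & forall h k, `|h| < d -> `|k| < d ->
    normc (F (x + h) (y + k) - F x y - beta * (h +i* k)) <= e * (`|h| + `|k|).

Let Fcont x y : x < X0 -> forall e : R, 0 < e -> exists2 d : R, 0 < d &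
  forall h k, `|h| < d -> `|k| < d -> normc (F (x + h) (y + k) - F x y) < e.
Proof.
move=> xX e e0; have [b hb] := dF y xX.
have [d d0 dP] := hb _ ltr01.
pose M := 1 + normc b; have M0 : 0 < M by rewrite ltr_pwDl// normc_ge0.
exists (Num.min d (e / (M * 3))); first by rewrite lt_min d0 divr_gt0// mulr_gt0.
move=> h k; rewrite !lt_min => /andP[hd he] /andP[kd ke].
have := dP h k hd kd; set T := F _ _ - F _ _ => hT.
have : normc T <= normc (T - b * (h +i* k)) + normc (b * (h +i* k)).
  by rewrite -[in normc T](subrK (b * (h +i* k)) T) normcD.
move=> /le_lt_trans; apply.
have : normc (b * (h +i* k)) <= normc b * (`|h| + `|k|).
  rewrite normcM ler_wpM2l ?normc_ge0//; exact: (normc_le_ReIm (h +i* k)).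
move=> hb2; apply: (le_lt_trans (lerD hT hb2)); rewrite -mulrDl -/M.
move: he ke; rewrite !ltr_pdivlMr ?mulr_gt0//.
by move=> he ke; nra.
Qed.

Let ctsRe1 a b y : b < X0 -> cts a b (fun x => Re (F x y)).
Proof.
move=> bX x /andP[_ xb] ; apply/cvgrPdist_lt => e e0.
have [d d0 dP] := Fcont y (le_lt_trans xb bX) e0.
apply/nbhs_ballP; exists d => //= t; rewrite /ball/= distrC => xt.
have := dP (t - x) 0 xt; rewrite normr0 addr0 subrKC => /(_ d0).
apply: le_lt_trans; rewrite distrC -raddfB/=.
exact: (le_trans _ (le_absRe_normc _)).
Qed.

Let ctsIm2 c d x : x < X0 -> cts c d (fun y => Im (F x y)).
Proof.
move=> xX y _; apply/cvgrPdist_lt => e e0.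
have [d' d0 dP] := Fcont y xX e0.
apply/nbhs_ballP; exists d' => //= t; rewrite /ball/= distrC => xt.
have := dP 0 (t - y); rewrite normr0 addr0 subrKC => /(_ d0 xt).
apply: le_lt_trans; rewrite distrC -raddfB/=.
exact: (le_trans _ (le_absIm_normc _)).
Qed.

(* The real part of the integral of [F (x + i y)] along the boundary of
   [a, b] x [c, d]. *)
Let contour a b c d : R := RI a b (fun x => Re (F x c) - Re (F x d)) -
  RI c d (fun y => Im (F b y) - Im (F a y)).

Let contour_splitx a m b c d : a <= m -> m <= b -> b < X0 ->
  contour a b c d = contour a m c d + contour m b c d.
Proof.
move=> am mb bX; rewrite /contour.
rewrite (@RI_split _ a m b)//; last by apply: ctsB; exact: ctsRe1.
have mX := le_lt_trans mb bX; have aX := le_lt_trans am mX.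
rewrite !RI_B; try exact: ctsIm2; try exact: ctsRe1.
by ring.
Qed.

Let contour_splity a b c m d : a <= b -> c <= m -> m <= d -> b < X0 ->
  contour a b c d = contour a b c m + contour a b m d.
Proof.
move=> ab cm md bX; rewrite /contour.
have aX := le_lt_trans ab bX.
rewrite (@RI_split _ c m d)//; last by apply: ctsB; exact: ctsIm2.
rewrite !RI_B; try exact: ctsIm2; try exact: ctsRe1.
by ring.
Qed.

(** The affine approximation of [F] at the given point drops out: both integrals contribute
    [Im be * (b - a) * (d - c)], with opposite signs. What remains is an error of size [2 * e * s]
    on four sides of length at most [s]. *)
Let contour_small x y e : x < X0 -> 0 < e -> exists2 d' : R, 0 < d' &
  forall a b c d s, a <= x <= b -> c <= y <= d -> b < X0 ->
    b - a <= s -> d - c <= s -> s < d' ->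
    `|contour a b c d| <= 8 * e * s ^+ 2.
Proof.
move=> xX e0; have [be hb] := dF y xX; have [d' d0 dP] := hb _ e0.
exists d' => // a b c d s /andP[ax xb] /andP[cy yd] bX bas dcs sd.
have ab := le_trans ax xb; have cd := le_trans cy yd.
pose E u v := F u v - F x y - be * ((u - x) +i* (v - y)).
have EP u v : a <= u <= b -> c <= v <= d -> normc (E u v) <= 2 * e * s.
  move=> /andP[au ub] /andP[cv vd].
  have h1 : `|u - x| <= s by rewrite ler_distl; apply/andP; split; lra.
  have h2 : `|v - y| <= s by rewrite ler_distl; apply/andP; split; lra.
  have := dP (u - x) (v - y) (le_lt_trans h1 sd) (le_lt_trans h2 sd).
  rewrite !subrKC => /le_trans; apply.
  apply: le_trans (_ : e * (s + s) <= _); first by rewrite ler_pM2l//; apply: lerD.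
  by rewrite le_eqVlt; apply/orP; left; apply/eqP; ring.
have FE u v : F u v = E u v + F x y + be * ((u - x) +i* (v - y)).
  by rewrite /E; ring.
have h1 : `|RI a b (fun u => Re (F u c) - Re (F u d)) - (Im be * (d - c)) * (b - a)|
    <= (4 * e * s) * (b - a).
  apply: RI_near_cst => //; first by apply: ctsB; exact: ctsRe1.
  move=> u uab.
  have -> : Re (F u c) - Re (F u d) - Im be * (d - c) = Re (E u c) - Re (E u d).
    by rewrite (FE u c) (FE u d) !raddfD/=; case: (be) => p q /=; ring.
  apply: le_trans (ler_normB _ _) _.
  have -> : 4 * e * s = 2 * e * s + 2 * e * s by ring.
  by apply: lerD; apply: (le_trans (le_absRe_normc _)); apply: EP => //; rewrite ?lexx ?cd ?ab.
have h2 : `|RI c d (fun v => Im (F b v) - Im (F a v)) - (Im be * (b - a)) * (d - c)|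
    <= (4 * e * s) * (d - c).
  apply: RI_near_cst => //.
    by apply: ctsB; apply: ctsIm2 => //; apply: le_lt_trans bX.
  move=> v vab.
  have -> : Im (F b v) - Im (F a v) - Im be * (b - a) = Im (E b v) - Im (E a v).
    by rewrite (FE b v) (FE a v) !raddfD/=; case: (be) => p q /=; ring.
  apply: le_trans (ler_normB _ _) _.
  have -> : 4 * e * s = 2 * e * s + 2 * e * s by ring.
  by apply: lerD; apply: (le_trans (le_absIm_normc _)); apply: EP => //; rewrite ?lexx ?cd ?ab.
rewrite /contour; set P := RI _ _ _ in h1 *; set Q := RI _ _ _ in h2 *.
have -> : P - Q = (P - Im be * (d - c) * (b - a)) - (Q - Im be * (b - a) * (d - c)).
  by ring.
apply: le_trans (ler_normB _ _) _; apply: (le_trans (lerD h1 h2)).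
have s0 : 0 <= s by lra.
have k0 : 0 <= 4 * e * s by rewrite !mulr_ge0// ltW.
apply: le_trans (_ : 4 * e * s * s + 4 * e * s * s <= _).
  by apply: lerD; rewrite ler_wpM2l.
by rewrite le_eqVlt; apply/orP; left; apply/eqP; ring.
Qed.

Let contour_quarter a c h k eta : 0 <= h -> 0 <= k -> a + h + h < X0 ->
  4 * eta <= `|contour a (a + h + h) c (c + k + k)| ->
  exists p : R * R, [/\ p.1 = a \/ p.1 = a + h, p.2 = c \/ p.2 = c + k &
    eta <= `|contour p.1 (p.1 + h) p.2 (p.2 + k)|].
Proof.
move=> h0 k0 aX ge.
have aX' : a + h < X0 by lra.
apply: contrapT => /forallNP no.
have lt p : (p.1 = a \/ p.1 = a + h) -> (p.2 = c \/ p.2 = c + k) ->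
  `|contour p.1 (p.1 + h) p.2 (p.2 + k)| < eta.
  by move=> p1 p2; rewrite ltNge; apply/negP => q; exact: (no p).
have := lt (a, c) (or_introl erefl) (or_introl erefl).
have := lt (a, c + k) (or_introl erefl) (or_intror erefl).
have := lt (a + h, c) (or_intror erefl) (or_introl erefl).
have := lt (a + h, c + k) (or_intror erefl) (or_intror erefl).
move: ge; rewrite (@contour_splitx a (a + h))//; [|lra|lra].
rewrite (@contour_splity a (a + h) c (c + k))//; [|lra|lra|lra].
rewrite (@contour_splity (a + h) (a + h + h) c (c + k))//; [|lra|lra|lra].
rewrite /=; set A := contour _ _ _ _; set B := contour _ _ _ _.
set D := contour _ _ _ _; set E := contour _ _ _ _ => ge h1 h2 h3 h4.
have := ler_normD (A + B) (D + E); have := ler_normD A B; have := ler_normD D E.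
lra.
Qed.

(** Goursat's bisection: a contour integral of modulus [eta] leaves a rectangle of generation [n]
    with at least [eta / 4 ^ n], and [contour_small] at the common point of these rectangles
    contradicts this. The real part of Cauchy's theorem is enough: it controls [Im g] below, and
    [Re g] through ['i * g]. *)
Lemma contour_eq0 a b c d : a <= b -> c <= d -> b < X0 ->
  RI a b (fun x => Re (F x c) - Re (F x d)) =
  RI c d (fun y => Im (F b y) - Im (F a y)).
Proof.
move=> ab cd bX; apply/eqP; rewrite -subr_eq0 -normr_le0 leNgt; apply/negP.
set eta := `| _ |; rewrite -/(contour a b c d) in eta * => eta0.
pose sx n : R := (b - a) / 2 ^+ n; pose sy n : R := (d - c) / 2 ^+ n.
have sx0 n : 0 <= sx n by rewrite divr_ge0 ?subr_ge0 ?exprn_ge0.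
have sy0 n : 0 <= sy n by rewrite divr_ge0 ?subr_ge0 ?exprn_ge0.
have n2 n : 2 ^+ n != 0 :> R by rewrite expf_neq0.
have sxS n : sx n = sx n.+1 + sx n.+1.
  by rewrite /sx exprS; field.
have syS n : sy n = sy n.+1 + sy n.+1.
  by rewrite /sy exprS; field.
pose P n (p : R * R) := [/\ a <= p.1, p.1 + sx n <= b &
  eta / 4 ^+ n <= `|contour p.1 (p.1 + sx n) p.2 (p.2 + sy n)|].
have step (np : nat * (R * R)) : exists p', P np.1 np.2 -> [/\ P np.1.+1 p',
   np.2.1 <= p'.1 <= np.2.1 + sx np.1.+1 & np.2.2 <= p'.2 <= np.2.2 + sy np.1.+1].
  case: np => n p /=.
  have [Pnp|] := pselect (P n p); last by exists p.
  have [ap pb ge] := Pnp.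
  have := @contour_quarter p.1 p.2 (sx n.+1) (sy n.+1) (eta / 4 ^+ n.+1) (sx0 _) (sy0 _).
  rewrite -!addrA -sxS -syS => /(_ (le_lt_trans pb bX)) [].
    apply: le_trans ge; rewrite exprS le_eqVlt; apply/orP; left; apply/eqP.
    by have : 4 ^+ n != 0 :> R by [rewrite expf_neq0]; move=> ?; field.
  move=> p' [p1 p2 hp']; exists p' => _.
  have s1 := sxS n; have := sx0 n.+1; have := sy0 n.+1 => y0 x0.
  split; last 2 first.
  - by apply/andP; case: p1 => ->; split; lra.
  - by apply/andP; case: p2 => ->; split; lra.
  by split => //; case: p1 => ->; lra.
have [f fP] := choice step.
pose q := fix q n := if n is m.+1 then f (m, q m) else (a, c).
have q0 : P 0 (q 0%N).
  by rewrite /P /sx /sy /= expr0 !divr1 !subrKC; split.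
have qP n : P n (q n) by elim: n => // n ih; have [] := fP (n, q n) ih.
have q1 n : (q n).1 <= (q n.+1).1 <= (q n).1 + sx n.+1.
  by have [] := fP (n, q n) (qP n).
have q2 n : (q n).2 <= (q n.+1).2 <= (q n).2 + sy n.+1.
  by have [] := fP (n, q n) (qP n).
(* Nested intervals, applied to each coordinate separately. *)
have nest (u s : nat -> R) : (forall n, 0 <= s n) -> (forall n, s n = s n.+1 + s n.+1) ->
    (forall n, u n <= u n.+1 <= u n + s n.+1) ->
    exists x, forall n, u n <= x <= u n + s n.
  move=> s0 ss us.
  have mono n m : u n <= u (n + m)%N.
    elim: m => [|m ih]; first by rewrite addn0.
    by rewrite addnS; have /andP[h _] := us (n + m)%N; exact: le_trans ih h.
  have upS n m : u (n + m)%N + s (n + m)%N <= u n + s n.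
    elim: m => [|m ih]; first by rewrite addn0.
    rewrite addnS; have /andP[_ h] := us (n + m)%N; have := ss (n + m)%N; lra.
  have ub n : ubound (range u) (u n + s n).
    move=> _ [m _ <-]; have [nm|mn] := leqP n m.
      by rewrite -(subnKC nm); have := upS n (m - n)%N; have := s0 (n + (m - n))%N; lra.
    have := mono m (n - m)%N; rewrite subnKC; last exact: ltnW.
    by have := s0 n; lra.
  exists (sup (range u)) => n; apply/andP; split.
    by apply: ub_le_sup; [exists (u 0%N + s 0%N); exact: ub|exists n].
  by apply: ge_sup; [exists (u 0%N); exists 0%N|exact: ub].
have [x xP] := nest _ _ sx0 sxS q1.
have [y yP] := nest _ _ sy0 syS q2.
pose S := (b - a) + (d - c) + 1.
have S0 : 0 < S by rewrite /S; lra.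
have xX : x < X0.
  have /andP[_ h] := xP 0%N; apply: le_lt_trans bX.
  by have [_ ? _] := qP 0%N; lra.
(* For this [e] and [s = S / 2 ^ n], the bound [8 * e * s ^+ 2] is half of [eta / 4 ^ n]. *)
have e0 : 0 < eta / (16 * S ^+ 2) by rewrite divr_gt0// mulr_gt0// exprn_gt0.
have [d' d'0 small] := contour_small y xX e0.
have [n hn] : exists n : nat, S / 2 ^+ n < d'.
  have [n hn] := @expr_large R (S / d') 2 (ltr1n _ 2).
  by exists n; rewrite ltr_pdivrMr ?exprn_gt0// mulrC -ltr_pdivrMr.
have [qa qb qge] := qP n.
have := small (q n).1 ((q n).1 + sx n) (q n).2 ((q n).2 + sy n) (S / 2 ^+ n) (xP n) (yP n)
  (le_lt_trans qb bX).
have i0 : 0 < (2 ^+ n)^-1 :> R by rewrite invr_gt0 exprn_gt0.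
rewrite ![_ + _ n - _]addrC !addKr => /(_ _ _ hn).
rewrite /sx /sy !ler_pM2r// /S => /(_ _ _)/(le_trans qge).
have -> : 8 * (eta / (16 * (b - a + (d - c) + 1) ^+ 2)) *
    ((b - a + (d - c) + 1) / 2 ^+ n) ^+ 2 = eta / 4 ^+ n / 2.
  have -> : 4 = 2 ^+ 2 :> R by ring.
  by rewrite -exprM mulnC exprM; have := n2 n; have := lt0r_neq0 S0; rewrite /S => ? ?; field; apply/andP; split.
have : 0 < eta / 4 ^+ n by rewrite divr_gt0// exprn_gt0.
by move=> w0 /(_ _ _) w1; suff : eta / 4 ^+ n <= eta / 4 ^+ n / 2 by [lra]; apply: w1; lra.
Qed.
End goursat.

Section mean_value.
Variable R : realType.
Local Notation C := R[i].
Implicit Types x y h k r : R.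

Definition cis (y : R) : C := cos y +i* sin y.

Lemma normc_cis y : normc (cis y) = 1.
Proof. by rewrite /cis /normc cos2Dsin2 sqrtr1. Qed.

Lemma cisD x y : cis (x + y) = cis x * cis y.
Proof.
rewrite /cis cosD sinD.
by apply/eqP; rewrite eq_complex/=; apply/andP; split; apply/eqP; ring.
Qed.

(* In the coordinates [z = E x y = exp (x + i y)] the circles around [0] become
   segments, and the mean value property follows from Goursat's theorem for
   rectangles whose left side tends to [-oo]. *)
Let E x y : C := (expR x)%:C * cis y.

Let ED x y h k : E (x + h) (y + k) = E x y * E h k.
Proof. by rewrite /E cisD expRD rmorphM/=; ring. Qed.

Let normE x y : normc (E x y) = expR x.
Proof. by rewrite normcM normc_cis mulr1 normc_real ger0_norm ?expR_ge0. Qed.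

Lemma is_derive_small (f : R -> R) l : is_derive (0 : R) (1 : R) f l ->
  forall e : R, 0 < e -> exists2 d : R, 0 < d &
  forall h, `|h| < d -> `|f h - f 0 - l * h| <= e * `|h|.
Proof.
move=> [df fl] e e0; move: df; rewrite /derivable => /cvg_ex[l' hl'].
have ll : l' = l by rewrite -fl; apply/esym; apply: cvg_lim.
rewrite {}ll in hl'; move/cvgrPdist_lt : hl' => /(_ e e0).
move=> /nbhs_ballP[d /= d0 dP].
exists d => // h hd; have [->|hn0] := eqVneq h 0.
  by rewrite subrr mulr0 subrr normr0 mulr0.
have := dP h; rewrite /ball/= sub0r normrN => /(_ hd hn0).
rewrite /= addr0 [h *: 1]mulr1 => hh.
have -> : f h - f 0 - l * h = - (h * (l - h^-1 *: (f h - f 0))).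
  by rewrite /GRing.scale/=; field.
by rewrite normrN normrM mulrC ler_wpM2r// ltW.
Qed.

(** The complex exponential has derivative [1] at [0], by the real derivatives of [expR], [cos] and
    [sin]; [ED] transports this to every point. *)
Let Esmall e : 0 < e -> exists2 d : R, 0 < d &
  forall h k, `|h| < d -> `|k| < d ->
    normc (E h k - 1 - (h +i* k)) <= e * (`|h| + `|k|).
Proof.
move=> e0; have [e1 [e10 e11 e18]] : exists e1 : R, [/\ 0 < e1, e1 <= 1 & e1 <= e / 8].
  exists (Num.min 1 (e / 8)); split; last 2 first.
  - by rewrite ge_min lexx.
  - by rewrite ge_min lexx orbT.
  by rewrite lt_min ltr01 divr_gt0.
have [d1 d10 h1] := is_derive_small (is_derive_expR (0 : R)) e10.
have [d2 d20 h2] := is_derive_small (is_derive_cos (0 : R)) e10.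
have [d3 d30 h3] := is_derive_small (is_derive_sin (0 : R)) e10.
rewrite expR0 in h1; rewrite cos0 sin0 in h2; rewrite sin0 cos0 in h3.
exists (Num.min (Num.min d1 d2) (Num.min d3 e1)); first by rewrite !lt_min d10 d20 d30 e10.
move=> h k; rewrite !lt_min => /andP[/andP[hd1 hd2] /andP[hd3 he1]].
move=> /andP[/andP[kd1 kd2] /andP[kd3 ke1]].
have := h1 h hd1; rewrite mul1r => hh1.
have := h2 k kd2; rewrite oppr0 mul0r subr0 => hh2.
have := h3 k kd3; rewrite subr0 mul1r => hh3.
apply: le_trans (normc_le_ReIm _) _; rewrite /E /cis /=.
pose A := expR h - 1 - h; have A1 : `|A| <= e1 * `|h| := hh1.
have -> : expR h * cos k - 0 * sin k - 1 - h = A * cos k + (1 + h) * (cos k - 1).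
  by rewrite /A; ring.
have -> : expR h * sin k + 0 * cos k - 0 - k = A * sin k + h * sin k + (sin k - k).
  by rewrite /A; ring.
have i1 : `|A * cos k| <= `|A| by rewrite normrM ler_piMr// cos_max.
have i2 : `|A * sin k| <= `|A| by rewrite normrM ler_piMr// sin_max.
have i3 : `|(1 + h) * (cos k - 1)| <= 2 * (e1 * `|k|).
  rewrite normrM; apply: ler_pM => //.
  by apply: le_trans (ler_normD _ _) _; rewrite normr1; lra.
have i4 : `|sin k| <= 2 * `|k|.
  have := ler_normD (sin k - k) k; rewrite subrK => /le_trans; apply.
  have := normr_ge0 k; nra.
have i5 : `|h * sin k| <= e1 * (2 * `|k|) by rewrite normrM ler_pM// ltW.
have j1 := ler_normD (A * cos k) ((1 + h) * (cos k - 1)).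
have j2 := ler_normD (A * sin k + h * sin k) (sin k - k).
have j3 := ler_normD (A * sin k) (h * sin k).
have p1 : e1 * `|h| <= e / 8 * `|h| by rewrite ler_wpM2r.
have p2 : e1 * `|k| <= e / 8 * `|k| by rewrite ler_wpM2r.
have q1 : 0 <= e * `|h| by rewrite mulr_ge0// ltW.
have q2 : 0 <= e * `|k| by rewrite mulr_ge0// ltW.
lra.
Qed.

Variables (g : C -> C) (rho : R).
Hypothesis dg : forall z, normc z < rho -> differentiable g z.

Let F x y := g (E x y).

Let dF x y : x < ln rho -> 0 < rho -> exists beta : C, forall e : R, 0 < e ->
  exists2 d : R, 0 < d & forall h k, `|h| < d -> `|k| < d ->
    normc (F (x + h) (y + k) - F x y - beta * (h +i* k)) <= e * (`|h| + `|k|).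
Proof.
move=> xr r0; pose z := E x y.
have zr : normc z < rho by rewrite normE -(@lnK _ rho)// ltr_expR.
have [l hl] := (differentiable_cderiv g z).1 (dg zr).
(* Chain rule: the exponential is its own derivative, with value [z] at the point. *)
exists (l * z) => e e0.
have M0 : 0 < expR x by exact: expR_gt0.
pose e1 := e / (expR x * 4).
have e10 : 0 < e1 by rewrite divr_gt0// mulr_gt0.
pose e2 := Num.min 1 (e / ((normc l + 1) * expR x * 2)).
have l0 := normc_ge0 l.
have lx0 : 0 < (normc l + 1) * expR x * 2 by rewrite !mulr_gt0// ltr_wpDl.
have e20 : 0 < e2 by rewrite lt_min ltr01 divr_gt0.
have e21 : e2 <= 1 by rewrite ge_min lexx.
have e22 : e2 * ((normc l + 1) * expR x * 2) <= e.
  by rewrite -ler_pdivlMr// ge_min lexx orbT.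
have [d1 d10 h1] := hl _ e10.
have [d2 d20 h2] := Esmall e20.
exists (Num.min d2 (d1 / (expR x * 4))).
  by rewrite lt_min d20 divr_gt0// mulr_gt0.
move=> h k; rewrite !lt_min => /andP[hd2 hd1] /andP[kd2 kd1].
have hh2 := h2 h k hd2 kd2.
pose w := E h k - 1.
have w2 : normc w <= 2 * (`|h| + `|k|).
  have := normcD (w - (h +i* k)) (h +i* k); rewrite subrK => /le_trans; apply.
  have nhk : normc (h +i* k) <= `|h| + `|k| := normc_le_ReIm _.
  have s0 : 0 <= `|h| + `|k| by rewrite addr_ge0.
  have := ler_wpM2r s0 e21; move: hh2; rewrite -/w; lra.
have -> : F (x + h) (y + k) = g (z + z * w).
  by rewrite /F ED /w -/z; congr g; ring.
have nz : normc z = expR x by rewrite normE.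
have nzw : normc (z * w) <= expR x * (2 * (`|h| + `|k|)).
  by rewrite normcM nz ler_wpM2l// ltW.
have zwd : normc (z * w) < d1.
  apply: le_lt_trans nzw _; move: hd1 kd1; rewrite !ltr_pdivlMr ?mulr_gt0//; lra.
have := h1 _ zwd => hh1; rewrite -/(F x y).
have -> : g (z + z * w) - F x y - l * z * (h +i* k) =
  (g (z + z * w) - g z - l * (z * w)) + l * z * (w - (h +i* k)) by rewrite /F -/z; ring.
apply: le_trans (normcD _ _) _.
have t1 : e1 * normc (z * w) <= e / 2 * (`|h| + `|k|).
  apply: le_trans (_ : e1 * (expR x * (2 * (`|h| + `|k|))) <= _).
    by rewrite ler_wpM2l// ltW.
  rewrite le_eqVlt; apply/orP; left; apply/eqP; rewrite /e1.
  by have := lt0r_neq0 M0 => ?; field.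
have t2 : normc (l * z * (w - (h +i* k))) <= e / 2 * (`|h| + `|k|).
  rewrite 2!normcM nz.
  apply: le_trans (_ : normc l * expR x * (e2 * (`|h| + `|k|)) <= _).
    by rewrite ler_wpM2l// mulr_ge0// ltW.
  rewrite mulrA ler_wpM2r ?addr_ge0//.
  have : 0 <= expR x * e2 by rewrite mulr_ge0// ltW.
  move: e22; lra.
by have := lerD (le_trans hh1 t1) t2; lra.
Qed.

Lemma mean_value_Im r : 0 < r -> r < rho ->
  RI 0 (pi *+ 2) (fun y => Im (g (r%:C * cis y))) = pi *+ 2 * Im (g 0).
Proof.
move=> r0 rrho; have rho0 := lt_trans r0 rrho.
have lr : ln r < ln rho by rewrite ltr_ln.
have pi0 : 0 < pi *+ 2 :> R by rewrite pmulrn_lgt0// pi_gt0.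
have d00 : {for 0, continuous g}.
  by apply: differentiable_continuous; apply: dg; rewrite normc0.
have cont x : x < ln rho -> cts 0 (pi *+ 2) (fun y => Im (F x y)).
  move=> xr y _; apply/cvgrPdist_lt => e e0.
  have [b hb] := dF y xr rho0.
  have [d d0 dP] := hb 1 ltr01.
  pose M := 1 + normc b; have M0 : 0 < M by rewrite ltr_pwDl// normc_ge0.
  apply/nbhs_ballP; exists (Num.min d (e / M)) => /=; first by rewrite lt_min d0 divr_gt0.
  move=> t; rewrite /ball/= distrC lt_min => /andP[td te].
  have := dP 0 (t - y); rewrite normr0 addr0 subrKC => /(_ d0 td).
  rewrite add0r mul1r => hh; rewrite distrC -raddfB/=.
  apply: le_lt_trans (le_absIm_normc _) _.
  set T := F x t - F x y in hh *.
  have := normcD (T - b * (0 +i* (t - y))) (b * (0 +i* (t - y))); rewrite subrK.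
  have k1 : normc (0 +i* (t - y)) <= `|t - y|.
    by apply: le_trans (normc_le_ReIm _) _; rewrite /= normr0 add0r.
  have : normc (b * (0 +i* (t - y))) <= normc b * `|t - y|.
    by rewrite normcM ler_wpM2l// normc_ge0.
  move: te; rewrite ltr_pdivlMr// /M; lra.
have const a b : a <= b -> b < ln rho -> RI 0 (pi *+ 2) (fun y => Im (F a y)) =
   RI 0 (pi *+ 2) (fun y => Im (F b y)).
  move=> ab br.
  have := @contour_eq0 R F (ln rho) (fun x y xr => dF y xr rho0) a b 0 (pi *+ 2) ab (ltW pi0) br.
  (* The horizontal sides cancel by periodicity, so the circle integral does not depend on the
     radius. *)
  have -> : (fun x => Re (F x 0) - Re (F x (pi *+ 2))) = fun=> 0.
    by apply/funext => x; rewrite /F /E /cis cos0 sin0 cos2pi sin2pi subrr.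
  rewrite (RI_cst _ ab) mul0r (RI_B (cont b br) (cont a (le_lt_trans ab br))).
  by move/eqP; rewrite eq_sym subr_eq0 => /eqP ->.
have -> : (fun y => Im (g (r%:C * cis y))) = fun y => Im (F (ln r) y).
  by apply/funext => y; rewrite /F /E lnK.
apply/eqP; rewrite -subr_eq0 -normr_le0; apply/ler_addgt0Pl => e e0; rewrite addr0.
have e0' : 0 < e / (pi *+ 2) by rewrite divr_gt0.
have [d d0 dP] := (continuous_normcP g 0).1 d00 _ e0'.
(* Far enough to the left, the circle of radius [expR a] lies where [g] is close to [g 0]. *)
pose a := Num.min (ln r) (ln (d / 2)).
rewrite -(@const a (ln r))//; last by rewrite ge_min lexx.
have ar : a < ln rho by apply: le_lt_trans lr; rewrite ge_min lexx.
have := @RI_near_cst R 0 (pi *+ 2) (fun y => Im (F a y)) (Im (g 0)) (e / (pi *+ 2)) (ltW pi0) (cont _ ar).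
rewrite subr0 divfK ?lt0r_neq0// [X in _ - X]mulrC; apply => y _.
rewrite -raddfB/=; apply: le_trans (le_absIm_normc _) _; apply: ltW.
rewrite /F -[E a y]add0r; apply: dP; rewrite normE.
apply: (@le_lt_trans _ _ (d / 2)); last lra.
have d20 : 0 < d / 2 by lra.
by rewrite -[leRHS]lnK// ler_expR ge_min lexx orbT.
Qed.

End mean_value.

Lemma mean_value_Re (R : realType) (g : R[i] -> R[i]) (rho r : R) :
  (forall z, normc z < rho -> differentiable g z) -> 0 < r -> r < rho ->
  RI 0 (pi *+ 2) (fun y => Re (g (r%:C * cis y))) = pi *+ 2 * Re (g 0).
Proof.
move=> dg r0 rr; have := @mean_value_Im R (fun z => 'i * g z) rho _ r r0 rr.
have ImI (z : R[i]) : Im ('i * z) = Re z by case: z => a b /=; ring.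
rewrite ImI (_ : (fun y => Im _) = fun y => Re (g (r%:C * cis y))); last first.
  by apply/funext => y; rewrite ImI.
apply => z zr.
by apply: differentiableM => //; exact: dg.
Qed.

(** * The maximum principle *)

Section max_principle.
Variable R : realType.
Local Notation C := R[i].
Implicit Types (g v : C -> C) (r rho M : R) (z a : C).

Lemma normc_sqr z : normc z ^+ 2 = Re z ^+ 2 + Im z ^+ 2.
Proof. by case: z => a b; rewrite sqr_sqrtr// addr_ge0// sqr_ge0. Qed.

Lemma cts_circle g r : (forall y : R, {for r%:C * cis y, continuous g}) ->
  cts 0 (pi *+ 2) (fun y => Re (g (r%:C * cis y))).
Proof.
move=> cg y _; apply/cvgrPdist_lt => e e0.
have [d d0 dP] := (continuous_normcP g _).1 (cg y) _ e0.
have e1 : 0 < d / (2 * (`|r| + 1)) by rewrite divr_gt0// mulr_gt0// ltr_wpDl.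
have /cvgrPdist_lt/(_ _ e1) c1 := @continuous_cos R y.
have /cvgrPdist_lt/(_ _ e1) c2 := @continuous_sin R y.
near=> t.
have h1 : `|cos y - cos t| < d / (2 * (`|r| + 1)) by near: t; exact: c1.
have h2 : `|sin y - sin t| < d / (2 * (`|r| + 1)) by near: t; exact: c2.
rewrite distrC -raddfB/=; apply: le_lt_trans (le_absRe_normc _) _.
have -> : r%:C * cis t = r%:C * cis y + r%:C * (cis t - cis y) by ring.
apply: dP; rewrite normcM normc_real.
have : normc (cis t - cis y) <= `|cos y - cos t| + `|sin y - sin t|.
  apply: le_trans (normc_le_ReIm _) _ => /=.
  by rewrite [`|cos t - _|]distrC [`|sin t - _|]distrC.
have r1 : 0 < 2 * (`|r| + 1) by rewrite mulr_gt0// ltr_wpDl.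
move: h1 h2; rewrite !ltr_pdivlMr// => h1 h2 h3.
have h4 : `|r| * normc (cis t - cis y) <= `|r| * (`|cos y - cos t| + `|sin y - sin t|).
  by rewrite ler_wpM2l.
have := normr_ge0 (cos y - cos t); have := normr_ge0 (sin y - sin t); lra.
Unshelve. all: by end_near. Qed.

(** After multiplication by the conjugate of [g 0], the value at the center is the real number
    [normc (g 0) ^+ 2], and the mean value of real parts can be compared with [normc (g 0) * M]. *)
Lemma center_le_circle g rho r M :
  (forall z, normc z < rho -> differentiable g z) -> 0 < r -> r < rho ->
  (forall z, normc z = r -> normc (g z) <= M) -> normc (g 0) <= M.
Proof.
move=> dg r0 rr gM.
pose u := (g 0)^*; pose h z := u * g z.
have dh z : normc z < rho -> differentiable h z.
  by move=> zr; apply: differentiableM => //; exact: dg.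
have nu : normc u = normc (g 0) by rewrite /u; case: (g 0) => a b /=; rewrite sqrrN.
have Reh0 : Re (h 0) = normc (g 0) ^+ 2.
  by rewrite /h /u normc_sqr; case: (g 0) => a b /=; ring.
have nc y : normc (r%:C * cis y) = r.
  by rewrite normcM normc_cis mulr1 normc_real gtr0_norm.
have := mean_value_Re dh r0 rr; rewrite Reh0 => mv.
have pi0 : 0 < pi *+ 2 :> R by rewrite pmulrn_lgt0// pi_gt0.
have : RI 0 (pi *+ 2) (fun y => Re (h (r%:C * cis y))) <=
    RI 0 (pi *+ 2) (fun=> normc (g 0) * M).
  apply: RI_le.
  - by apply: cts_circle => y; apply: differentiable_continuous; apply: dh; rewrite nc.
  - exact: cts_cst.
  - move=> y _; apply: le_trans (le_Re_normc _) _.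
    by rewrite normcM nu ler_wpM2l ?normc_ge0// gM.
rewrite mv (RI_cst _ (ltW pi0)) subr0 [leRHS]mulrC ler_pM2l// expr2.
have [->|g0] := eqVneq (g 0) 0.
  by move=> _; rewrite normc0; apply: le_trans (gM r%:C _); rewrite ?normc_ge0 ?normc_real ?gtr0_norm.
by rewrite ler_pM2l// normc_gt0.
Qed.

(** A Moebius map [phi] from the unit disc to the disc of radius [r] sends the center to [z], which
    reduces the claim to [center_le_circle]. *)
Lemma max_principle g rho r M z :
  (forall z, normc z < rho -> differentiable g z) -> 0 < r -> r < rho ->
  (forall z, normc z = r -> normc (g z) <= M) -> normc z <= r -> normc (g z) <= M.
Proof.
move=> dg r0 rr gM; rewrite le_eqVlt => /predU1P[/gM//|zr].
have rC : r%:C != 0 :> C by rewrite -normc_eq0 normc_real gtr0_norm// gt_eqF.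
pose a := z / r%:C; pose al := normc a.
have al1 : al < 1.
  by rewrite /al /a normcM normcV normc_real gtr0_norm// ltr_pdivrMr// mul1r.
have al0 : 0 <= al by exact: normc_ge0.
pose D (l : C) : C := 1 + a^* * l.
have nca : normc (a^*) = al by rewrite /al; case: (a) => p q /=; rewrite sqrrN.
(* This identity serves twice: [phi] maps the unit circle to the circle of radius [r], and it maps a
   slightly larger disc into the disc of radius [rho]. *)
have key l : normc (l + a) ^+ 2 = normc (D l) ^+ 2 + (normc l ^+ 2 - 1) * (1 - al ^+ 2).
  by rewrite /al !normc_sqr /D; case: (a) => p q; case: (l) => s t /=; ring.
have Dge l : 1 - al * normc l <= normc (D l).
  have := normcB (D l) (a^* * l); rewrite /D addrK normc1 normcM nca; lra.
pose ka := (1 - al) / 2; have ka0 : 0 < ka by rewrite /ka; lra.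
(* [ka] bounds [D] from below on the larger disc. There [normc l ^+ 2 - 1] is at most [3 * dl], and
   [dl <= del] makes [3 * dl * r ^+ 2] smaller than [(rho ^+ 2 - r ^+ 2) * ka ^+ 2]. *)
pose del := (rho ^+ 2 - r ^+ 2) * ka ^+ 2 / (4 * r ^+ 2).
have r2 : r ^+ 2 < rho ^+ 2 by rewrite ltr_pXn2r// nnegrE ltW// (lt_trans r0).
have del0 : 0 < del by rewrite divr_gt0 ?mulr_gt0 ?subr_gt0 ?exprn_gt0.
have [dl [dl0 dl1 dl2 dl3]] : exists dl, [/\ 0 < dl, dl <= 1, dl <= ka & dl <= del].
  exists (Num.min 1 (Num.min ka del)); split.
  - by rewrite !lt_min ltr01 ka0.
  - by rewrite !ge_min lexx.
  - by rewrite !ge_min lexx orbT.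
  - by rewrite !ge_min lexx !orbT.
have Dka l : normc l < 1 + dl -> ka <= normc (D l).
  move=> ll; apply: le_trans (Dge l).
  have : al * normc l <= al * (1 + ka) by rewrite ler_wpM2l//; lra.
  by have : al * ka <= ka; [rewrite ler_piMl//; lra|rewrite /ka; lra].
pose phi l := r%:C * (l + a) / D l.
have D0 l : normc l < 1 + dl -> D l != 0.
  by move=> /Dka h; rewrite -normc_gt0 (lt_le_trans ka0).
have phir l : normc l < 1 + dl -> normc (phi l) < rho.
  move=> ll; have Dl := Dka _ ll; have D0l : 0 < normc (D l) by exact: lt_le_trans Dl.
  have rho0 : 0 < rho by exact: lt_trans rr.
  rewrite /phi !normcM normcV normc_real gtr0_norm// ltr_pdivrMr//.
  rewrite -(@ltr_pXn2r _ 2)// ?nnegrE ?mulr_ge0 ?normc_ge0//; [|exact: ltW|exact: ltW].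
  rewrite !exprMn key.
  have k2 : ka ^+ 2 <= normc (D l) ^+ 2 by rewrite lerXn2r// nnegrE ltW.
  have nl2 : normc l ^+ 2 - 1 <= 3 * dl by have := normc_ge0 l; nra.
  have a2 : 0 <= 1 - al ^+ 2 <= 1 by apply/andP; split; nra.
  have : (normc l ^+ 2 - 1) * (1 - al ^+ 2) <= 3 * dl by move: a2 => /andP[? ?]; nra.
  have : 4 * r ^+ 2 * dl <= (rho ^+ 2 - r ^+ 2) * ka ^+ 2.
    by have := dl3; rewrite /del ler_pdivlMr ?mulr_gt0 ?exprn_gt0// mulrC.
  have r20 : 0 < r ^+ 2 by rewrite exprn_gt0.
  set X := _ * (1 - _) => h1 h2.
  have h3 : r ^+ 2 * X <= r ^+ 2 * (3 * dl) by rewrite ler_pM2l.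
  have h4 : (rho ^+ 2 - r ^+ 2) * ka ^+ 2 <= (rho ^+ 2 - r ^+ 2) * normc (D l) ^+ 2.
    by rewrite ler_pM2l// subr_gt0.
  have h5 : 0 < r ^+ 2 * dl by rewrite mulr_gt0.
  by rewrite mulrDr; move: h1 h3 h4; rewrite !mulrBl; lra.
pose h l := g (phi l).
have dh l : normc l < 1 + dl -> differentiable h l.
  move=> ll; apply: (@differentiable_comp _ _ _ _ phi g); last by apply: dg; exact: phir.
  have d1 : differentiable (fun l : C => l + a) l by apply: differentiableD.
  have d2 := differentiable_mul (differentiable_cst r%:C l) d1.
  have d3 := differentiable_mul (differentiable_cst a^* l) (@differentiable_var R C l).
  have d4 : differentiable D l.
    exact: (@differentiable_add R C (fun=> 1) _ l (differentiable_cst (1 : C) l) d3).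
  exact: (differentiable_mul d2 (differentiable_inv d4 (D0 l ll))).
have := @center_le_circle h (1 + dl) 1 M dh ltr01.
rewrite ltrDl => /(_ dl0).
have -> : h 0 = g z.
  by rewrite /h /phi /D mulr0 addr0 invr1 mulr1 add0r /a mulrC divfK.
apply=> l l1; apply: gM.
rewrite /phi !normcM normcV normc_real gtr0_norm//.
have Dl : 0 < normc (D l) by apply: lt_le_trans (Dge l); rewrite l1; lra.
suff -> : normc (l + a) = normc (D l) by rewrite mulfK// gt_eqF.
apply/eqP; rewrite -(@eqrXn2 _ 2) ?normc_ge0// key l1.
by rewrite expr1n subrr mul0r addr0.
Qed.

(** The difference quotient at [a] is [v (a + h)] itself, so continuity gives the derivative
    [v a]. *)
Lemma differentiable_mul_sub v a : {for a, continuous v} ->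
  differentiable (fun z => (z - a) * v z) a.
Proof.
move=> /continuous_normcP cv; apply/differentiable_cderiv; exists (v a) => e e0.
have [d d0 dP] := cv _ e0; exists d => // h hd.
rewrite subrr mul0r subr0.
have -> : (a + h - a) * v (a + h) - v a * h = h * (v (a + h) - v a) by ring.
by rewrite normcM mulrC ler_wpM2r ?normc_ge0// ltW// dP.
Qed.

Lemma differentiable_prod_sub (S : seq C) z :
  differentiable (fun z : C => \prod_(s <- S) (z - s)) z.
Proof.
elim: S => [|s S ih]; first by under eq_fun do rewrite big_nil; exact: differentiable_cst.
under eq_fun do rewrite big_cons.
have d1 : differentiable (fun z : C => z - s) z by apply: differentiableB.
exact: (differentiable_mul d1 ih).
Qed.

Lemma near_notin (S : seq C) z (d : R) : 0 < d ->
  exists2 h, normc h < d & z + h \notin S.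
Proof.
move=> d0; suff [d' /andP[d'0 d'd] dP] : exists2 d' : R, 0 < d' <= d &
    forall h, 0 < normc h -> normc h < d' -> z + h \notin S.
  have n2 : normc (d' / 2)%:C = d' / 2 by rewrite normc_real gtr0_norm//; lra.
  by exists (d' / 2)%:C; [|apply: dP]; rewrite n2; lra.
elim: S => [|s S [d' /andP[d'0 d'd] ih]]; first by exists d => //; rewrite d0 lexx.
have [->|zs] := eqVneq s z.
  exists d'; rewrite ?d'0// => h h0 hd; rewrite inE negb_or ih// andbT.
  by rewrite -subr_eq0 addrC addKr -normc_gt0.
exists (Num.min d' (normc (s - z))).
  by rewrite lt_min d'0 normc_gt0 subr_eq0 zs/= ge_min d'd.
move=> h h0; rewrite lt_min => /andP[hd hs]; rewrite inE negb_or ih// andbT.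
by apply: contraTneq hs => <-; rewrite addrC addKr ltxx.
Qed.

(* Singularities of a continuous function are killed by the factors of [P];
   taking n-th roots in [|P| |v|^n <= sup |P| sup |v|^n] removes [P] again. *)
Lemma max_principle_except (S : seq C) v rho r M z :
  (forall z, normc z < rho -> {for z, continuous v}) ->
  (forall z, normc z < rho -> z \notin S -> differentiable v z) ->
  0 < r -> r < rho ->
  (forall z, normc z = r -> normc (v z) <= M) -> normc z <= r -> normc (v z) <= M.
Proof.
move=> cv dv r0 rr vM.
pose P z := \prod_(s <- S) (z - s).
pose B := \prod_(s <- S) (r + normc s).
have PB w : normc w <= r -> normc (P w) <= B.
  move=> wr; rewrite /P /B; elim: (S) => [|s T ih]; first by rewrite !big_nil normc1.
  rewrite !big_cons normcM ler_pM ?normc_ge0//.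
  by apply: le_trans (normcB _ _) _; rewrite lerD2r.
have P0 w : w \notin S -> P w != 0.
  rewrite /P => wS; rewrite prodf_seq_neq0; apply/allP => s sS /=.
  by rewrite subr_eq0; apply: contraNneq wS => ->.
have dPv n w : normc w < rho -> differentiable (fun z => P z * v z ^+ n.+1) w.
  move=> wr; have [wS|wS] := boolP (w \in S); last first.
    apply: differentiableM; first exact: differentiable_prod_sub.
    by apply: differentiable_pow; exact: dv.
  pose Q z := \prod_(s <- rem w S) (z - s).
  have -> : (fun z => P z * v z ^+ n.+1) = (fun z => (z - w) * (Q z * v z ^+ n.+1)).
    by apply/funext => x; rewrite /P (big_rem w)//= mulrA.
  apply: differentiable_mul_sub; apply: continuous_mul.
    by apply: differentiable_continuous; exact: differentiable_prod_sub.
  by apply: continuous_pow; exact: cv.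
have off w : normc w <= r -> w \notin S -> normc (v w) <= M.
  move=> wr wS; have M0 : 0 <= M.
    by apply: le_trans (vM r%:C _); rewrite ?normc_ge0// normc_real gtr0_norm.
  apply/ler_addgt0Pl => e e0; rewrite leNgt; apply/negP => Mv.
  have Me : 0 < e + M by lra.
  have Pw : 0 < normc (P w) by rewrite normc_gt0 P0.
  have [n hn] : exists n, B / normc (P w) < (normc (v w) / (e + M)) ^+ n.
    by apply: expr_large; rewrite ltr_pdivlMr// mul1r.
  have : normc (P w * v w ^+ n.+1) <= B * (e + M) ^+ n.+1.
    apply: (max_principle (dPv n) r0 rr _ wr) => u ur.
    rewrite normcM normcX; apply: ler_pM; rewrite ?exprn_ge0 ?normc_ge0//.
      by apply: PB; rewrite ur.
    apply: lerXn2r; rewrite ?nnegrE ?normc_ge0//; first exact: ltW.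
    by have := vM u ur; lra.
  rewrite normcM normcX leNgt; apply/negP/negPn.
  have V0 : 0 < normc (v w) by exact: lt_trans Me Mv.
  have VM : B * (e + M) ^+ n < normc (P w) * normc (v w) ^+ n.
    by move: hn; rewrite expr_div_n ltr_pdivrMr// mulrAC ltr_pdivlMr ?exprn_gt0// [X in _ < X]mulrC.
  have B0 : 0 <= B by apply: prodr_ge0 => s _; rewrite addr_ge0 ?normc_ge0 ?ltW.
  have X0 : 0 <= B * (e + M) ^+ n by rewrite mulr_ge0// exprn_ge0// ltW.
  rewrite !exprSr !mulrA.
  apply: le_lt_trans (_ : B * (e + M) ^+ n * normc (v w) < _).
    by rewrite ler_wpM2l// ltW.
  by rewrite ltr_pM2r.
move=> zr; have [zr'|zr'|] := ltgtP (normc z) r; last by move=> /vM.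
  2: by rewrite leNgt zr' in zr.
(* Points of [S] are limits of points outside [S], and [v] is continuous. *)
apply/ler_addgt0Pr => e e0.
have [d d0 dP] := (continuous_normcP v z).1 (cv z (lt_trans zr' rr)) _ e0.
have [|h hd hS] := @near_notin S z (Num.min d (r - normc z)).
  by rewrite lt_min d0 subr_gt0.
move: hd; rewrite lt_min => /andP[hd hr].
have := off (z + h) _ hS; have := normcD z h => h1 /(_ _)h2.
have := dP h hd; have := normcB (v (z + h)) (v (z + h) - v z).
have -> : v (z + h) - (v (z + h) - v z) = v z by ring.
by have := h2 _; lra.
Qed.

(** The value [l] at [a] is a parameter; taking the derivative of [v] makes the quotient continuous
    there. *)
Definition quotient v a l z : C := if z == a then l else (v z - v a) / (z - a).

Lemma quotient_neq v a l z : z != a -> quotient v a l z = (v z - v a) / (z - a).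
Proof. by rewrite /quotient => /negbTE ->. Qed.

Let near_neq z a : z != a -> exists2 d : R, 0 < d & forall h, normc h < d -> z + h != a.
Proof.
move=> za; exists (normc (a - z)); first by rewrite normc_gt0 subr_eq0 eq_sym.
by move=> h; apply: contraTneq => <-; rewrite addrC addKr ltxx.
Qed.

Lemma differentiable_quotient v a l z : z != a -> differentiable v z ->
  differentiable (quotient v a l) z.
Proof.
move=> za dv; have [d d0 dP] := near_neq za.
apply: (@differentiable_eq_near _ _ _ (fun z => (v z - v a) / (z - a))).
  by exists d => // h; rewrite nr_C => /dP ?; rewrite quotient_neq.
have d1 : differentiable (fun z => v z - v a) z.
  exact: (differentiable_sub dv (differentiable_cst (v a) z)).
have d2 : differentiable (fun z : C => z - a) z.
  exact: (differentiable_sub (@differentiable_var R C z) (differentiable_cst a z)).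
apply: (differentiable_mul d1); apply: (differentiable_inv d2).
by rewrite subr_eq0.
Qed.

Lemma continuous_quotient v a l z : z != a -> {for z, continuous v} ->
  {for z, continuous (quotient v a l)}.
Proof.
move=> za cv; have [d d0 dP] := near_neq za.
have cva : {for z, continuous (fun z => v z - v a)}.
  have ca : {for z, continuous (fun=> v a)} by exact: cst_continuous.
  exact: (continuous_sub cv ca).
have cza : {for z, continuous (fun z => (z - a)^-1)}.
  apply: differentiable_continuous.
  have d2 := differentiable_sub (@differentiable_var R C z) (differentiable_cst a z).
  by apply: (differentiable_inv d2); rewrite subr_eq0.
have c1 := continuous_mul cva cza.
apply/continuous_normcP => e e0.
have [d' d'0 d'P] := (continuous_normcP _ _).1 c1 e e0.
exists (Num.min d d'); first by rewrite lt_min d0.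
move=> h; rewrite lt_min => /andP[hd hd'].
by rewrite !quotient_neq// ?dP// d'P.
Qed.

Lemma continuous_quotient_at v a l : cderiv v a l ->
  {for a, continuous (quotient v a l)}.
Proof.
move=> dv; apply/continuous_normcP => e e0.
have [d d0 dP] := dv (e / 2) (divr2_gt0 e0); exists d => // h hd.
rewrite {2}/quotient eqxx; have [->|h0] := eqVneq h 0.
  by rewrite addr0 /quotient eqxx subrr normc0.
have ah : a + h != a by rewrite -subr_eq0 addrC addKr.
rewrite quotient_neq// [a + h - a]addrC addKr.
have -> : (v (a + h) - v a) / h - l = (v (a + h) - v a - l * h) / h by field.
rewrite normcM normcV ltr_pdivrMr ?normc_gt0//.
apply: le_lt_trans (dP h hd) _; rewrite ltr_pM2r ?normc_gt0//; lra.
Qed.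

(** Cauchy's estimate, by the maximum principle for the difference quotient at [0]; the factor [2]
    comes from [g z - g 0] on the circle. *)
Lemma cderiv_bound g rho r M l : (forall z, normc z < rho -> differentiable g z) ->
  0 < r -> r < rho -> (forall z, normc z <= r -> normc (g z) <= M) ->
  cderiv g 0 l -> normc l <= 2 * M / r.
Proof.
move=> dg r0 rr gM dl.
have -> : l = quotient g 0 l 0 by rewrite /quotient eqxx.
apply: (@max_principle_except [:: 0] (quotient g 0 l) rho r) => //; last first.
- by rewrite normc0 ltW.
- move=> z zr; have z0 : z != 0 by rewrite -normc_gt0 zr.
  rewrite quotient_neq// subr0 normcM normcV zr ler_pM2r ?invr_gt0//.
  apply: le_trans (normcB _ _) _.
  by have := gM z; have := gM 0; rewrite zr normc0 lexx (ltW r0) => /(_ isT) h1 /(_ isT) h2; lra.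
- by move=> z zr; rewrite inE => z0; apply: differentiable_quotient => //; exact: dg.
- move=> z zr; have [->|z0] := eqVneq z 0; first exact: continuous_quotient_at.
  by apply: continuous_quotient => //; apply: differentiable_continuous; exact: dg.
Qed.

End max_principle.

(** * Functions vanishing to infinite order *)

Section flat.
Variable R : realType.
Local Notation C := R[i].
Implicit Types (g v : C -> C) (r rho M : R) (z a : C).

Lemma differentiable_shift v a z : differentiable v (a + z) ->
  differentiable (fun z => v (a + z)) z.
Proof.
move=> dv; have d1 : differentiable (fun z : C => a + z) z.
  exact: (@differentiable_add R C (fun=> a) _ z (differentiable_cst a z) (@differentiable_var R C z)).
exact: (@differentiable_comp _ C C C (fun z => a + z) v z d1 dv).
Qed.

(* The difference quotients [q_w] of [v] satisfy the maximum principle in [z],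
   hence depend continuously on [w] uniformly in [z], and [q_w 0 = q_0 w]. *)
Lemma quotient_cauchy v rho :
  0 < rho -> (forall z, normc z < rho -> {for z, continuous v}) ->
  (forall z, normc z < rho -> z != 0 -> differentiable v z) ->
  forall e : R, 0 < e -> exists2 d : R, 0 < d & forall w w', w != 0 -> w' != 0 ->
    normc w < d -> normc w' < d ->
    normc ((v w - v 0) / w - (v w' - v 0) / w') <= e.
Proof.
move=> rho0 cv dv e e0.
have cv0 := (continuous_normcP v 0).1 (cv 0 _).
rewrite normc0 in cv0; have {}cv0 := cv0 rho0.
have [d1 d10 d1P] := cv0 1 ltr01.
have [r [r0 r1 r2]] : exists r, [/\ 0 < r, r < d1 & r < rho].
  exists (Num.min d1 rho / 2); split; first by rewrite divr_gt0// lt_min d10.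
    by rewrite ltr_pdivrMr//; apply: le_lt_trans (_ : d1 < _); [rewrite ge_min lexx|lra].
  by rewrite ltr_pdivrMr//; apply: le_lt_trans (_ : rho < _); [rewrite ge_min lexx orbT|lra].
have v1 z : normc z <= r -> normc (v z - v 0) <= 1.
  by move=> zr; have := d1P z (le_lt_trans zr r1); rewrite add0r => /ltW.
have r20 : 0 < r ^+ 2 by rewrite exprn_gt0.
have e10 : 0 < e * r / 8 by rewrite divr_gt0// mulr_gt0.
have [d2 d20 d2P] := cv0 _ e10.
have e20 : 0 < e * r ^+ 2 / 8 by rewrite divr_gt0// mulr_gt0.
exists (Num.min (r / 2) (Num.min d2 (e * r ^+ 2 / 8))).
  by rewrite !lt_min d20 e20 divr_gt0.
(* On the circle, the quotients based at [w] and at [0] differ by at most [e / 2], so two of them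
   differ by at most [e]. *)
have close w z : w != 0 -> normc w < r / 2 -> normc w < d2 ->
  normc w < e * r ^+ 2 / 8 -> normc z = r ->
  normc ((v z - v w) / (z - w) - (v z - v 0) / z) <= e / 2.
  move=> w0 wr wd we zr.
  have z0 : z != 0 by rewrite -normc_gt0 zr.
  have nzw : r / 2 <= normc (z - w).
    by have := normcD (z - w) w; rewrite subrK zr; lra.
  have zw : z - w != 0 by rewrite -normc_gt0; lra.
  have -> : (v z - v w) / (z - w) - (v z - v 0) / z =
    (z * (v 0 - v w) + w * (v z - v 0)) / (z * (z - w)).
    by field; apply/andP; split.
  rewrite normcM normcV ler_pdivrMr ?normc_gt0 ?mulf_neq0// [normc (z * _)]normcM zr.
  apply: le_trans (normcD _ _) _; rewrite !normcM zr.
  have h1 : normc (v 0 - v w) <= e * r / 8.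
    by rewrite distcC; have := d2P w wd; rewrite add0r => /ltW.
  have h2 : r * normc (v 0 - v w) <= r * (e * r / 8) by rewrite ler_pM2l.
  have h3 : normc w * normc (v z - v 0) <= e * r ^+ 2 / 8 * 1.
    by apply: ler_pM; rewrite ?normc_ge0//; [exact: ltW|apply: v1; rewrite zr].
  have h4 : e / 2 * (r * (r / 2)) <= e / 2 * (r * normc (z - w)).
    by rewrite ler_pM2l ?divr_gt0// ler_pM2l.
  by move: h2 h3 h4; rewrite expr2; lra.
move=> w w' w0 w'0; rewrite !lt_min => /and3P[wr wd we] /and3P[wr' wd' we'].
have rr2 : r / 2 < rho by lra.
have [l dl] := (differentiable_cderiv v w).1 (dv w (lt_trans wr rr2) w0).
have [l' dl'] := (differentiable_cderiv v w').1 (dv w' (lt_trans wr' rr2) w'0).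
(* [q 0] is the difference to be bounded. The exceptional points are [w], [w'] and also [0], where
   [v] is only assumed continuous. *)
pose q z := quotient v w l z - quotient v w' l' z.
have cq u k z : cderiv v u k -> normc z < rho -> {for z, continuous (quotient v u k)}.
  move=> du zr; have [->|zu] := eqVneq z u; first exact: continuous_quotient_at.
  by apply: continuous_quotient => //; exact: cv.
have q0E : q 0 = (v w - v 0) / w - (v w' - v 0) / w'.
  by rewrite /q !quotient_neq 1?eq_sym//; field; apply/andP; split.
have contq z : normc z < rho -> {for z, continuous q}.
  by move=> zr; exact: (continuous_sub (cq w l z dl zr) (cq w' l' z dl' zr)).
have diffq z : normc z < rho -> z \notin [:: 0; w; w'] -> differentiable q z.
  move=> zr; rewrite !inE !negb_or => /and3P[z0 zw zw'].
  have dvz := dv z zr z0.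
  exact: (differentiable_sub (differentiable_quotient l zw dvz) (differentiable_quotient l' zw' dvz)).
have circ z : normc z = r -> normc (q z) <= e.
  move=> zr; rewrite /q !quotient_neq; first last.
  - by apply: contraTneq wr => <-; rewrite zr -leNgt; lra.
  - by apply: contraTneq wr' => <-; rewrite zr -leNgt; lra.
  have -> : (v z - v w) / (z - w) - (v z - v w') / (z - w') =
    ((v z - v w) / (z - w) - (v z - v 0) / z) - ((v z - v w') / (z - w') - (v z - v 0) / z) by ring.
  apply: le_trans (normcB _ _) _.
  by have := close w z w0 wr wd we zr; have := close w' z w'0 wr' wd' we' zr; lra.
rewrite -q0E; apply: (max_principle_except contq diffq r0 r2 circ).
by rewrite normc0 ltW.
Qed.

(** The difference quotients at [a] are Cauchy by [quotient_cauchy] and come arbitrarily close to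
    [0] along some points [w]; hence they converge to [0], which is the derivative. *)
Lemma removable_flat v a rho :
  0 < rho -> (forall z, normc (z - a) < rho -> {for z, continuous v}) ->
  (forall z, normc (z - a) < rho -> z != a -> differentiable v z) ->
  (forall e d : R, 0 < e -> 0 < d -> exists w, [/\ w != 0, normc w < d &
     normc ((v (a + w) - v a) / w) < e]) ->
  differentiable v a.
Proof.
move=> rho0 cv dv fl; apply/differentiable_cderiv; exists 0 => e e0.
pose u z := v (a + z).
have [||d d0 dP] := @quotient_cauchy u rho rho0 _ _ (e / 2) (divr2_gt0 e0).
- move=> z zr; apply/continuous_normcP => e' e'0.
  have za : normc (a + z - a) < rho by rewrite addrC addKr.
  have [d d0 dP] := (continuous_normcP v (a + z)).1 (cv (a + z) za) _ e'0.
  by exists d => // h hd; rewrite /u addrA; exact: dP.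
- move=> z zr z0; apply: differentiable_shift; apply: dv.
    by rewrite addrC addKr.
  by rewrite -subr_eq0 addrC addKr.
exists d => // h hd; rewrite mul0r subr0.
have [->|h0] := eqVneq h 0; first by rewrite addr0 subrr normc0 mulr0.
have [w [w0 wd wP]] := fl (e / 2) d (divr2_gt0 e0) d0.
have := dP h w h0 w0 hd wd; rewrite /u addr0 => hP.
have -> : v (a + h) - v a = ((v (a + h) - v a) / h) * h by rewrite divfK.
rewrite normcM ler_wpM2r ?normc_ge0//.
have := normcD ((v (a + h) - v a) / h - (v (a + w) - v a) / w) ((v (a + w) - v a) / w).
by rewrite subrK; lra.
Qed.

(** The order of vanishing is measured along the real segment to the left of [1], the only place
    where the Hoelder estimates give information. *)
Definition flat_at1 g := forall N : nat, exists M : R,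
  forall s : R, 0 < s -> s < 1 -> normc (g (1 - s)%:C) <= M * s ^+ N.

Let flat_ge0 g N : flat_at1 g -> exists2 M : R, 0 <= M &
  forall s : R, 0 < s -> s < 1 -> normc (g (1 - s)%:C) <= M * s ^+ N.
Proof.
move=> /(_ N)[M MP]; exists `|M| => // s s0 s1; apply: le_trans (MP s s0 s1) _.
by apply: ler_wpM2r; [rewrite exprn_ge0// ltW|exact: ler_norm].
Qed.

(* [g] divided by the Blaschke factor of the disc of radius [r] at [1]. *)
Let blaschke r g z : C :=
  if z == 1 then 0 else g z * ((r ^+ 2)%:C - z) / (r%:C * (z - 1)).

Section step.
Variables (rho r : R).
Hypotheses (r1 : 1 < r) (rrho : r < rho).

Let r0 : 0 < r. Proof. exact: lt_trans r1. Qed.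
Let rC : r%:C != 0 :> C.
Proof. by rewrite -normc_eq0 normc_real gtr0_norm// gt_eqF. Qed.

Let flat_value g : {for 1, continuous g} -> flat_at1 g -> g 1 = 0.
Proof.
move=> cg fg; apply/eqP; rewrite -normc_eq0 -(@le_anti _ _ (normc (g 1)) 0) ?normc_ge0 ?andbT//.
apply/ler_addgt0Pl => e e0; rewrite addr0.
have e20 : 0 < e / 2 by rewrite divr_gt0.
have [d d0 dP] := (continuous_normcP g 1).1 cg _ e20.
have [M M0 MP] := flat_ge0 1 fg.
(* The three terms put [s] in the range of the flatness bound, bring [1 - s] within [d] of [1], and
   make [M * s <= e / 2]. *)
pose s := Num.min (1 / 2) (Num.min (d / 2) (e / 2 / (M + 1))).
have [s0 s12 sd sM] : [/\ 0 < s, s <= 1 / 2, s <= d / 2 & s <= e / 2 / (M + 1)].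
  split; rewrite /s.
  - by rewrite !lt_min !divr_gt0// ltr_wpDl.
  - by rewrite !ge_min lexx.
  - by rewrite !ge_min lexx orbT.
  - by rewrite !ge_min lexx !orbT.
move: sM; rewrite ler_pdivlMr ?ltr_wpDl// => sM.
have := dP (- s%:C); rewrite normcNr normc_real gtr0_norm// => /(_ _) h1.
have {}h1 := h1 ltac:(lra).
have := MP s s0 ltac:(lra); rewrite expr1 rmorphB/= rmorph1 => h2.
have := normcB (g (1 - s%:C)) (g (1 - s%:C) - g 1).
have -> : g (1 - s%:C) - (g (1 - s%:C) - g 1) = g 1 by ring.
lra.
Qed.

Let flat_deriv g l : g 1 = 0 -> cderiv g 1 l -> flat_at1 g -> l = 0.
Proof.
move=> g1 dg fg; apply/eqP; rewrite -normc_eq0 -(@le_anti _ _ (normc l) 0) ?normc_ge0 ?andbT//.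
apply/ler_addgt0Pl => e e0; rewrite addr0.
have e20 : 0 < e / 2 by rewrite divr_gt0.
have [d d0 dP] := dg _ e20.
have [M M0 MP] := flat_ge0 2 fg.
pose s := Num.min (1 / 2) (Num.min (d / 2) (e / 2 / (M + 1))).
have [s0 s12 sd sM] : [/\ 0 < s, s <= 1 / 2, s <= d / 2 & s <= e / 2 / (M + 1)].
  split; rewrite /s.
  - by rewrite !lt_min !divr_gt0// ltr_wpDl.
  - by rewrite !ge_min lexx.
  - by rewrite !ge_min lexx orbT.
  - by rewrite !ge_min lexx !orbT.
move: sM; rewrite ler_pdivlMr ?ltr_wpDl// => sM.
have := dP (- s%:C); rewrite normcNr normc_real gtr0_norm// g1 subr0 => /(_ _) h1.
have {}h1 := h1 ltac:(lra).
have := MP s s0 ltac:(lra); rewrite rmorphB/= rmorph1 => h2.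
have := normcB (g (1 - s%:C)) (g (1 - s%:C) - l * - s%:C).
have -> : g (1 - s%:C) - (g (1 - s%:C) - l * - s%:C) = - (l * s%:C) by ring.
rewrite normcNr normcM normc_real gtr0_norm// => h3.
have h4 : normc l * s <= e * s by move: h2; rewrite expr2; nra.
by rewrite ler_pM2r in h4.
Qed.

(** Flatness makes [g] and its derivative vanish at [1], so the value [0] prescribed there is the
    limit of the quotient. The order [N.+1] of [g] gives the order [N] of the quotient, whose
    flatness in turn removes the singularity. *)
Let blaschke_step g : (forall z, normc z < rho -> differentiable g z) -> flat_at1 g ->
  (forall z, normc z < rho -> differentiable (blaschke r g) z) /\
  flat_at1 (blaschke r g).
Proof.
move=> dg fg.
have n1 : normc (1 : C) < rho by rewrite normc1 (lt_trans r1).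
have g1 : g 1 = 0 by apply: flat_value => //; apply: differentiable_continuous; exact: dg.
have [l dl] := (differentiable_cderiv g 1).1 (dg 1 n1).
have l0 := flat_deriv g1 dl fg.
have bE : blaschke r g = fun z => quotient g 1 l z * (((r ^+ 2)%:C - z) / r%:C).
  apply/funext => z; rewrite /blaschke /quotient; case: eqVneq => [_|z1].
    by rewrite l0 mul0r.
  by rewrite g1 subr0; field; rewrite rC subr_eq0 z1.
have dp z : differentiable (fun z : C => ((r ^+ 2)%:C - z) / r%:C) z.
  by apply: differentiableM => //; apply: differentiableB.
have flb : flat_at1 (blaschke r g).
  move=> N; have [M M0 MP] := flat_ge0 N.+1 fg.
  exists (M * r) => s s0 s1.
  have sC : s%:C != 0 :> C by rewrite -normc_eq0 normc_real gtr0_norm// gt_eqF.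
  rewrite /blaschke; case: eqVneq => [/eqP|_].
    rewrite rmorphB/= rmorph1 -subr_eq0 addrC addKr oppr_eq0; move: sC => /negbTE -> //.
  have -> : (r ^+ 2)%:C - (1 - s)%:C = (r ^+ 2 - 1 + s)%:C :> C.
    by rewrite -rmorphB/=; congr (_%:C); ring.
  have -> : r%:C * ((1 - s)%:C - 1) = - (r * s)%:C :> C.
    by rewrite rmorphB rmorphM rmorph1; ring.
  rewrite invrN mulrN normcNr !normcM normcV !normc_real.
  have rs : 0 < r * s by rewrite mulr_gt0.
  have r21 : 1 < r ^+ 2 by rewrite exprn_egt1.
  rewrite (gtr0_norm rs) ger0_norm; last lra.
  rewrite ler_pdivrMr//.
  apply: le_trans (_ : M * s ^+ N.+1 * r ^+ 2 <= _).
    apply: ler_pM; rewrite ?normc_ge0//; [lra|exact: MP|lra].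
  by rewrite exprS le_eqVlt; apply/orP; left; apply/eqP; ring.
split=> // z zr; have [->|z1] := eqVneq z 1; last first.
  rewrite bE; exact: (differentiable_mul (differentiable_quotient l z1 (dg z zr)) (dp z)).
apply: (@removable_flat _ 1 (rho - 1)).
- by move: n1; rewrite normc1; lra.
- move=> w wr; have wrho : normc w < rho.
    by have := normcD (w - 1) 1; rewrite subrK normc1; lra.
  rewrite bE; apply: continuous_mul; last exact: differentiable_continuous.
  have [->|w1] := eqVneq w 1; first exact: continuous_quotient_at.
  by apply: continuous_quotient => //; apply: differentiable_continuous; exact: dg.
- move=> w wr w1; have wrho : normc w < rho.
    by have := normcD (w - 1) 1; rewrite subrK normc1; lra.
  rewrite bE; exact: (differentiable_mul (differentiable_quotient l w1 (dg w wrho)) (dp w)).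
- move=> e d e0 d0; have [M M0 MP] := flat_ge0 2 flb.
  pose s := Num.min (1 / 2) (Num.min (d / 2) (e / 2 / (M + 1))).
  have [s0 s12 sd sM] : [/\ 0 < s, s <= 1 / 2, s <= d / 2 & s <= e / 2 / (M + 1)].
    split; rewrite /s.
    - by rewrite !lt_min !divr_gt0// ltr_wpDl.
    - by rewrite !ge_min lexx.
    - by rewrite !ge_min lexx orbT.
    - by rewrite !ge_min lexx !orbT.
  move: sM; rewrite ler_pdivlMr ?ltr_wpDl// => sM.
  exists (- s%:C); split.
  + by rewrite oppr_eq0 -normc_eq0 normc_real gtr0_norm// gt_eqF.
  + by rewrite normcNr normc_real gtr0_norm//; lra.
  + rewrite {2}/blaschke eqxx subr0 normcM normcV normcNr normc_real gtr0_norm//.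
    rewrite ltr_pdivrMr//; have := MP s s0 ltac:(lra); rewrite rmorphB/= rmorph1.
    move=> /le_lt_trans; apply; rewrite expr2; nra.
Qed.

(* Dividing by the Blaschke factor preserves flatness at [1] and the bound on the
   circle of radius [r], but multiplies the value at [0] by [r > 1] each time. *)
Lemma flat_center_eq0 g M : (forall z, normc z < rho -> differentiable g z) ->
  flat_at1 g -> (forall z, normc z = r -> normc (g z) <= M) -> g 0 = 0.
Proof.
move=> dg fg gM.
pose G n := iter n (blaschke r) g.
have GP n : (forall z, normc z < rho -> differentiable (G n) z) /\ flat_at1 (G n).
  by elim: n => // n [d f]; exact: blaschke_step.
have Gr n z : normc z = r -> normc (G n z) <= M.
  move=> zr; elim: n => [|n ih]; first exact: gM.
  rewrite /G/= -/(G n) /blaschke; case: eqVneq => [_|z1].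
    by rewrite normc0; exact: le_trans (normc_ge0 _) ih.
  suff -> : normc (G n z * ((r ^+ 2)%:C - z) / (r%:C * (z - 1))) = normc (G n z) by [].
  rewrite !normcM normcV normcM normc_real gtr0_norm//.
  have z1' : normc (z - 1) != 0 by rewrite normc_eq0 subr_eq0.
  (* The Blaschke factor has modulus [1] on the circle of radius [r]. *)
  have -> : normc ((r ^+ 2)%:C - z) = r * normc (z - 1).
    apply/eqP; rewrite -(@eqrXn2 _ 2) ?mulr_ge0 ?normc_ge0// ?ltW// exprMn.
    have : Re z ^+ 2 + Im z ^+ 2 = r ^+ 2 by rewrite -normc_sqr zr.
    rewrite !normc_sqr; case: (z) => x y /= h; apply/eqP.
    by rewrite -h; ring.
  by field; rewrite z1' gt_eqF.
have G0 n : normc (G n 0) = r ^+ n * normc (g 0).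
  elim: n => [|n ih]; first by rewrite mul1r.
  rewrite /G/= -/(G n) /blaschke eq_sym oner_eq0 subr0 sub0r mulrN1 invrN mulrN normcNr.
  rewrite !normcM normcV !normc_real ih !gtr0_norm ?exprn_gt0//.
  by rewrite [r ^+ n.+1]exprS expr2; field; rewrite gt_eqF.
apply/eqP; rewrite -normc_eq0; apply/negPn/negP => g0.
have g0' : 0 < normc (g 0) by rewrite lt_neqAle eq_sym g0 normc_ge0.
have [n] := expr_large (M / normc (g 0)) r1.
rewrite ltr_pdivrMr// -G0 ltNge => /negP; apply.
apply: (max_principle (GP n).1 r0 rrho); first exact: Gr.
by rewrite normc0 ltW.
Qed.

End step.
End flat.

(** * Measure preserving maps of C^n *)

Section preserves.
Local Open Scope ereal_scope.
Context d (T : measurableType d) (R : realType).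
Implicit Types (m : set T -> \bar R) (f g : T -> T).

Definition preserves m f :=
  measurable_fun [set: T] f /\ forall A, measurable A -> m (f @^-1` A) = m A.

Lemma preserves_comp m f g : preserves m f -> preserves m g -> preserves m (f \o g).
Proof.
move=> [mf hf] [mg hg]; split; first exact: measurableT_comp.
move=> A mA; rewrite comp_preimage hg ?hf//.
by rewrite -[X in measurable X]setTI; exact: mf.
Qed.

Lemma ge0_integral_preserves (m : {measure set T -> \bar R}) f D (h : T -> \bar R) :
  preserves m f -> measurable D -> measurable_fun D h -> (forall x, D x -> 0 <= h x) ->
  \int[m]_(x in D) h x = \int[m]_(x in f @^-1` D) h (f x).
Proof.
move=> [mf hf] mD mh h0; rewrite -(ge0_integral_pushforward mf)//; last first.
  by move=> y; rewrite inE; exact: h0.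
by apply: eq_measure_integral => A mA _; exact/esym/hf.
Qed.

End preserves.

Section preserves_product.
Local Open Scope ereal_scope.
Context d1 d2 (T1 : measurableType d1) (T2 : measurableType d2) (R : realType).
Variable m1 : {sigma_finite_measure set T1 -> \bar R}.
Variable m2 : {sigma_finite_measure set T2 -> \bar R}.

(** Slice by slice: the section at [x] of the preimage is the preimage of the section under
    [g x]. *)
Lemma preserves_skew2 (g : T1 -> T2 -> T2) :
  measurable_fun setT (fun p : T1 * T2 => (p.1, g p.1 p.2)) ->
  (forall x, preserves m2 (g x)) ->
  preserves (product_measure m1 m2) (fun p => (p.1, g p.1 p.2)).
Proof.
move=> mg hg; split=> // A mA; rewrite /product_measure /product_measure1.
apply: eq_integral => x _ /=; rewrite -[RHS](hg x).2; last exact: measurable_xsection.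
by congr (m2 _); apply/seteqP; split => y /=; rewrite /xsection/= !inE.
Qed.

(** The product measure is defined by integrating over the first factor; [preserves_skew1]
    integrates over the second. *)
Lemma product_measureE A : measurable A -> product_measure m1 m2 A = (m1 \x^ m2) A.
Proof.
move=> mA; apply: product_measure_unique => // B D mB mD.
exact: product_measure2E.
Qed.

Lemma preserves_skew1 (f : T2 -> T1 -> T1) :
  measurable_fun setT (fun p : T1 * T2 => (f p.2 p.1, p.2)) ->
  (forall y, preserves m1 (f y)) ->
  preserves (product_measure m1 m2) (fun p => (f p.2 p.1, p.2)).
Proof.
move=> mf hf; split=> // A mA; rewrite !product_measureE//; last first.
  by rewrite -[X in measurable X]setTI; exact: mf.
apply: eq_integral => y _ /=; rewrite -[RHS](hf y).2; last exact: measurable_ysection.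
by congr (m1 _); apply/seteqP; split => x /=; rewrite /ysection/= !inE.
Qed.

Lemma preserves_prod (f : T1 -> T1) (g : T2 -> T2) :
  preserves m1 f -> preserves m2 g ->
  preserves (product_measure m1 m2) (fun p => (f p.1, g p.2)).
Proof.
move=> hf hg.
have h1 : preserves (product_measure m1 m2) (fun p => (f p.1, p.2)).
  apply: (@preserves_skew1 (fun=> f)) => //.
  by apply: measurable_fun_pair => //=; apply: measurableT_comp => //; exact: hf.1.
have h2 : preserves (product_measure m1 m2) (fun p => (p.1, g p.2)).
  apply: (@preserves_skew2 (fun=> g)) => //.
  by apply: measurable_fun_pair => //=; apply: measurableT_comp => //; exact: hg.1.
exact: preserves_comp h1 h2.
Qed.

End preserves_product.

Section preserves_plane.
Variable R : realType.
Local Notation leb := (@lebesgue_measure R).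
Local Notation T := (measurableTypeR R).
Local Notation leb2 := (product_measure leb leb).

Lemma preserves_translation (c : R) : preserves leb (fun x : T => (x + c : T)).
Proof.
have mf : measurable_fun setT (fun x : T => (x + c : T)).
  by apply: measurable_funD.
split=> // A mA; apply/esym.
apply: (@lebesgue_measure_unique R (pushforward leb (fun x : T => (x + c : T)))) => //.
move=> _ [[a b]] _ <-.
change (leb `]a, b]%classic = leb ((fun x : R => x + c) @^-1` `]a, b]%classic)).
rewrite (_ : _ @^-1` _ = `]a - c, b - c]%classic); last first.
  by apply/seteqP; split => x /=; rewrite !in_itv/= ltrBlDr lerBrDr.
by rewrite !lebesgue_measure_itv/= !lte_fin ltrD2r -!EFinD; case: ifP => // _; congr (_%:E); ring.
Qed.

Lemma preserves_shear1 (a c : R) :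
  preserves leb2 (fun p : T * T => ((p.1 + (a * p.2 + c), p.2) : T * T)).
Proof.
apply: (@preserves_skew1 _ _ T T R leb leb (fun y x => (x + (a * y + c) : R))).
  by apply: measurable_fun_pair => //=; apply: measurable_funD => //; apply: measurable_funD => //;
     apply: measurable_funM.
by move=> y; exact: preserves_translation.
Qed.

Lemma preserves_shear2 (a c : R) :
  preserves leb2 (fun p : T * T => ((p.1, p.2 + (a * p.1 + c)) : T * T)).
Proof.
apply: (@preserves_skew2 _ _ T T R leb leb (fun x y => (y + (a * x + c) : R))).
  by apply: measurable_fun_pair => //=; apply: measurable_funD => //; apply: measurable_funD => //;
     apply: measurable_funM.
by move=> y; exact: preserves_translation.
Qed.

Definition affine (c u : R[i]) (p : T * T) : T * T :=
  let q := c + u * (p.1 +i* p.2) in (Re q, Im q).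

(** A rotation by [theta] is a product of three shears with coefficients [k], [b], [k], where
    [k = - tan (theta / 2) = - b / (1 + a)]; this excludes [u = -1], which is reached later as
    ['i * 'i]. The translation is absorbed by constants in the shears. *)
Let preserves_affine_neqN1 c u : normc u = 1 -> u != -1 -> preserves leb2 (affine c u).
Proof.
case: c => c1 c2; case: u => a b /(congr1 (fun x => x ^+ 2)).
rewrite normc_sqr/= expr1n => ab u1.
have a1 : 1 + a != 0.
  apply: contraNneq u1 => a1; have aE : a = -1 by lra.
  move: ab; rewrite aE sqrrN expr1n => /eqP; rewrite eq_sym addrC -subr_eq subrr eq_sym sqrf_eq0.
  by move=> /eqP ->; rewrite eq_complex/= oppr0 !eqxx.
pose k := - b / (1 + a).
have kb : k * b = a - 1.
  have -> : k * b = - b ^+ 2 / (1 + a) by rewrite /k; field.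
  have -> : b ^+ 2 = (1 - a) * (1 + a) by move: ab; rewrite !expr2; lra.
  by field.
have ka : k * (1 + a) = - b by rewrite /k; field.
have := preserves_comp (preserves_shear2 0 c2) (preserves_comp (preserves_shear1 k c1)
  (preserves_comp (preserves_shear2 b 0) (preserves_shear1 k 0))).
congr (preserves _ _); apply/funext => -[x y] /=.
rewrite /affine/=; congr pair.
  have -> : x + (k * y + 0) + (k * (y + (b * (x + (k * y + 0)) + 0)) + c1) =
    x + k * y * 2 + k * b * x + k * b * (k * y) + c1 by ring.
  rewrite kb; have -> : x + k * y * 2 + (a - 1) * x + (a - 1) * (k * y) + c1 =
    a * x + k * (1 + a) * y + c1 by ring.
  by rewrite ka; ring.
have -> : y + (b * (x + (k * y + 0)) + 0) + (0 * (x + (k * y + 0) +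
  (k * (y + (b * (x + (k * y + 0)) + 0)) + c1)) + c2) = y + b * x + k * b * y + c2 by ring.
by rewrite kb; ring.
Qed.

Lemma preserves_affine c u : normc u = 1 -> preserves leb2 (affine c u).
Proof.
have [->|u1] := eqVneq u (-1); last by move=> ?; exact: preserves_affine_neqN1.
move=> _; have i1 : normc 'i = 1 :> R by rewrite /normc expr0n expr1n add0r sqrtr1.
have iN : 'i != -1 :> R[i] by rewrite eq_complex/= oppr0 oner_eq0 andbF.
have := preserves_comp (preserves_affine_neqN1 c i1 iN) (preserves_affine_neqN1 0 i1 iN).
congr (preserves _ _); apply/funext => -[x y] /=.
by rewrite /affine/=; case: c => c1 c2 /=; congr pair; ring.
Qed.

End preserves_plane.

Section power.
Local Open Scope ereal_scope.
Context d (T : measurableType d) (R : realType).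
Variable m : {sigma_finite_measure set T -> \bar R}.

Lemma preserves_power n (phi : 'I_n -> T -> T) : (forall j, preserves m (phi j)) ->
  preserves (power_measure m n) (fun t => [tuple phi j (tnth t j) | j < n]).
Proof.
move=> mphi; split.
  apply/measurable_fun_tnthP => i.
  rewrite [X in measurable_fun _ X](_ : _ = phi i \o (@tnth _ T ^~ i)); last first.
    by apply/funext => t /=; rewrite tnth_mktuple.
  by apply: measurableT_comp; [exact: (mphi i).1|exact: measurable_tnth].
elim: n phi mphi => [|n ih] phi mphi A mA.
  have E (t u : 0.-tuple T) : t = u by rewrite [t]tuple0 [u]tuple0.
  by congr (power_measure m 0 _); apply/seteqP; split => t /= At;
    [rewrite -(E [tuple phi j (tnth t j) | j < 0] t)|rewrite (E [tuple phi j (tnth t j) | j < 0] t)].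
pose Phi' t := [tuple phi (lift ord0 j) (tnth t j) | j < n] : n.-tuple T.
have mP' : preserves (power_measure m n) Phi'.
  split; last by move=> B mB; exact: (ih (fun j => phi (lift ord0 j)) (fun j => mphi _) B mB).
  apply/measurable_fun_tnthP => i.
  rewrite [X in measurable_fun _ X](_ : _ = phi (lift ord0 i) \o (@tnth _ T ^~ i)); last first.
    by apply/funext => t /=; rewrite tnth_mktuple.
  by apply: measurableT_comp; [exact: (mphi _).1|exact: measurable_tnth].
have mc := @measurable_tuple_cons _ T n.
have mcA : measurable (@tuple_cons _ T n @^-1` A).
  by rewrite -[X in measurable X]setTI; exact: mc.
have [_ /(_ _ mcA) h] := preserves_prod (mphi ord0) mP'.
rewrite /= /power_step /pushforward -h; congr (product_measure _ _ _).
suff E x t : [tuple phi j (tnth (tuple_cons (x, t)) j) | j < n.+1] =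
    tuple_cons (phi ord0 x, Phi' t).
  by apply/seteqP; split => -[x t] /=; rewrite E.
apply: eq_from_tnth => j; rewrite tnth_mktuple.
case: (unliftP ord0 j) => [i ->|->]; first by rewrite !tnthS tnth_mktuple.
by rewrite !tnth0.
Qed.

Lemma power_measure_box n (A : 'I_n -> set T) (P : set (\bar R)) :
  (forall j, measurable (A j)) -> (forall j, P (m (A j))) -> P 1 ->
  (forall x y, 0 <= x -> 0 <= y -> P x -> P y -> P (x * y)) ->
  P (power_measure m n [set t | forall j, A j (tnth t j)]).
Proof.
move=> + + P1 PM; elim: n A => [|n ih] A mA PA.
  rewrite /= diracE (_ : _ \in _ = true) ?mem_set// => -[]//.
have -> : power_measure m n.+1 [set t | forall j, A j (tnth t j)] =
  m (A ord0) * power_measure m n [set t | forall j, A (lift ord0 j) (tnth t j)].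
  rewrite -product_measure1E//.
    rewrite /= /power_step /pushforward /product_measure; congr (_ _).
    apply/seteqP; split => -[x t] /=.
      move=> h; split; first by have := h ord0; rewrite tnth0.
      by move=> j; have := h (lift ord0 j); rewrite tnthS.
    move=> [h0 h] j; case: (unliftP ord0 j) => [i ->|->].
      by rewrite tnthS; exact: h.
    by rewrite tnth0.
  rewrite (_ : [set t | _] = \big[setI/setT]_(j < n) ((@tnth _ T ^~ j) @^-1` A (lift ord0 j))).
    apply: bigsetI_measurable => j _; rewrite -[X in measurable X]setTI.
    by apply: measurable_tnth => //.
  apply/seteqP; split => t /=.
    by move=> h; rewrite -bigcap_seq => j _; exact: h.
  by rewrite -bigcap_seq => h j; apply: (h j); rewrite /= mem_index_enum.
by apply: PM => //; apply: (ih (fun j => A (lift ord0 j))).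
Qed.

End power.

(** * Measurability of open sets and continuous functions on C^n *)

Section lebesgue_Cn_lemmas.
Variables (R : realType) (n : nat).
Local Notation C := R[i].
Local Notation Cn := 'rV[R[i]]_n.
Local Notation T := (measurableTypeR R * measurableTypeR R)%type.
Implicit Types (v z w : Cn) (U : set Cn).

Lemma normc_coord_le v j : normc (v 0 j) <= nr v.
Proof.
apply/ler_addgt0Pr => e e0.
have : ball (0 : Cn) (nr v + e)%:C v.
  by rewrite -ball_normE /ball_/= sub0r normrN nrE ltcR ltrDl.
move=> [_ /(_ 0 j)]; rewrite -ball_normE /ball_/= mxE sub0r normrN -nr_C.
by rewrite [`|_|]nrE ltcR => /ltW.
Qed.

Lemma nr_lt v (e : R) : 0 < e -> (forall j, normc (v 0 j) < e) -> nr v < e.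
Proof.
move=> e0 ve; rewrite -ltcR -nrE.
have [->|v0] := eqVneq v 0; first by rewrite normr0 (ltcR 0 e).
have [[i j] /= hi] := @mx_norm_neq0 _ _ _ v (contra_neq (@mx_norm_eq0 _ _ _ v) v0).
rewrite -[`|v|]/(mx_norm v) hi (ord1 i) nrE ltcR nr_C; exact: ve.
Qed.

Let mpre (A : 'I_n -> set T) : (forall j, measurable (A j)) ->
  measurable [set t : n.-tuple T | forall j, A j (tnth t j)].
Proof.
move=> mA; rewrite (_ : [set t | _] = \big[setI/setT]_(j < n) ((@tnth _ T ^~ j) @^-1` A j)).
  apply: bigsetI_measurable => j _; rewrite -[X in measurable X]setTI.
  by apply: measurable_tnth => //.
apply/seteqP; split => t /=.
  by move=> h; rewrite -bigcap_seq => j _; exact: h.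
by rewrite -bigcap_seq => h j; apply: (h j); rewrite /= mem_index_enum.
Qed.

(** The sigma-algebra on tuples is the product one, so an open set is written as a union of
    countably many boxes with rational centers. *)
Lemma measurable_open_Cn U : open U -> measurable (@to_Cn R n @^-1` U).
Proof.
move=> /open_nrP oU.
pose Bx (qk : n.-tuple (rat * rat) * nat) j : set T :=
  `]ratr (tnth qk.1 j).1 - qk.2.+1%:R^-1, ratr (tnth qk.1 j).1 + qk.2.+1%:R^-1[%classic `*`
  `]ratr (tnth qk.1 j).2 - qk.2.+1%:R^-1, ratr (tnth qk.1 j).2 + qk.2.+1%:R^-1[%classic.
pose B qk : set (n.-tuple T) := [set t | forall j, Bx qk j (tnth t j)].
have mB qk : measurable (B qk).
  by apply: (@mpre (Bx qk)) => j; apply: measurableX; exact: measurable_itv.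
rewrite (_ : _ @^-1` _ = \bigcup_(qk in [set qk | B qk `<=` @to_Cn R n @^-1` U]) B qk).
  rewrite bigcup_mkcond; apply: countable_bigcupT_measurable => [|qk]; first exact: countableP.
  by case: ifP.
apply/seteqP; split => [t /= Ut|t [qk /= + Bt]]; last exact.
have [e e0 eP] := oU _ Ut.
(* Two points of a box differ by at most [2 * de] in each real coordinate, hence by less than [e] in
   each complex one. *)
have [k kP] : exists k : nat, k.+1%:R^-1 < e / 4.
  have [k _ kP] := near_infty_natSinv_lt (PosNum (divr_gt0 e0 (ltr0Sn R 3))).
  by exists k; exact: (kP k (leqnn k)).
have k0 : 0 < k.+1%:R^-1 :> R by rewrite invr_gt0.
set de : R := k.+1%:R^-1 in kP k0 *.
have q (x : R) : {q : rat | x - de < ratr q < x + de}.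
  apply: cid; have [|y] := @rat_in_itvoo R (x - de) (x + de); first by lra.
  by rewrite in_itv/= => ?; exists y.
pose qk : n.-tuple (rat * rat) * nat :=
  ([tuple (sval (q (tnth t j).1), sval (q (tnth t j).2)) | j < n], k).
exists qk; last first.
  move=> j; rewrite /Bx /qk/= !tnth_mktuple/= -/de; case: (q _) => a /= /andP[a1 a2].
  case: (q _) => b /= /andP[b1 b2].
  by split => /=; rewrite in_itv/=; apply/andP; split; lra.
move=> t' /= Bt'; apply: eP; apply: nr_lt => // j.
apply: le_lt_trans (normc_le_ReIm _) _.
have := Bt' j; rewrite /Bx /qk/= !tnth_mktuple/= -/de; case: (q _) => a /= /andP[a1 a2].
case: (q _) => b /= /andP[b1 b2].
rewrite /to_Cn !mxE; case: (tnth t' j) (tnth t j) a1 a2 b1 b2 => x' y' [x y] /= a1 a2 b1 b2.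
case=> /=; rewrite !in_itv/= => /andP[x1 x2] /andP[y1 y2].
have h1 : `|x' - x| <= 2 * de by rewrite ler_distl; apply/andP; split; lra.
have h2 : `|y' - y| <= 2 * de by rewrite ler_distl; apply/andP; split; lra.
lra.
Qed.

Lemma measurable_continuous_Cn U (u : Cn -> R) : open U ->
  (forall z, U z -> {for z, continuous u}) ->
  measurable_fun (@to_Cn R n @^-1` U) (u \o @to_Cn R n).
Proof.
move=> oU cu; apply: (measurability _ (RGenOInfty.measurableE R)) => //.
move=> _ [_ [a ->] <-].
rewrite (_ : _ `&` _ = @to_Cn R n @^-1` (U `&` u @^-1` `]a, +oo[)).
  apply: measurable_open_Cn; rewrite openE => z [Uz uz].
  apply: filterI; first exact: open_nbhs_nbhs.
  by apply: (cu z Uz); apply: open_nbhs_nbhs; split.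
by apply/seteqP; split.
Qed.

End lebesgue_Cn_lemmas.

(** * Point evaluations *)

Section submean.
Variable R : realType.
Local Notation C := R[i].
Local Notation leb := (@lebesgue_measure R).

Lemma continuous_normc (V : normedModType C) (f : V -> C) z :
  {for z, continuous f} -> {for z, continuous (fun x => normc (f x))}.
Proof.
move=> /continuous_nrP cf; apply/cvgrPdist_lt => e e0.
have [d d0 dP] := cf e e0; apply/nbhs_nrP; exists d => // y yz.
have := dP _ yz; rewrite subrKC nr_C => h.
have := normcB (f y) (f y - f z); have := normcB (f z) (f z - f y).
rewrite !subKr [normc (f z - f y)]distcC => h1 h2.
by rewrite ltr_norml; apply/andP; split; lra.
Qed.

Lemma cts_circle_norm2 (g : C -> C) rho : 1 < rho ->
  (forall z, normc z < rho -> differentiable g z) ->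
  cts 0 (pi *+ 2) (fun y => normc (g (cis y)) ^+ 2).
Proof.
move=> r1 dg.
have cg y : {for cis y, continuous g}.
  by apply: differentiable_continuous; apply: dg; rewrite normc_cis.
move=> y yI; have -> : (fun y => normc (g (cis y)) ^+ 2) =
   (fun y => Re (g (1%:C * cis y)) * Re (g (1%:C * cis y)) +
             Re ('i * g (1%:C * cis y)) * Re ('i * g (1%:C * cis y))).
  apply/funext => x; rewrite normc_sqr !mul1r; case: (g _) => a b /=; ring.
have c1 : {for y, continuous (fun y => Re (g (1%:C * cis y)))}.
  by apply: (cts_circle (g := g)) yI => x; rewrite mul1r.
have c2 : {for y, continuous (fun y => Re ('i * g (1%:C * cis y)))}.
  apply: (cts_circle (g := fun z => 'i * g z)) yI => x; rewrite mul1r.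
  have ci : {for cis x, continuous (fun _ : C => 'i : C)} by exact: cst_continuous.
  exact: (continuous_mul ci (cg x)).
exact: (continuousD (continuousM c1 c1) (continuousM c2 c2)).
Qed.

(** The mean value property is applied to [g ^+ 2], multiplied by the conjugate of its value at [0];
    the modulus on the circle is then [normc (g z) ^+ 2] up to a constant. *)
Lemma submean2 (g : C -> C) rho : 1 < rho ->
  (forall z, normc z < rho -> differentiable g z) ->
  ((pi *+ 2 * normc (g 0) ^+ 2)%:E <=
    \int[leb]_(y in `[0%R, (pi *+ 2)%R]) (normc (g (cis y)) ^+ 2)%:E)%E.
Proof.
move=> r1 dg; have cn := cts_circle_norm2 r1 dg.
have pi0 : 0 < pi *+ 2 :> R by rewrite pmulrn_lgt0// pi_gt0.
have -> : (\int[leb]_(y in `[0%R, (pi *+ 2)%R]) (normc (g (cis y)) ^+ 2)%:E)%E =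
    (RI 0 (pi *+ 2) (fun y => normc (g (cis y)) ^+ 2))%:E.
  by rewrite /RI /Rintegral fineK//; apply: integrable_fin_num => //; exact: (cts_integrable cn).
rewrite lee_fin.
have [->|g0] := eqVneq (g 0) 0.
  rewrite normc0 expr0n mulr0; apply: Rintegral_ge0 => x _; exact: sqr_ge0.
pose u := ((g 0) ^+ 2)^*; pose h z := u * (g z * g z).
have nu : normc u = normc (g 0) ^+ 2.
  by rewrite /u -normcX; case: ((g 0) ^+ 2) => a b /=; rewrite sqrrN.
have dh z : normc z < rho -> differentiable h z.
  move=> zr; have dgz := dg z zr.
  exact: (differentiable_mul (differentiable_cst u z) (differentiable_mul dgz dgz)).
have Reh0 : Re (h 0) = (normc (g 0) ^+ 2) ^+ 2.
  by rewrite /h -expr2 -normcX normc_sqr /u; case: ((g 0) ^+ 2) => a b /=; ring.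
have := mean_value_Re dh ltr01 r1; rewrite Reh0 => mv.
have n0 : 0 < normc (g 0) ^+ 2 by rewrite exprn_gt0// normc_gt0.
rewrite -(ler_pM2l n0) mulrCA -expr2 -mv.
have cu : cts 0 (pi *+ 2) (fun y => normc (g 0) ^+ 2 * normc (g (cis y)) ^+ 2).
  move=> y yI; exact: (continuousM (@cst_continuous _ _ (normc (g 0) ^+ 2) y) (cn y yI)).
have <- : RI 0 (pi *+ 2) (fun y => normc (g 0) ^+ 2 * normc (g (cis y)) ^+ 2) =
    normc (g 0) ^+ 2 * RI 0 (pi *+ 2) (fun y => normc (g (cis y)) ^+ 2).
  by apply: RintegralZl => //; exact: (cts_integrable cn).
have ch : cts 0 (pi *+ 2) (fun y => Re (h (1%:C * cis y))).
  apply: (cts_circle (g := h)) => y; rewrite mul1r.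
  by apply: differentiable_continuous; apply: dh; rewrite normc_cis.
apply: (RI_le ch cu) => y _.
apply: le_trans (le_Re_normc _) _.
by rewrite /h mul1r normcM nu -expr2 normcX.
Qed.

End submean.

Section point_evaluation.
Variables (R : realType) (n : nat).
Local Notation C := R[i].
Local Notation Cn := 'rV[R[i]]_n.
Local Notation leb := (@lebesgue_measure R).
Local Notation T := (measurableTypeR R * measurableTypeR R)%type.
Local Notation mu := (@lebesgue_Cn R n).
Implicit Types (Omega : set Cn) (f : Cn -> C) (z w b : Cn).

Lemma differentiable_slice f z w (l : C) : differentiable f (z + l *: w) ->
  differentiable (fun l : C => f (z + l *: w)) l.
Proof. by move=> hf; apply: (@differentiable_comp _ _ _ _ (fun l : C => z + l *: w) f). Qed.

(** The norm of a row is the largest modulus of a coordinate, so its balls are polydiscs with equal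
    radii. *)
Definition polydisc b (r : R) : set Cn := [set z | nr (z - b) < r].

Lemma polydisc_open b r : open (polydisc b r).
Proof.
apply/open_nrP => z zr; exists (r - nr (z - b)); first by rewrite subr_gt0.
move=> y yz; rewrite /polydisc/=.
by have := nrD (y - z) (z - b); rewrite addrA subrK; move: yz; lra.
Qed.

Definition rotate (b : Cn) (u : C) (t : n.-tuple T) : n.-tuple T :=
  [tuple affine ((1 - u) * b 0 j) u (tnth t j) | j < n].

Lemma to_Cn_rotate b u t : to_Cn (rotate b u t) = b + u *: (to_Cn t - b).
Proof.
apply/rowP => j; rewrite !mxE tnth_mktuple; case: (tnth t j) => x y /=.
by case: u => p q; case: (b 0 j) => b1 b2 /=;
  apply/eqP; rewrite eq_complex/=; apply/andP; split; apply/eqP; ring.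
Qed.

Lemma preserves_rotate b u : normc u = 1 -> preserves mu (rotate b u).
Proof.
move=> u1; apply: (@preserves_power _ _ _ _ n (fun j => affine ((1 - u) * b 0 j) u)).
by move=> j; exact: preserves_affine.
Qed.

(** Measurability jointly in the angle and the point, as Tonelli's theorem requires in
    [point_eval]. *)
Lemma measurable_rotate b :
  measurable_fun setT (fun p : measurableTypeR R * n.-tuple T => rotate b (cis p.1) p.2).
Proof.
apply/measurable_fun_tnthP => j.
rewrite [X in measurable_fun _ X](_ : _ =
  (fun p => affine ((1 - cis p.1) * b 0 j) (cis p.1) (tnth p.2 j))); last first.
  by apply/funext => p /=; rewrite tnth_mktuple.
have mc : measurable_fun setT (fun p : measurableTypeR R * n.-tuple T => cos p.1 : measurableTypeR R).
  apply: (@measurableT_comp _ _ _ _ _ _ (@cos R : measurableTypeR R -> measurableTypeR R)) => //.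
  by apply: continuous_measurable_fun; exact: continuous_cos.
have ms : measurable_fun setT (fun p : measurableTypeR R * n.-tuple T => sin p.1 : measurableTypeR R).
  apply: (@measurableT_comp _ _ _ _ _ _ (@sin R : measurableTypeR R -> measurableTypeR R)) => //.
  by apply: continuous_measurable_fun; exact: continuous_sin.
have mt : measurable_fun setT (fun p : measurableTypeR R * n.-tuple T => tnth p.2 j).
  by apply: (@measurableT_comp _ _ _ _ _ _ (fun t : n.-tuple T => tnth t j)) => //; exact: measurable_tnth.
have m1 : measurable_fun setT (fun p : measurableTypeR R * n.-tuple T => (tnth p.2 j).1).
  exact: (measurableT_comp measurable_fst mt).
have m2 : measurable_fun setT (fun p : measurableTypeR R * n.-tuple T => (tnth p.2 j).2).
  exact: (measurableT_comp measurable_snd mt).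
apply: measurable_fun_pair => /=.
  rewrite [X in measurable_fun _ X](_ : _ = (fun p => ((1 - cos p.1) * Re (b 0 j) + sin p.1 * Im (b 0 j))
     + (cos p.1 * (tnth p.2 j).1 - sin p.1 * (tnth p.2 j).2))); last first.
    by apply/funext => p /=; case: (b 0 j) => b1 b2 /=; ring.
  apply: measurable_funD; first apply: measurable_funD.
  - by apply: measurable_funM => //; apply: measurable_funB.
  - by apply: measurable_funM.
  - by apply: measurable_funB; apply: measurable_funM.
rewrite [X in measurable_fun _ X](_ : _ = (fun p => ((1 - cos p.1) * Im (b 0 j) - sin p.1 * Re (b 0 j))
   + (cos p.1 * (tnth p.2 j).2 + sin p.1 * (tnth p.2 j).1))); last first.
  by apply/funext => p /=; case: (b 0 j) => b1 b2 /=; ring.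
apply: measurable_funD; first apply: measurable_funB.
- by apply: measurable_funM => //; apply: measurable_funB.
- by apply: measurable_funM.
- by apply: measurable_funD; apply: measurable_funM.
Qed.

End point_evaluation.

Section point_eval.
Variables (R : realType) (n : nat).
Local Notation C := R[i].
Local Notation Cn := 'rV[R[i]]_n.
Local Notation leb := (@lebesgue_measure R).
Local Notation T := (measurableTypeR R * measurableTypeR R)%type.
Local Notation mu := (@lebesgue_Cn R n).
Implicit Types (Omega : set Cn) (f : Cn -> C) (z w b : Cn).

Lemma measurable_norm2 f U : open U -> (forall z, U z -> {for z, continuous f}) ->
  measurable_fun (@to_Cn R n @^-1` U) (fun t => (normc (f (to_Cn t)) ^+ 2)%:E).
Proof.
move=> oU cf; apply/measurable_EFinP.
apply: (@measurable_continuous_Cn R n U (fun z => normc (f z) ^+ 2)) => // z Uz.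
have cn := continuous_normc (cf z Uz).
exact: (continuousM cn cn).
Qed.

Lemma slice_norm2 f b r t : (forall z, polydisc b r z -> differentiable f z) ->
  polydisc b r (to_Cn t) ->
  ((pi *+ 2 * normc (f b) ^+ 2)%:E <= \int[leb]_(y in `[0%R, (pi *+ 2)%R])
    (normc (f (b + cis y *: (to_Cn t - b))) ^+ 2)%:E)%E.
Proof.
move=> df tP; pose w := to_Cn t - b.
have wr : nr w < r by exact: tP.
(* The largest radius for which the complex disc through [b] in direction [w] stays in the polydisc;
   for [w = 0] any number above [1] will do. *)
pose rho := if nr w == 0 then 2 else r / nr w.
have [rho1 rhow] : 1 < rho /\ forall l : C, normc l < rho -> normc l * nr w < r.
  rewrite /rho; case: eqP => [->|/eqP w0].
    split; first lra.
    by move=> l _; rewrite mulr0 (le_lt_trans (nr_ge0 w)).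
  have w0' : 0 < nr w by rewrite lt_neqAle eq_sym w0 nr_ge0.
  split; first by rewrite ltr_pdivlMr// mul1r.
  by move=> l; rewrite ltr_pdivlMr.
have := @submean2 R (fun l => f (b + l *: w)) rho rho1.
rewrite scale0r addr0; apply => l lr; apply: differentiable_slice; apply: df.
by rewrite /polydisc/= addrC addKr nrZ; exact: rhow.
Qed.

(** The integral over the polydisc is unchanged by rotations about [b]. Averaging over them and
    exchanging integrals, each point [t] contributes a circle mean, which [slice_norm2] bounds from
    below by the value at the center. *)
Lemma point_eval f b r : (forall z, polydisc b r z -> differentiable f z) ->
  ((normc (f b) ^+ 2)%:E * mu (@to_Cn R n @^-1` polydisc b r) <=
   \int[mu]_(t in @to_Cn R n @^-1` polydisc b r) (normc (f (to_Cn t)) ^+ 2)%:E)%E.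
Proof.
move=> df; set D := _ @^-1` _; pose phi t := (normc (f (to_Cn t)) ^+ 2)%:E.
have mD : measurable D by apply: measurable_open_Cn; exact: polydisc_open.
have mphi : measurable_fun D phi.
  apply: measurable_norm2; first exact: polydisc_open.
  by move=> z zP; apply: differentiable_continuous; exact: df.
have phi0 t : (0 <= phi t)%E by rewrite lee_fin sqr_ge0.
have mphiD : measurable_fun setT (phi \_ D).
  by apply/(measurable_restrictT phi).
have phiD0 t : (0 <= (phi \_ D) t)%E by rewrite patchE; case: ifP.
pose I : set R := `[0%R, (pi *+ 2)%R]%classic.
have mI : measurable I by exact: measurable_itv.
pose H (p : measurableTypeR R * n.-tuple T) : \bar R :=
  ((phi \_ D) (rotate b (cis p.1) p.2) * (\1_I p.1)%:E)%E.
have mH : measurable_fun setT H.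
  apply: emeasurable_funM.
    exact: (measurableT_comp mphiD (@measurable_rotate R n b)).
  apply/measurable_EFinP.
  exact: (measurableT_comp (measurable_indic mI) measurable_fst).
have H0 p : (0 <= H p)%E by rewrite mule_ge0// lee_fin.
have nrot y : normc (cis y) = 1 :> R := normc_cis y.
pose A := (\int[mu]_(t in D) phi t)%E.
have Arot y : (\int[mu]_t (phi \_ D) (rotate b (cis y) t) = A)%E.
  rewrite /A (integral_mkcond D).
  by rewrite [RHS](ge0_integral_preserves (preserves_rotate b (nrot y))).
have pi0 : 0 < pi *+ 2 :> R by rewrite pmulrn_lgt0// pi_gt0.
have lebI : leb I = (pi *+ 2)%:E.
  by rewrite lebesgue_measure_itv/= lte_fin pi0 oppr0 adde0.
have A0 : (0 <= A)%E by apply: integral_ge0 => t _; exact: phi0.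
have LHS : (\int[leb]_y \int[mu]_t H (y, t) = A * (pi *+ 2)%:E)%E.
  have inner y : (\int[mu]_t H (y, t) = A * (\1_I y)%:E)%E.
    rewrite -(Arot y) /H/= ge0_integralZr//.
    exact: (measurableT_comp mphiD (preserves_rotate b (nrot y)).1).
  under eq_integral do rewrite inner.
  have mi : measurable_fun setT (fun y : measurableTypeR R => (\1_I y)%:E : \bar R).
    by apply/measurable_EFinP; exact: measurable_indic.
  have := @ge0_integralZl _ _ _ leb setT measurableT (fun y => (\1_I y)%:E) mi A.
  move=> -> //.
  congr (_ * _)%E; rewrite integral_indic// setIT; exact: lebI.
have mG : measurable_fun setT (fun t => \int[leb]_y H (y, t))%E.
  exact: (measurable_fun_fubini_tonelli_G H mH H0).
have RHS : ((pi *+ 2)%:E * ((normc (f b) ^+ 2)%:E * mu D) <= \int[mu]_t \int[leb]_y H (y, t))%E.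
  rewrite muleA -EFinM -integral_cst// (integral_mkcond D).
  have c0 : 0 <= pi *+ 2 * normc (f b) ^+ 2 by rewrite mulr_ge0 ?sqr_ge0// ltW.
  apply: ge0_le_integral => //.
  - by move=> t _; rewrite patchE; case: ifP => // _; rewrite lee_fin.
  - by apply/(measurable_restrictT (cst (pi *+ 2 * normc (f b) ^+ 2)%:E)) => //; exact: measurable_cst.
  move=> t _; rewrite patchE; case: ifPn => [|_]; last by apply: integral_ge0.
  rewrite inE => tD; apply: le_trans (slice_norm2 df tD) _.
  rewrite [X in (X <= _)%E]integral_mkcond le_eqVlt; apply/orP; left; apply/eqP.
  apply: eq_integral => y _; rewrite /H/= !patchE indicE /I.
  have -> : rotate b (cis y) t \in D.
    rewrite inE /D/= to_Cn_rotate /polydisc/= addrC addKr nrZ normc_cis mul1r.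
    exact: tD.
  by case: ifP; rewrite ?mule1 ?mule0// /phi to_Cn_rotate.
have E : (A * (pi *+ 2)%:E = \int[mu]_t \int[leb]_y H (y, t))%E.
  by rewrite -LHS; exact: (fubini_tonelli H mH H0).
move: RHS; rewrite -E [X in (_ <= X)%E -> _]muleC lee_pmul2l// lte_fin.
Qed.

End point_eval.

(** * The space A^2 *)

Section volume.
Variables (R : realType) (n : nat).
Local Notation C := R[i].
Local Notation Cn := 'rV[R[i]]_n.
Local Notation leb := (@lebesgue_measure R).
Local Notation T := (measurableTypeR R * measurableTypeR R)%type.
Local Notation mu := (@lebesgue_Cn R n).
Implicit Types (Omega : set Cn) (f : Cn -> C) (z w b : Cn).

Let square (s : R) : set T := `]- s, s[%classic `*` `]- s, s[%classic.

Let msquare s : measurable (square s).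
Proof. by apply: measurableX; exact: measurable_itv. Qed.

Let square_measure s : 0 < s ->
  product_measure leb leb (square s) = ((2 * s) * (2 * s))%:E.
Proof.
move=> s0; have l : leb `]- s, s[%classic = (2 * s)%:E.
  rewrite lebesgue_measure_itv/= lte_fin; have -> : - s < s by lra.
  by rewrite -EFinB; congr (_%:E); ring.
rewrite EFinM -l; apply: product_measure1E; exact: measurable_itv.
Qed.

Let mbox s : measurable [set t : n.-tuple T | forall j, square s (tnth t j)].
Proof.
rewrite (_ : [set t | _] = \big[setI/setT]_(j < n) ((@tnth _ T ^~ j) @^-1` square s)).
  apply: bigsetI_measurable => j _; rewrite -[X in measurable X]setTI.
  by apply: measurable_tnth => //; exact: msquare.
apply/seteqP; split => t /=.
  by move=> h; rewrite -bigcap_seq => j _; exact: h.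
by rewrite -bigcap_seq => h j; apply: (h j); rewrite /= mem_index_enum.
Qed.

Let mpoly b r : measurable (@to_Cn R n @^-1` polydisc b r).
Proof. by apply: measurable_open_Cn; exact: polydisc_open. Qed.

Lemma polydisc_volume_gt0 r : 0 < r -> (0 < mu (@to_Cn R n @^-1` polydisc 0 r))%E.
Proof.
move=> r0; have s0 : 0 < r / 2 by lra.
apply: (@lt_le_trans _ _ (mu [set t | forall j, square (r / 2) (tnth t j)])).
  apply: (@power_measure_box _ _ _ _ n (fun=> square (r / 2)) [set x | (0 < x)%E]) => /=.
  - by move=> _; exact: msquare.
  - by move=> _; rewrite square_measure// lte_fin !mulr_gt0.
  - by rewrite lte_fin.
  - by move=> x y _ _; exact: mule_gt0.
apply: le_measure; [by rewrite inE; exact: mbox|by rewrite inE; exact: mpoly|].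
move=> t /= ht; rewrite /polydisc/= subr0; apply: nr_lt => // j.
apply: le_lt_trans (normc_le_ReIm _) _; rewrite mxE; have := ht j.
case: (tnth t j) => x y []/=; rewrite !in_itv/= => /andP[? ?] /andP[? ?].
have h1 : `|x| < r / 2 by rewrite ltr_norml; apply/andP; split; lra.
have h2 : `|y| < r / 2 by rewrite ltr_norml; apply/andP; split; lra.
lra.
Qed.

Lemma polydisc_volume_lty r : 0 < r -> (mu (@to_Cn R n @^-1` polydisc 0 r) < +oo)%E.
Proof.
move=> r0.
apply: (@le_lt_trans _ _ (mu [set t | forall j, square r (tnth t j)])); last first.
  apply: (@power_measure_box _ _ _ _ n (fun=> square r) [set x | (x < +oo)%E]) => /=.
  - by move=> _; exact: msquare.
  - by move=> _; rewrite square_measure// ltry.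
  - by rewrite ltry.
  - by move=> x y x0 y0 xoo yoo; rewrite lte_mul_pinfty// ge0_fin_numE.
apply: le_measure; [by rewrite inE; exact: mpoly|by rewrite inE; exact: mbox|].
move=> t /=; rewrite /polydisc/= subr0 => tr j.
have h := le_lt_trans (normc_coord_le (to_Cn t) j) tr.
have := le_lt_trans (le_absRe_normc _) h; have := le_lt_trans (le_absIm_normc _) h.
rewrite mxE; case: (tnth t j) => x y /=; rewrite !ltr_norml => hy hx.
by split => /=; rewrite in_itv/=.
Qed.

Lemma polydisc_volumeE b r :
  mu (@to_Cn R n @^-1` polydisc b r) = mu (@to_Cn R n @^-1` polydisc 0 r).
Proof.
have n1 : normc (1 : C) = 1 := normc1 R.
have [_ h] : preserves mu (fun t => [tuple affine (b 0 j) 1 (tnth t j) | j < n]).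
  by apply: (@preserves_power _ _ _ _ n (fun j => affine (b 0 j) 1)) => j; exact: preserves_affine.
rewrite -h; last exact: mpoly.
congr (mu _); apply/funext => t /=; rewrite /polydisc/= subr0.
suff -> : to_Cn [tuple affine (b 0 j) 1 (tnth t j) | j < n] - b = to_Cn t by [].
apply/rowP => j; rewrite !mxE tnth_mktuple; case: (tnth t j) => x y /=.
by case: (b 0 j) => b1 b2 /=; apply/eqP; rewrite eq_complex/=; apply/andP; split; apply/eqP; ring.
Qed.

Lemma bounded_polydisc Omega : bounded_set Omega ->
  exists2 M : R, 0 < M & Omega `<=` polydisc 0 M.
Proof.
move=> [M [Mr MP]]; exists (`|Re M| + 2); first by rewrite ltr_wpDl.
move=> z Oz; rewrite /polydisc/= subr0.
have : M < (`|Re M| + 1)%:C.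
  by rewrite -(RRe_real Mr) ltcR; have := ler_norm (Re M); lra.
move=> /MP/(_ z Oz) h; have : `|z| <= (`|Re M| + 1)%:C by exact: h.
by rewrite nrE lecR; lra.
Qed.

End volume.

Section L2.
Variables (R : realType) (n : nat) (Omega : set 'rV[R[i]]_n).
Local Notation C := R[i].
Local Notation Cn := 'rV[R[i]]_n.
Local Notation T := (measurableTypeR R * measurableTypeR R)%type.
Local Notation mu := (@lebesgue_Cn R n).
Local Notation D := (@to_Cn R n @^-1` Omega).
Hypothesis oO : open Omega.
Implicit Types (f g h : Cn -> C) (z w b : Cn).

Definition I2 f : \bar R := (\int[mu]_(t in D) (normc (f (to_Cn t)) ^+ 2)%:E)%E.
Definition A2 f := holomorphic_on Omega f /\ (I2 f < +oo)%E.
Definition N2 f : R := fine (I2 f).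

(** The link between the exponents: the space for [2 * k] is studied through the map [f |-> f ^+ k]
    into [A^2]. *)
Lemma int_pow_even k f : (0 < k)%N -> int_pow (2 * k)%:R Omega f = I2 (fun z => f z ^+ k).
Proof.
move=> k0; apply: eq_integral => t _; congr (_%:E).
by rewrite powR_mulrn ?normc_ge0// normcX -exprM mulnC.
Qed.

Lemma mD : measurable D. Proof. exact: measurable_open_Cn. Qed.

Let hcont f z : holomorphic_on Omega f -> Omega z -> {for z, continuous f}.
Proof. by move=> hf Oz; apply: differentiable_continuous; exact: hf. Qed.

Lemma mnorm2 f : holomorphic_on Omega f ->
  measurable_fun D (fun t => (normc (f (to_Cn t)) ^+ 2)%:E).
Proof. by move=> hf; apply: measurable_norm2 => // z; exact: hcont. Qed.

Lemma I2_ge0 f : (0 <= I2 f)%E.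
Proof. by apply: integral_ge0 => t _; rewrite lee_fin sqr_ge0. Qed.

Lemma I2_fin f : A2 f -> I2 f = (N2 f)%:E.
Proof. by move=> [_ f2]; rewrite /N2 fineK// ge0_fin_numE// I2_ge0. Qed.

Lemma eq_N2 f g : I2 f = I2 g -> N2 f = N2 g.
Proof. by rewrite /N2 => ->. Qed.

Lemma N2_ge0 f : 0 <= N2 f.
Proof. by rewrite fine_ge0// I2_ge0. Qed.

Lemma eq_I2 f g : (forall z, Omega z -> f z = g z) -> I2 f = I2 g.
Proof. by move=> fg; apply: eq_integral => t; rewrite inE => /fg ->. Qed.

Lemma A2_D f g : A2 f -> A2 g -> A2 (fun z => f z + g z).
Proof.
move=> [hf f2] [hg g2]; split.
  by move=> z Oz; exact: (differentiable_add (hf z Oz) (hg z Oz)).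
have two0 : (0 <= 2%:E :> \bar R)%E by rewrite lee_fin.
apply: (@le_lt_trans _ _ (2%:E * I2 f + 2%:E * I2 g)%E); last first.
  by rewrite lte_add_pinfty// lte_mul_pinfty.
have mf := mnorm2 hf; have mg := mnorm2 hg.
rewrite -!ge0_integralZl//; try exact: mD; try by move=> t _; rewrite lee_fin sqr_ge0.
rewrite -ge0_integralD//; try exact: mD;
  try by [move=> t _; rewrite mule_ge0// lee_fin sqr_ge0 | exact: measurable_funeM].
apply: ge0_le_integral.
- exact: mD.
- by move=> t _; rewrite lee_fin sqr_ge0.
- exact: (@mnorm2 (fun z => f z + g z) (fun z Oz => differentiable_add (hf z Oz) (hg z Oz))).
- exact: (emeasurable_funD (measurable_funeM 2%:E mf) (measurable_funeM 2%:E mg)).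
- move=> t _; rewrite -!EFinM -EFinD lee_fin !normc_sqr.
  case: (f _) => a b; case: (g _) => c d /=.
  have := sqr_ge0 (a - c); have := sqr_ge0 (b - d); rewrite !sqrrB !sqrrD !mulr2n; lra.
Qed.

Lemma A2_Z (c : C) f : A2 f -> A2 (fun z => c * f z).
Proof.
move=> [hf f2]; split.
  by move=> z Oz; exact: (differentiable_mul (differentiable_cst c z) (hf z Oz)).
rewrite /I2; under eq_integral do rewrite normcM exprMn EFinM.
rewrite ge0_integralZl//; try exact: mD; try exact: mnorm2;
  try by [move=> t _; rewrite lee_fin sqr_ge0|rewrite lee_fin sqr_ge0].
by rewrite lte_mul_pinfty// lee_fin sqr_ge0.
Qed.

Lemma A2_B f g : A2 f -> A2 g -> A2 (fun z => f z - g z).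
Proof.
move=> Af Ag; have := A2_D Af (A2_Z (-1) Ag).
by congr A2; apply/funext => z; rewrite mulN1r.
Qed.

(** The real part of the Hermitian product; the imaginary part is recovered by replacing [f] with
    ['i * f]. *)
Definition ip f g : R :=
  Rintegral mu D (fun t => Re (f (to_Cn t) * (g (to_Cn t))^*)).

Lemma ip_integrable f g : A2 f -> A2 g ->
  mu.-integrable D (EFin \o (fun t => Re (f (to_Cn t) * (g (to_Cn t))^*))).
Proof.
move=> Af Ag; have [hf f2] := Af; have [hg g2] := Ag.
have hfg : holomorphic_on Omega (fun z => f z + g z) by have [] := A2_D Af Ag.
have hfg' : holomorphic_on Omega (fun z => f z - g z) by have [] := A2_B Af Ag.
(* Polarization reduces measurability to the continuity of moduli of holomorphic functions. *)
have polar (a b : C) : Re (a * b^*) = (normc (a + b) ^+ 2 - normc (a - b) ^+ 2) / 4.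
  by rewrite !normc_sqr; case: a => p q; case: b => s t /=; field.
have mi : measurable_fun D (EFin \o (fun t => Re (f (to_Cn t) * (g (to_Cn t))^*))).
  apply/measurable_EFinP.
  apply: (@measurable_continuous_Cn R n Omega (fun z => Re (f z * (g z)^*))) => // z Oz.
  have c1 := continuous_normc (hcont hfg Oz); have c2 := continuous_normc (hcont hfg' Oz).
  have c3 := continuousM (continuousB (continuousM c1 c1) (continuousM c2 c2))
    (@cst_continuous _ _ (4^-1 : R) z).
  have -> : (fun z => Re (f z * (g z)^*)) = (fun z => (normc (f z + g z) * normc (f z + g z)
      - normc (f z - g z) * normc (f z - g z)) * 4^-1).
    by apply/funext => x; rewrite polar !expr2.
  exact: c3.
have dom : mu.-integrable D (fun t => (normc (f (to_Cn t)) ^+ 2)%:E + (normc (g (to_Cn t)) ^+ 2)%:E)%E.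
  apply: integrableD; first exact: mD.
    apply/integrableP; split; first exact: mnorm2.
    by under eq_integral do rewrite gee0_abs ?lee_fin ?sqr_ge0//.
  apply/integrableP; split; first exact: mnorm2.
  by under eq_integral do rewrite gee0_abs ?lee_fin ?sqr_ge0//.
apply: le_integrable dom => //; first exact: mD.
move=> t _ /=; rewrite lee_fin [leRHS]ger0_norm ?addr_ge0 ?sqr_ge0//.
rewrite !normc_sqr; case: (f _) => a b; case: (g _) => c d /=.
rewrite ler_norml; apply/andP; split; last first.
  by have := sqr_ge0 (a - c); have := sqr_ge0 (b - d);
     have := sqr_ge0 a; have := sqr_ge0 b; have := sqr_ge0 c; have := sqr_ge0 d;
     rewrite !sqrrB !mulr2n; lra.
by have := sqr_ge0 (a + c); have := sqr_ge0 (b + d);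
     have := sqr_ge0 a; have := sqr_ge0 b; have := sqr_ge0 c; have := sqr_ge0 d;
     rewrite !sqrrD !mulr2n; lra.
Qed.

Lemma ipC f g : ip f g = ip g f.
Proof.
rewrite /ip; congr (Rintegral mu D _); apply/funext => t.
by case: (f _) => a b; case: (g _) => c d /=; ring.
Qed.

Lemma ipDl f g h : A2 f -> A2 g -> A2 h -> ip (fun z => f z + g z) h = ip f h + ip g h.
Proof.
move=> Af Ag Ah; rewrite -RintegralD; try exact: mD; try exact: ip_integrable.
by congr (Rintegral mu D _); apply/funext => t; rewrite mulrDl raddfD.
Qed.

Lemma ipZl (c : R) f g : A2 f -> A2 g -> ip (fun z => c%:C * f z) g = c * ip f g.
Proof.
move=> Af Ag; rewrite -RintegralZl; try exact: mD; try exact: ip_integrable.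
congr (Rintegral mu D _); apply/funext => t.
by case: (f _) => a b; case: (g _) => p q /=; ring.
Qed.

Lemma N2_ip f : N2 f = ip f f.
Proof.
rewrite /N2 /I2 /ip /Rintegral; congr fine; apply: eq_integral => t _; congr (_%:E).
by rewrite normc_sqr; case: (f _) => a b /=; ring.
Qed.

Lemma N2_D f g : A2 f -> A2 g -> N2 (fun z => f z + g z) = N2 f + 2 * ip f g + N2 g.
Proof.
move=> Af Ag; have Afg := A2_D Af Ag.
rewrite !N2_ip ipDl// [ip f _]ipC [ip g _]ipC !ipDl// [ip g f]ipC; ring.
Qed.

Lemma N2_Z (c : C) f : A2 f -> N2 (fun z => c * f z) = normc c ^+ 2 * N2 f.
Proof.
move=> Af; have [hf _] := Af.
apply: EFin_inj; rewrite -(I2_fin (A2_Z c Af)) EFinM -(I2_fin Af).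
rewrite /I2; under eq_integral do rewrite normcM exprMn EFinM.
by rewrite ge0_integralZl//; try exact: mD; try exact: mnorm2;
  try by [move=> t _; rewrite lee_fin sqr_ge0|rewrite lee_fin sqr_ge0].
Qed.

Lemma N2_B f g : A2 f -> A2 g -> N2 (fun z => f z - g z) = N2 f - 2 * ip f g + N2 g.
Proof.
move=> Af Ag; have Ag' := A2_Z (-1) Ag.
have -> : (fun z => f z - g z) = (fun z => f z + -1 * g z).
  by apply/funext => z; rewrite mulN1r.
rewrite N2_D// N2_Z// normcN normc1 expr1n mul1r.
have -> : (fun z => -1 * g z) = (fun z => (-1)%:C * g z).
  by apply/funext => z; rewrite rmorphN1.
by rewrite ipC ipZl// [ip g f]ipC; ring.
Qed.

(** By translation invariance the volume is taken at the center [0], so that the bound is uniform in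
    [b]. *)
Lemma point_eval_N2 f b r : 0 < r -> A2 f -> polydisc b r `<=` Omega ->
  normc (f b) ^+ 2 * fine (mu (@to_Cn R n @^-1` polydisc 0 r)) <= N2 f.
Proof.
move=> r0 Af PO; have [hf f2] := Af.
rewrite -lee_fin EFinM fineK; last first.
  by rewrite ge0_fin_numE// polydisc_volume_lty.
rewrite -(polydisc_volumeE b) -(I2_fin Af).
apply: le_trans (point_eval _) _; first by move=> z /PO; exact: hf.
apply: ge0_subset_integral => //.
- by apply: measurable_open_Cn; exact: polydisc_open.
- exact: mD.
- exact: mnorm2.
- by move=> t _; rewrite lee_fin sqr_ge0.
- by move=> t; exact: PO.
Qed.

End L2.

(** * Uniform limits of holomorphic functions *)

Section complex_sequences.
Variable R : realType.
Local Notation C := R[i].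
Implicit Types (u : nat -> C).

Definition cseq_lim u (x : C) := forall e : R, 0 < e ->
  exists N, forall j, (N <= j)%N -> normc (u j - x) <= e.

Lemma cseq_lim_unique u x y : cseq_lim u x -> cseq_lim u y -> x = y.
Proof.
move=> ux uy; apply/eqP; rewrite -subr_eq0 -normc_eq0 -(@le_anti _ _ (normc (x - y)) 0) ?normc_ge0 ?andbT//.
apply/ler_addgt0Pl => e e0; rewrite addr0.
have [N hN] := ux _ (divr2_gt0 e0); have [N' hN'] := uy _ (divr2_gt0 e0).
have := hN _ (leq_maxl N N'); have := hN' _ (leq_maxr N N').
set v := u _ => h1 h2; have -> : x - y = (v - y) - (v - x) by ring.
by have := normcB (v - y) (v - x); lra.
Qed.

Let real_complete (v : nat -> R) :
  (forall e : R, 0 < e -> exists N, forall j l, (N <= j)%N -> (N <= l)%N -> `|v j - v l| <= e) ->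
  exists x, forall e : R, 0 < e -> exists N, forall j, (N <= j)%N -> `|v j - x| <= e.
Proof.
move=> cv; have : cauchy (v @ \oo).
  apply: cauchy_exP => e e0; have [N hN] := cv _ (divr2_gt0 e0).
  exists (v N), N => // j /= Nj; rewrite /ball/=.
  by have := hN N j (leqnn N) Nj; lra.
move=> /cauchy_cvgP/cvg_ex[x vx]; exists x => e e0.
have /cvgrPdist_le/(_ e e0)[N _ hN] := vx.
by exists N => j Nj; rewrite distrC; exact: hN.
Qed.

Lemma cseq_complete u :
  (forall e : R, 0 < e -> exists N, forall j l, (N <= j)%N -> (N <= l)%N ->
     normc (u j - u l) <= e) ->
  exists x, cseq_lim u x.
Proof.
move=> cu.
have [|x hx] := @real_complete (fun j => Re (u j)).
  move=> e /cu[N hN]; exists N => j l Nj Nl; rewrite -raddfB/=.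
  exact: le_trans (le_absRe_normc _) (hN j l Nj Nl).
have [|y hy] := @real_complete (fun j => Im (u j)).
  move=> e /cu[N hN]; exists N => j l Nj Nl; rewrite -raddfB/=.
  exact: le_trans (le_absIm_normc _) (hN j l Nj Nl).
exists (x +i* y) => e e0.
have [N hN] := hx _ (divr2_gt0 e0); have [N' hN'] := hy _ (divr2_gt0 e0).
exists (maxn N N') => j; rewrite geq_max => /andP[/hN h1 /hN' h2].
apply: le_trans (normc_le_ReIm _) _; move: h1 h2; case: (u j) => a b /=; lra.
Qed.

Lemma cseq_limD u v x y : cseq_lim u x -> cseq_lim v y ->
  cseq_lim (fun j => u j + v j) (x + y).
Proof.
move=> ux vy e e0.
have [N hN] := ux _ (divr2_gt0 e0); have [N' hN'] := vy _ (divr2_gt0 e0).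
exists (maxn N N') => j; rewrite geq_max => /andP[/hN h1 /hN' h2].
have -> : u j + v j - (x + y) = (u j - x) + (v j - y) by ring.
by have := normcD (u j - x) (v j - y); lra.
Qed.

Lemma cseq_limZ (c : C) u x : cseq_lim u x -> cseq_lim (fun j => c * u j) (c * x).
Proof.
move=> ux e e0; have c0 : 0 < normc c + 1 by rewrite ltr_wpDl// normc_ge0.
have [N hN] := ux _ (divr_gt0 e0 c0); exists N => j /hN.
rewrite -mulrBr normcM ler_pdivlMr// => h.
by have := normc_ge0 (u j - x); lra.
Qed.

Lemma cseq_lim_norm_le u x (a : C) (M : R) : cseq_lim u x ->
  (exists N, forall j, (N <= j)%N -> normc (a - u j) <= M) -> normc (a - x) <= M.
Proof.
move=> ux [N hN]; apply/ler_addgt0Pr => e e0; have [N' hN'] := ux _ e0.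
have := hN _ (leq_maxl N N'); have := hN' _ (leq_maxr N N').
set v := u _; have -> : a - x = (a - v) + (v - x) by ring.
by have := normcD (a - v) (v - x); lra.
Qed.

End complex_sequences.

Section holomorphic_limits.
Variables (R : realType) (n : nat).
Local Notation C := R[i].
Local Notation Cn := 'rV[R[i]]_n.
Implicit Types (f g : Cn -> C) (z w a b : Cn).

Lemma diff_expansion g a e : differentiable g a -> 0 < e ->
  exists2 d : R, 0 < d & forall h, nr h < d -> normc (g (a + h) - g a - 'd g a h) <= e * nr h.
Proof.
move=> /diff_locally/eqaddoP hf e0.
have e0' : 0 < e%:C by rewrite (ltcR 0 e).
have /nbhs_nrP[d d0 dP] := hf _ e0'; exists d => // h hd.
have := dP h; rewrite subr0 => /(_ hd) /=.
by rewrite /= !fctE !nrE -rmorphM lecR [h + a]addrC opprD addrA nr_C.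
Qed.

Lemma cderiv_slice g a w : differentiable g a ->
  cderiv (fun l => g (a + l *: w)) 0 ('d g a w).
Proof.
move=> dg e e0; have w1 : 0 < nr w + 1 by rewrite ltr_wpDl// nr_ge0.
have [d d0 dP] := diff_expansion dg (divr_gt0 e0 w1).
exists (d / (nr w + 1)); first by rewrite divr_gt0.
move=> h; rewrite ltr_pdivlMr// => hd.
have := dP (h *: w); rewrite nrZ => /(_ _); rewrite add0r scale0r addr0.
rewrite linearZ/= (_ : h *: 'd g a w = 'd g a w * h); last exact: mulrC.
move=> /(_ _)/le_trans; apply.
  by have := normc_ge0 h; lra.
rewrite mulrAC -mulrA ler_pM2l//.
by rewrite ler_pdivrMr// mulrC mulrDr; have := normc_ge0 h; nra.
Qed.

Let slice_in a r w l : 0 < nr w -> normc l < r / nr w -> polydisc a r (a + l *: w).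
Proof. by move=> w0; rewrite ltr_pdivlMr// /polydisc/= addrC addKr nrZ. Qed.

Lemma cderivB (u v : C -> C) x k l : cderiv u x k -> cderiv v x l ->
  cderiv (fun t => u t - v t) x (k - l).
Proof.
move=> du dv e e0; have [d1 d10 h1] := du _ (divr2_gt0 e0).
have [d2 d20 h2] := dv _ (divr2_gt0 e0).
exists (Num.min d1 d2); first by rewrite lt_min d10.
move=> h; rewrite lt_min => /andP[/h1 k1 /h2 k2].
have -> : u (x + h) - v (x + h) - (u x - v x) - (k - l) * h =
  (u (x + h) - u x - k * h) - (v (x + h) - v x - l * h) by ring.
by apply: le_trans (normcB _ _) _; lra.
Qed.

(** [cderiv_bound] on the slice in direction [w], at half of its radius [r / nr w]; halving turns
    the constant [2] into [4]. *)
Lemma diff_bound g a r M w k : 0 < r -> (forall z, polydisc a r z -> differentiable g z) ->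
  (forall z, polydisc a r z -> normc (g z) <= M) ->
  cderiv (fun l => g (a + l *: w)) 0 k -> normc k <= 4 * M / r * nr w.
Proof.
move=> r0 dg gM dk; have [w0|w0] := eqVneq w 0.
  rewrite {}w0 nr0 mulr0 in dk *; apply/ler_addgt0Pr => e e0.
  have [d d0 dP] := dk _ e0.
  have d2 : normc (d / 2)%:C = d / 2 by rewrite normc_real gtr0_norm// divr2_gt0.
  have := dP (d / 2)%:C; rewrite d2 => /(_ _).
  rewrite !scaler0 subrr sub0r normcNr normcM d2 ler_pM2r ?divr2_gt0//.
  by rewrite add0r; apply; lra.
have nw : 0 < nr w by rewrite lt_neqAle eq_sym nr_eq0 w0 nr_ge0.
have rw : 0 < r / nr w by rewrite divr_gt0.
have -> : 4 * M / r * nr w = 2 * M / (r / nr w / 2).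
  by field; rewrite !gt_eqF.
apply: (@cderiv_bound R (fun l => g (a + l *: w)) (r / nr w) (r / nr w / 2) M k _ _ _ _ dk).
- by move=> l lr; apply: differentiable_slice; apply: dg; exact: slice_in.
- by rewrite divr_gt0.
- lra.
- by move=> l lr; apply: gM; apply: slice_in => //; lra.
Qed.

(** The increment is the value at [l = 1] of the difference quotient on the slice, to which the
    maximum principle applies. *)
Lemma lipschitz_bound g a r M w : 0 < r -> (forall z, polydisc a r z -> differentiable g z) ->
  (forall z, polydisc a r z -> normc (g z) <= M) -> nr w < r / 2 ->
  normc (g (a + w) - g a) <= 4 * M / r * nr w.
Proof.
move=> r0 dg gM wr; have [w0|w0] := eqVneq w 0.
  by rewrite w0 addr0 subrr normc0 nr0 mulr0.
have nw : 0 < nr w by rewrite lt_neqAle eq_sym nr_eq0 w0 nr_ge0.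
have rw : 0 < r / nr w by rewrite divr_gt0.
have da : differentiable g a by apply: dg; rewrite /polydisc/= subrr nr0.
pose v l := g (a + l *: w).
have dv l : normc l < r / nr w -> differentiable v l.
  by move=> lr; apply: differentiable_slice; apply: dg; exact: slice_in.
have vM l : normc l < r / nr w -> normc (v l) <= M by move=> lr; apply: gM; exact: slice_in.
have rw1 : 1 < r / nr w / 2 by rewrite ltr_pdivlMr// ltr_pdivlMr//; lra.
have q1 : quotient v 0 ('d g a w) 1 = g (a + w) - g a.
  by rewrite quotient_neq ?oner_neq0// /v scale1r scale0r addr0 subr0 divr1.
have -> : 4 * M / r * nr w = 2 * M / (r / nr w / 2).
  by field; rewrite !gt_eqF.
rewrite -q1; apply: (@max_principle_except R [:: 0] _ (r / nr w) (r / nr w / 2)).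
- move=> l lr; have [->|l0] := eqVneq l 0; first exact: (continuous_quotient_at (cderiv_slice w da)).
  by apply: continuous_quotient => //; apply: differentiable_continuous; exact: dv.
- by move=> l lr; rewrite inE => l0; exact: (differentiable_quotient _ l0 (dv l lr)).
- lra.
- lra.
- move=> l lr; have l0 : l != 0 by rewrite -normc_gt0 lr; lra.
  rewrite quotient_neq// subr0 normcM normcV lr ler_pM2r ?invr_gt0; last lra.
  apply: le_trans (normcB _ _) _.
  have h1 : normc l < r / nr w by rewrite lr; lra.
  by have := vM l h1; have := vM 0; rewrite normc0 => /(_ rw); lra.
- by rewrite normc1; lra.
Qed.

(** By [diff_bound] the differentials at [a] converge to a linear map, the candidate differential.
    [lipschitz_bound] for [fs m - fs j], uniform in [j], carries the expansion of one [fs m] over to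
    [f]; each of the three errors is at most [e / 4 * nr h]. *)
Lemma holomorphic_limit (fs : nat -> Cn -> C) f a r : 0 < r ->
  (forall j z, polydisc a r z -> differentiable (fs j) z) ->
  (forall e : R, 0 < e -> exists N, forall j l, (N <= j)%N -> (N <= l)%N ->
     forall z, polydisc a r z -> normc (fs j z - fs l z) <= e) ->
  (forall z, polydisc a r z -> cseq_lim (fs ^~ z) (f z)) ->
  differentiable f a.
Proof.
move=> r0 dfs cfs lfs.
have aP : polydisc a r a by rewrite /polydisc/= subrr nr0.
pose Lj j := 'd (fs j) a.
have ddif j l z : polydisc a r z -> differentiable (fun z => fs j z - fs l z) z.
  by move=> zP; exact: (differentiable_sub (dfs j z zP) (dfs l z zP)).
have dE j l w : cderiv (fun x => fs j (a + x *: w) - fs l (a + x *: w)) 0 (Lj j w - Lj l w).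
  exact: (cderivB (cderiv_slice w (dfs j a aP)) (cderiv_slice w (dfs l a aP))).
have cL e : 0 < e -> exists N, forall j l, (N <= j)%N -> (N <= l)%N ->
    forall w, normc (Lj j w - Lj l w) <= e * nr w.
  move=> e0; have e1 : 0 < e * r / 4 by rewrite divr_gt0// mulr_gt0.
  have [N hN] := cfs _ e1; exists N => j l Nj Nl w.
  have := diff_bound r0 (@ddif j l) (hN j l Nj Nl) (dE j l w).
  suff -> : 4 * (e * r / 4) / r * nr w = e * nr w by [].
  by field; rewrite gt_eqF.
have Lex w : exists x, cseq_lim (Lj ^~ w) x.
  apply: cseq_complete => e e0; have w1 : 0 < nr w + 1 by rewrite ltr_wpDl// nr_ge0.
  have [N hN] := cL _ (divr_gt0 e0 w1); exists N => j l Nj Nl.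
  apply: le_trans (hN j l Nj Nl w) _; rewrite mulrAC ler_pdivrMr// ler_pM2l//.
  by rewrite lerDl.
have [L LP] := choice Lex.
have linL : linear L.
  move=> c u v; apply: (cseq_lim_unique (LP _)).
  have -> : Lj ^~ (c *: u + v) = (fun j => c * Lj j u + Lj j v).
    by apply/funext => j; rewrite linearP.
  exact: cseq_limD (cseq_limZ c (LP u)) (LP v).
pose lM := GRing.isLinear.Build _ _ _ _ _ linL.
pose LL : {linear Cn -> C} := HB.pack L lM.
have LLb e : 0 < e -> exists N, forall j, (N <= j)%N -> forall w, normc (Lj j w - L w) <= e * nr w.
  move=> e0; have [N hN] := cL _ e0; exists N => j Nj w.
  by apply: (cseq_lim_norm_le (LP w)); exists N => l Nl; exact: hN.
apply/differentiable_nrP; exists LL; split.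
  move=> x; apply/continuous_nrP => e e0; have [N hN] := LLb 1 ltr01.
  have dN : differentiable (fs N) a by exact: dfs.
  have /continuous_nrP/(_ _ (divr2_gt0 e0))[d d0 dP] : {for 0, continuous (Lj N)}.
    exact: diff_continuous.
  exists (Num.min d (e / 2)); first by rewrite lt_min d0 divr2_gt0.
  move=> h; rewrite lt_min => /andP[hd he].
  have -> : LL (x + h) - LL x = L h by rewrite linearD/= [LL x + _]addrC addrK.
  rewrite nr_C; have := dP h hd; rewrite add0r linear0 subr0 nr_C => h1.
  have := hN N (leqnn N) h; rewrite mul1r => h2.
  have := normcB (Lj N h) (Lj N h - L h); rewrite subKr; lra.
move=> e e0; have e4 : 0 < e / 4 by rewrite divr_gt0.
have e1 : 0 < e * r / 16 by rewrite divr_gt0// mulr_gt0.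
have [N1 h1] := cfs _ e1; have [N2 h2] := LLb _ e4.
pose m := maxn N1 N2.
have dm := dfs m a aP; have [d d0 dP] := diff_expansion dm e4.
exists (Num.min d (r / 2)); first by rewrite lt_min d0 divr2_gt0.
move=> h; rewrite lt_min => /andP[hd hr]; rewrite !nr_C.
have ahP : polydisc a r (a + h) by rewrite /polydisc/= addrC addKr; lra.
have k1 : normc ((fs m (a + h) - fs m a) - (f (a + h) - f a)) <= e / 4 * nr h.
  have lD : cseq_lim (fun j => fs j (a + h) - fs j a) (f (a + h) - f a).
    have := cseq_limD (lfs _ ahP) (cseq_limZ (-1) (lfs _ aP)); rewrite mulN1r.
    by congr cseq_lim; apply/funext => j; rewrite mulN1r.
  apply: (cseq_lim_norm_le lD); exists N1 => j N1j.
  have := lipschitz_bound r0 (@ddif m j) (h1 m j (leq_maxl _ _) N1j) hr.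
  have -> : 4 * (e * r / 16) / r * nr h = e / 4 * nr h by field; rewrite gt_eqF.
  suff -> : fs m (a + h) - fs m a - (fs j (a + h) - fs j a) =
     fs m (a + h) - fs j (a + h) - (fs m a - fs j a) by [].
  by ring.
have k2 := dP h hd; have k3 := h2 m (leq_maxr _ _) h.
have -> : f (a + h) - f a - LL h = (fs m (a + h) - fs m a - Lj m h) -
  (fs m (a + h) - fs m a - (f (a + h) - f a)) + (Lj m h - L h) by rewrite /=; ring.
apply: le_trans (normcD _ _) _; apply: le_trans (lerD (normcB _ _) (lexx _)) _.
have : 0 <= e * nr h by rewrite mulr_ge0 ?nr_ge0// ltW.
by lra.
Qed.

End holomorphic_limits.

(** * Minimizers in A^2 *)

Section minimal.
Variables (R : realType) (n : nat) (Omega : set 'rV[R[i]]_n).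
Local Notation C := R[i].
Local Notation Cn := 'rV[R[i]]_n.
Local Notation mu := (@lebesgue_Cn R n).
Local Notation D := (@to_Cn R n @^-1` Omega).
Hypotheses (oO : open Omega) (bO : bounded_set Omega).
Implicit Types (f g h : Cn -> C) (z w a b : Cn).

Local Notation A2 := (A2 Omega).
Local Notation N2 := (N2 Omega).
Local Notation ip := (ip Omega).

Definition minimal z f :=
  [/\ A2 f, f z = 1 & forall g, A2 g -> g z = 1 -> N2 f <= N2 g].

Let V r : R := fine (mu (@to_Cn R n @^-1` polydisc 0 r)).

Let V_gt0 r : 0 < r -> 0 < V r.
Proof. by move=> r0; rewrite fine_gt0// polydisc_volume_gt0//= polydisc_volume_lty. Qed.

Lemma open_polydisc z : Omega z -> exists2 r : R, 0 < r & polydisc z r `<=` Omega.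
Proof. by move=> Oz; have /open_nrP/(_ z Oz)[r r0 rP] := oO; exists r. Qed.

Lemma A2_const (c : C) : A2 (fun=> c).
Proof.
split; first by move=> z _; exact: differentiable_cst.
have [M M0 OM] := bounded_polydisc bO.
rewrite /I2 integral_cst; last exact: mD.
rewrite lte_mul_pinfty// ?lee_fin ?sqr_ge0//.
apply: le_lt_trans (polydisc_volume_lty n M0).
apply: le_measure; rewrite ?inE; first exact: mD.
  by apply: measurable_open_Cn; exact: polydisc_open.
by move=> t; exact: OM.
Qed.

Lemma N2_eq0 f z : A2 f -> N2 f = 0 -> Omega z -> f z = 0.
Proof.
move=> Af f0 Oz; have [r r0 rO] := open_polydisc Oz.
have := point_eval_N2 oO r0 Af rO; rewrite f0 pmulr_lle0 ?V_gt0// => h.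
apply/eqP; rewrite -normc_eq0 -sqrf_eq0; apply/eqP/le_anti.
by rewrite h sqr_ge0.
Qed.

Lemma parallelogram f g : A2 f -> A2 g ->
  N2 (fun z => f z - g z) = 2 * N2 f + 2 * N2 g - N2 (fun z => f z + g z).
Proof. by move=> Af Ag; rewrite (N2_B oO Af Ag) (N2_D oO Af Ag); ring. Qed.

(** The midpoint of [f] and [g] is a competitor too, so [N2 (f + g) >= 4 * d] in the parallelogram
    law. Any lower bound [d] is allowed: the minimum gives uniqueness, the infimum gives
    existence. *)
Let avg_le (d : R) z f g : (forall h, A2 h -> h z = 1 -> d <= N2 h) ->
  A2 f -> A2 g -> f z = 1 -> g z = 1 -> N2 (fun z => f z - g z) <= 2 * N2 f + 2 * N2 g - 4 * d.
Proof.
move=> dP Af Ag fz gz; rewrite parallelogram// lerD2l lerN2.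
have Afg := A2_D oO Af Ag; have := dP _ (A2_Z oO 2^-1 Afg).
rewrite fz gz N2_Z// => /(_ _)h.
have {}h : d <= normc (2^-1 : C) ^+ 2 * N2 (fun z => f z + g z).
  by apply: h; rewrite -mulr2n -[1 *+ 2]/(2 : C) mulVf// pnatr_eq0.
have n2 : normc (2^-1 : C) = 2^-1.
  by rewrite normcV -[2 : C]/(2%:R) -(rmorph_nat (real_complex R)) normc_real normr_nat.
by rewrite n2 in h; lra.
Qed.

Lemma minimal_unique z f g w : minimal z f -> minimal z g -> Omega w -> f w = g w.
Proof.
move=> [Af fz fm] [Ag gz gm] Ow.
have fg : N2 f = N2 g by apply/eqP; rewrite eq_le fm// gm.
have := avg_le fm Af Ag fz gz; rewrite fg => h.
have {}h : N2 (fun z => f z - g z) = 0.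
  by apply/eqP; rewrite eq_le N2_ge0 andbT; lra.
by apply/eqP; rewrite -subr_eq0; apply/eqP; exact: (N2_eq0 (A2_B oO Af Ag) h).
Qed.

(** A minimizing sequence is Cauchy for [N2] by [avg_le], hence locally uniformly by point
    evaluation. Its pointwise limit is holomorphic, and Fatou's lemma keeps its norm below the
    infimum. *)
Lemma minimal_exists z : Omega z -> exists f, minimal z f.
Proof.
move=> Oz.
pose S := [set N2 f | f in [set f | A2 f /\ f z = 1]].
have S0 : has_inf S.
  split.
    exists (N2 (fun=> 1)); exists (fun=> 1); last by [].
    by split; [exact: A2_const|].
  by exists 0 => _ [f _ <-]; exact: N2_ge0.
pose d := inf S.
have dP h : A2 h -> h z = 1 -> d <= N2 h.
  by move=> Ah hz; apply: ge_inf; [exact: S0.2|exists h].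
have seqx j : exists f, [/\ A2 f, f z = 1 & N2 f < d + j.+1%:R^-1].
  have j0 : 0 < j.+1%:R^-1 :> R by rewrite invr_gt0.
  by have [_ [f [Af fz] <-] fd] := inf_adherent j0 S0; exists f.
have [fs fsP] := choice seqx.
have Afs j : A2 (fs j) by have [] := fsP j.
have diffs j l : N2 (fun z => fs j z - fs l z) <= 2 * j.+1%:R^-1 + 2 * l.+1%:R^-1.
  have [Aj jz jd] := fsP j; have [Al lz ld] := fsP l.
  apply: le_trans (avg_le dP Aj Al jz lz) _; move: jd ld.
  by set x := j.+1%:R^-1; set y := l.+1%:R^-1; lra.
have small (e : R) : 0 < e -> exists N, forall j l, (N <= j)%N -> (N <= l)%N ->
    N2 (fun z => fs j z - fs l z) <= e.
  move=> e0; have e4 : 0 < e / 4 by rewrite divr_gt0.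
  have [N _ NP] := near_infty_natSinv_lt (PosNum e4).
  exists N => j l /NP/= j4 /NP/= l4; apply: le_trans (diffs j l) _.
  move: j4 l4; set x := j.+1%:R^-1; set y := l.+1%:R^-1; lra.
have unif b r : 0 < r -> (forall x, polydisc b r x -> polydisc x r `<=` Omega) ->
    forall e : R, 0 < e -> exists N, forall j l, (N <= j)%N -> (N <= l)%N ->
      forall x, polydisc b r x -> normc (fs j x - fs l x) <= e.
  move=> r0 rO e e0; have e1 : 0 < e ^+ 2 * V r by rewrite mulr_gt0 ?exprn_gt0 ?V_gt0.
  have [N NP] := small _ e1; exists N => j l Nj Nl x xP.
  have := point_eval_N2 oO r0 (A2_B oO (Afs j) (Afs l)) (rO x xP).
  move=> /le_trans/(_ (NP j l Nj Nl)); rewrite ler_pM2r ?V_gt0// ler_sqr ?nnegrE ?normc_ge0//.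
  exact: ltW.
(* One radius that fits around every point near [b] makes point evaluation uniform there. *)
have half b : Omega b -> exists2 r : R, 0 < r & forall x, polydisc b r x -> polydisc x r `<=` Omega.
  move=> Ob; have [r r0 rO] := open_polydisc Ob; exists (r / 2); first exact: divr2_gt0.
  move=> x xb y yx; apply: rO; rewrite /polydisc/=.
  by have := nrD (y - x) (x - b); rewrite addrA subrK; move: xb yx; rewrite /polydisc/=; lra.
have lim b : exists x, Omega b -> cseq_lim (fs ^~ b) x.
  have [Ob|nOb] := pselect (Omega b); last by exists 0.
  have [r r0 rP] := half b Ob.
  have [|x xP] := @cseq_complete R (fs ^~ b); last by exists x.
  move=> e e0; have [N NP] := unif b r r0 rP e e0; exists N => j l Nj Nl.
  by apply: NP => //; rewrite /polydisc/= subrr nr0.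
have [f fP] := choice lim.
have hf : holomorphic_on Omega f.
  move=> b Ob; have [r r0 rP] := half b Ob.
  have bO' x : polydisc b r x -> Omega x.
    by move=> xP; apply: (rP x xP); rewrite /polydisc/= subrr nr0.
  apply: (holomorphic_limit r0 _ (unif b r r0 rP)).
    by move=> j x /bO' Ox; have [h _] := Afs j; exact: h.
  by move=> x /bO' Ox; exact: fP.
have fz : f z = 1.
  apply: (cseq_lim_unique (fP z Oz)) => e e0; exists 0%N => j _.
  by have [_ -> _] := fsP j; rewrite subrr normc0 ltW.
have I2f : (I2 Omega f <= d%:E)%E.
  have -> : I2 Omega f = (\int[mu]_(t in D) limn_einf (fun j => (normc (fs j (to_Cn t)) ^+ 2)%:E))%E.
    apply: eq_integral => t; rewrite inE => Ot.
    apply/esym; apply: (fst (cvg_limn_einf_sup _)).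
    apply/fine_cvgP; split; first by near=> j.
    have c1 : normc (fs j (to_Cn t)) @[j --> \oo] --> normc (f (to_Cn t)).
      apply/cvgrPdist_le => e e0; have [N NP] := fP _ Ot e e0.
      exists N => // j /= /NP h; have := normcB (fs j (to_Cn t)) (fs j (to_Cn t) - f (to_Cn t)).
      have := normcB (f (to_Cn t)) (f (to_Cn t) - fs j (to_Cn t)); rewrite !subKr.
      rewrite [normc (f _ - _)]distcC => h1 h2.
      by rewrite ler_norml; apply/andP; split; lra.
    exact: (cvgM c1 c1).
  apply: le_trans (fatou mu (mD oO) _ _) _.
  - by move=> j; apply: (mnorm2 oO); have [] := Afs j.
  - by move=> j t _; rewrite lee_fin sqr_ge0.
  rewrite le_eqVlt; apply/orP; left; apply/eqP.
  apply: (fst (cvg_limn_einf_sup _)).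
  apply/fine_cvgP; split; first near=> j.
    by have [Aj _ _] := fsP j; rewrite -/(I2 Omega (fs j)) (I2_fin Aj).
  apply/cvgrPdist_le => e e0.
  have [N _ NP] := near_infty_natSinv_lt (PosNum e0).
  exists N => // j /= /NP/= je; have [Aj jz jd] := fsP j.
  have := dP _ Aj jz; rewrite ler_norml => dj; move: je jd.
  rewrite -/(I2 Omega (fs j)) -/(N2 (fs j)); set x := j.+1%:R^-1 => je jd.
  by apply/andP; split; lra.
have Af : A2 f by split=> //; apply: le_lt_trans I2f _; rewrite ltry.
exists f; split=> // g Ag gz; apply: le_trans (dP g Ag gz).
by rewrite -lee_fin -(I2_fin Af).
Unshelve. all: by end_near. Qed.

Lemma minimal_orth z f h : minimal z f -> A2 h -> h z = 0 -> ip h f = 0.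
Proof.
move=> [Af fz fm] Ah hz; apply/eqP/negPn/negP => i0.
pose H := N2 h; have H0 : 0 <= H := N2_ge0 _ h.
(* The minimum of the quadratic in [t] is at [- ip h f / H]; the [1] avoids dividing by zero and
   still gives a decrease. *)
pose t := - ip h f / (H + 1).
have Ath := A2_Z oO t%:C Ah.
have := fm _ (A2_D oO Af Ath); rewrite fz hz mulr0 addr0 => /(_ erefl).
rewrite N2_D// N2_Z// ipC ipZl// normc_real real_normK ?num_real// -/H.
have H1 : 0 < H + 1 by lra.
suff : 2 * (t * ip h f) + t ^+ 2 * H < 0 by lra.
have -> : 2 * (t * ip h f) + t ^+ 2 * H = - (ip h f ^+ 2 * (H + 2) / (H + 1) ^+ 2).
  by rewrite /t; field; rewrite gt_eqF.
rewrite oppr_lt0 divr_gt0 ?exprn_gt0// mulr_gt0//; last lra.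
by rewrite lt_neqAle eq_sym sqrf_eq0 i0 sqr_ge0.
Qed.

Let ip_selfZ (c : C) f : A2 f -> ip (fun z => c * f z) f = Re c * N2 f.
Proof.
move=> Af; rewrite N2_ip -RintegralZl; try exact: mD; try exact: ip_integrable.
congr (Rintegral mu D _); apply/funext => t.
by case: (f _) => a b; case: c => p q /=; ring.
Qed.

(** [g - g z * f] vanishes at [z], hence is orthogonal to [f]. *)
Lemma minimal_reproducing z f g : minimal z f -> A2 g -> ip g f = Re (g z) * N2 f.
Proof.
move=> mf Ag; have [Af fz fm] := mf.
have Ah := A2_B oO Ag (A2_Z oO (g z) Af).
have := minimal_orth mf Ah; rewrite fz mulr1 subrr => /(_ erefl) h0.
rewrite -ip_selfZ//.
have Ac := A2_Z oO (g z) Af.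
have := ipDl oO Ah Ac Af; rewrite h0 add0r => <-.
by congr ip; apply/funext => x; rewrite subrK.
Qed.

Let ip_i f g : A2 f -> A2 g -> ip (fun z => 'i * f z) g = - ip (fun z => 'i * g z) f.
Proof.
move=> Af Ag; have Aig := A2_Z oO 'i Ag.
rewrite -mulN1r -RintegralZl; last 2 first.
- exact: mD.
- exact: (ip_integrable oO Aig Af).
congr (Rintegral mu D _); apply/funext => t.
by case: (f _) => a b; case: (g _) => p q /=; ring.
Qed.

(** Each minimizer is tested against the other. Since [ip] sees real parts only, a second test with
    ['i * f] and ['i * g] gives the imaginary parts. *)
Lemma minimal_hermitian z w f g : minimal z f -> minimal w g ->
  f w * (N2 g)%:C = (g z)^* * (N2 f)%:C.
Proof.
move=> mf mg; have [Af _ _] := mf; have [Ag _ _] := mg.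
have r1 := minimal_reproducing mg Af; have r2 := minimal_reproducing mf Ag.
have i1 := minimal_reproducing mg (A2_Z oO 'i Af).
have i2 := minimal_reproducing mf (A2_Z oO 'i Ag).
rewrite ip_i// i2 in i1; rewrite ipC r2 in r1.
move: r1 i1; case: (f w) => a b; case: (g z) => c d /=.
rewrite !mul0r !mul1r !sub0r => r1 i1.
by apply/eqP; rewrite eq_complex/=; apply/andP; split; apply/eqP; lra.
Qed.

Lemma minimal_N2_gt0 z f : Omega z -> minimal z f -> 0 < N2 f.
Proof.
move=> Oz [Af fz _]; rewrite lt_neqAle N2_ge0 andbT eq_sym; apply/eqP => f0.
by have := N2_eq0 Af f0 Oz; rewrite fz => /eqP; rewrite oner_eq0.
Qed.

End minimal.

(** * The Bergman kernel of a complete Reinhardt domain *)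

Section minimizers.
Variables (R : realType) (n : nat) (Omega : set 'rV[R[i]]_n).
Local Notation C := R[i].
Local Notation Cn := 'rV[R[i]]_n.
Hypotheses (oO : open Omega).
Implicit Types (f g h : Cn -> C) (z w a b : Cn) (k : nat).

Local Notation A2 := (A2 Omega).
Local Notation N2 := (N2 Omega).
Local Notation pow f k := (fun z => f z ^+ k).

(* [f] minimizes the norm of [A^(2 k)], which is a power of [N2 (f ^ k)]. *)
Definition minimal_pow k z f :=
  [/\ Ap (2 * k)%:R Omega f, f z = 1 &
      forall g, Ap (2 * k)%:R Omega g -> g z = 1 -> N2 (pow f k) <= N2 (pow g k)].

Lemma Ap_pow k f : (0 < k)%N ->
  Ap (2 * k)%:R Omega f <-> holomorphic_on Omega f /\ A2 (pow f k).
Proof.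
move=> k0; rewrite /Ap int_pow_even//; split=> -[hf f2]; split=> //.
  by split=> // z Oz; apply: differentiable_pow; exact: hf.
by have [] := f2.
Qed.

Lemma Ap_norm_pow k f : (0 < k)%N ->
  Ap_norm (2 * k)%:R Omega f = N2 (pow f k) `^ ((2 * k)%:R)^-1.
Proof. by move=> k0; rewrite /Ap_norm int_pow_even. Qed.

Let k2_gt0 k : (0 < k)%N -> 0 < ((2 * k)%:R : R)^-1.
Proof. by move=> k0; rewrite invr_gt0 ltr0n muln_gt0. Qed.

Let le_root k (x y : R) : (0 < k)%N -> 0 <= x -> 0 <= y ->
  (x `^ ((2 * k)%:R)^-1 <= y `^ ((2 * k)%:R)^-1) = (x <= y).
Proof.
move=> k0 x0 y0; apply/idP/idP => h.
  rewrite leNgt; apply/negP => yx.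
  by have := gt0_ltr_powR (k2_gt0 k0) y0 x0 yx; rewrite ltNge h.
by apply: (ge0_ler_powR (ltW (k2_gt0 k0))).
Qed.

Lemma is_minimizerP k z f : (0 < k)%N ->
  is_minimizer (2 * k)%:R Omega z f <-> minimal_pow k z f.
Proof.
move=> k0; split=> [[Af fz fm]|[Af fz fm]].
  split; [exact: Af|exact: fz|move=> g Ag gz].
  have : Ap_norm (2 * k)%:R Omega f <= Ap_norm (2 * k)%:R Omega g.
    rewrite fm; apply: ge_inf; last by exists g.
    by exists 0 => _ [h _ <-]; exact: powR_ge0.
  by rewrite (Ap_norm_pow f k0) (Ap_norm_pow g k0) (le_root k0 (N2_ge0 _ _) (N2_ge0 _ _)).
split; [exact: Af|exact: fz|apply/eqP; rewrite eq_le; apply/andP; split].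
  apply: lb_le_inf; first by exists (Ap_norm (2 * k)%:R Omega f), f.
  move=> _ [g [Ag gz] <-].
  rewrite (Ap_norm_pow f k0) (Ap_norm_pow g k0) (le_root k0 (N2_ge0 _ _) (N2_ge0 _ _)).
  exact: fm.
apply: ge_inf; last by exists f.
by exists 0 => _ [h _ <-]; exact: powR_ge0.
Qed.

Lemma Ap_Z k (c : C) f : (0 < k)%N -> Ap (2 * k)%:R Omega f ->
  Ap (2 * k)%:R Omega (fun z => c * f z) /\
  N2 (pow (fun z => c * f z) k) = normc c ^+ (2 * k) * N2 (pow f k).
Proof.
move=> k0 /(Ap_pow _ k0)[hf Af].
have E : pow (fun z => c * f z) k = (fun z => c ^+ k * f z ^+ k).
  by apply/funext => z; rewrite exprMn.
split; last by rewrite E N2_Z// normcX -exprM mulnC.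
apply/(Ap_pow _ k0); split.
  by move=> z Oz; exact: (differentiable_mul (differentiable_cst c z) (hf z Oz)).
by rewrite E; exact: A2_Z.
Qed.

(** This is [K_p = m_p ^ (- p)]: scaling passes between competitors of norm [1] and competitors with
    value [1] at [z]. *)
Lemma K_diagE k z f : (0 < k)%N -> minimal_pow k z f -> 0 < N2 (pow f k) ->
  K_diag (2 * k)%:R Omega z = (N2 (pow f k))^-1.
Proof.
move=> k0 [Af fz fm] N0; set N := N2 _ in N0 *.
have k20 : (2 * k)%:R != 0 :> R by rewrite pnatr_eq0 muln_eq0/= -lt0n.
(* The factor that gives [f] norm [1]. *)
pose c : R := N `^ (- ((2 * k)%:R)^-1).
have ck : c ^+ (2 * k) = N^-1.
  rewrite /c -powR_mulrn ?powR_ge0// -powRrM mulNr mulVf// powR_inv1// ltW//.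
have c0 : 0 <= c by exact: powR_ge0.
have nc : normc c%:C = c by rewrite normc_real ger0_norm.
have ub : ubound [set (normc (g z)) `^ (2 * k)%:R | g in [set g | Ap (2 * k)%:R Omega g /\
    Ap_norm (2 * k)%:R Omega g = 1]] N^-1.
  move=> _ [g [Ag g1] <-].
  have Ng : N2 (pow g k) = 1.
    have e1 : N2 (pow g k) `^ ((2 * k)%:R)^-1 = 1 `^ ((2 * k)%:R)^-1.
      by rewrite powR1 -(Ap_norm_pow g k0).
    by apply: (powR_injective (k2_gt0 k0) _ _ e1); rewrite nnegrE ?N2_ge0.
  rewrite powR_mulrn ?normc_ge0//; have [->|gz] := eqVneq (g z) 0.
    by rewrite normc0 expr0n muln_eq0/= gtn_eqF// invr_ge0 ltW.
  have [Ag' Ng'] := Ap_Z (g z)^-1 k0 Ag.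
  have := fm _ Ag'; rewrite mulVf// => /(_ erefl).
  rewrite Ng' Ng mulr1 normcV exprVn -/N => h.
  by rewrite -[leLHS]invrK lef_pV2// posrE// invr_gt0 exprn_gt0// normc_gt0.
have [Af' Nf'] := Ap_Z c%:C k0 Af.
have G1 : Ap_norm (2 * k)%:R Omega (fun z => c%:C * f z) = 1.
  by rewrite (Ap_norm_pow _ k0) Nf' nc ck mulVf ?gt_eqF// powR1.
have G2 : normc (c%:C * f z) `^ (2 * k)%:R = N^-1 by rewrite fz mulr1 nc powR_mulrn.
set S := [set _ | _ in _] in ub *.
have SN : S N^-1 by rewrite -G2; exists (fun z => c%:C * f z); [split; [exact: Af'|exact: G1]|].
apply/eqP; rewrite eq_le; apply/andP; split.
  by apply: ge_sup; [exists N^-1|exact: ub].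
by apply: ub_le_sup; [exists N^-1|].
Qed.

Lemma m_minP k z f : (0 < k)%N -> minimal_pow k z f ->
  minimal_pow k z (fun zeta => m_min (2 * k)%:R Omega zeta z).
Proof.
move=> k0 /(is_minimizerP _ _ k0) mf; apply/(is_minimizerP _ _ k0).
exact: (@xgetPex _ (cst 0) [set f | is_minimizer (2 * k)%:R Omega z f] (ex_intro _ f mf)).
Qed.

Let pow1 f : pow f 1 = f. Proof. by apply/funext => z; rewrite expr1. Qed.

Lemma minimal_pow1 z f : minimal_pow 1 z f <-> minimal Omega z f.
Proof.
rewrite /minimal_pow /minimal pow1; split=> -[Af fz fm]; (split; [|exact: fz|]).
- by have [_] := (Ap_pow f (ltn0Sn 0)).1 Af; rewrite pow1.
- move=> g Ag gz; have := fm g; rewrite pow1; apply; last exact: gz.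
  by apply/(Ap_pow g (ltn0Sn 0)); rewrite pow1; split=> //; have [] := Ag.
- by apply/(Ap_pow f (ltn0Sn 0)); rewrite pow1; split=> //; have [] := Af.
- move=> g /(Ap_pow g (ltn0Sn 0))[]; rewrite pow1 => hg Ag gz; exact: fm.
Qed.

End minimizers.

Section kernel.
Variables (R : realType) (n : nat) (Omega : set 'rV[R[i]]_n).
Local Notation C := R[i].
Local Notation Cn := 'rV[R[i]]_n.
Hypotheses (oO : open Omega) (bO : bounded_set Omega).
Implicit Types (f g h : Cn -> C) (z w a b zeta : Cn) (k : nat).
Local Notation N2 := (N2 Omega).
Local Notation K2 := (K_off 2 Omega).
Local Notation m2 z := (fun zeta => m_min 2 Omega zeta z).

Lemma m2P z : Omega z -> minimal Omega z (m2 z).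
Proof.
move=> Oz; have [f mf] := minimal_exists oO bO Oz.
apply/minimal_pow1 => //; apply: (@m_minP R n Omega 1 z f) => //.
by apply/minimal_pow1.
Qed.

Lemma N2_gt0 z : Omega z -> 0 < N2 (m2 z).
Proof. by move=> Oz; exact: (minimal_N2_gt0 oO Oz (m2P Oz)). Qed.

Lemma K2E zeta z : Omega z -> K2 zeta z = ((N2 (m2 z))^-1)%:C * m2 z zeta.
Proof.
move=> Oz; rewrite /K_off; congr (_%:C * _).
have := @K_diagE R n Omega oO 1 z (m2 z) (ltn0Sn 0).
rewrite (_ : (fun z0 => m2 z z0 ^+ 1) = m2 z); last by apply/funext => x; rewrite expr1.
apply; last exact: N2_gt0.
by apply/minimal_pow1 => //; exact: m2P.
Qed.

Let hermitian_quotients (p q : R) (A B : C) : 0 < p -> 0 < q ->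
  A * q%:C = conjc B * p%:C -> (p^-1)%:C * A = conjc ((q^-1)%:C * B).
Proof.
have RC (x : R) : 0 < x -> x%:C != 0 :> C.
  by move=> x0; rewrite -normc_eq0 normc_real normr_eq0 gt_eqF.
move=> /RC p0 /RC q0 AB.
have cE (x : R) (y : C) : conjc (x%:C * y) = x%:C * (conjc y).
  by case: y => a b; apply/eqP; rewrite eq_complex/=; apply/andP; split; apply/eqP; ring.
rewrite cE !fmorphV; have -> : A = conjc B * p%:C / q%:C by rewrite -AB mulfK.
by field; rewrite p0 q0.
Qed.

Lemma K2_hermitian z w : Omega z -> Omega w -> K2 w z = conjc (K2 z w).
Proof.
move=> Oz Ow; rewrite (K2E w Oz) (K2E z Ow).
exact: (hermitian_quotients (N2_gt0 Oz) (N2_gt0 Ow) (minimal_hermitian oO (m2P Oz) (m2P Ow))).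
Qed.

Lemma K2_holomorphic z : Omega z -> holomorphic_on Omega (fun zeta => K2 zeta z).
Proof.
move=> Oz w Ow; under eq_fun do rewrite (K2E _ Oz).
have [[hf _] _ _] := m2P Oz.
exact: (differentiable_mul (differentiable_cst _ w) (hf w Ow)).
Qed.

Hypothesis rO : complete_Reinhardt Omega.

Lemma balanced (c : C) z : Omega z -> normc c <= 1 -> Omega (c *: z).
Proof.
move=> Oz c1; apply: rO Oz _ => j; rewrite mxE normcM.
by rewrite ler_piMl ?normc_ge0.
Qed.

Lemma balanced0 z : Omega z -> Omega 0.
Proof. by move=> Oz; rewrite -(scale0r z); apply: balanced; rewrite ?normc0. Qed.

Let mulVu (u : C) : normc u = 1 -> (conjc u) * u = 1.
Proof.
move=> u1; have := congr1 (fun x => x ^+ 2) u1; rewrite normc_sqr expr1n.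
case: (u) => a b /= h; apply/eqP; rewrite eq_complex/=; apply/andP; split; apply/eqP.
  by rewrite -h; ring.
by ring.
Qed.

Let nconj (u : C) : normc (conjc u) = normc u.
Proof. by case: u => a b /=; rewrite sqrrN. Qed.

Lemma A2_rotate u f : normc u = 1 -> A2 Omega f ->
  A2 Omega (fun z => f (u *: z)) /\ N2 (fun z => f (u *: z)) = N2 f.
Proof.
move=> u1 [hf f2].
have IE : I2 Omega (fun z => f (u *: z)) = I2 Omega f.
  rewrite /I2 [RHS](ge0_integral_preserves (preserves_rotate 0 u1)).
  - have -> : rotate 0 u @^-1` (@to_Cn R n @^-1` Omega) = @to_Cn R n @^-1` Omega.
      apply/seteqP; split => t /=; rewrite to_Cn_rotate add0r subr0.
        move=> /balanced => /(_ (conjc u)); rewrite nconj u1 scalerA mulVu// scale1r; exact.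
      by move=> /balanced; apply; rewrite u1.
    by apply: eq_integral => t _; rewrite to_Cn_rotate add0r subr0.
  - exact: mD.
  - exact: mnorm2.
  - by move=> t _; rewrite lee_fin sqr_ge0.
split; last exact: eq_N2 IE.
split; last by rewrite IE.
move=> z Oz; apply: (@differentiable_comp _ _ _ _ (fun z => u *: z) f) => //.
by apply: hf; apply: balanced => //; rewrite u1.
Qed.

Lemma minimal_rotate u z f : normc u = 1 -> minimal Omega z f ->
  minimal Omega (u *: z) (fun w => f ((conjc u) *: w)).
Proof.
move=> u1 [Af fz fm]; have u1' : normc (conjc u) = 1 by rewrite nconj.
have [Af' Nf'] := A2_rotate u1' Af; split=> //.
  by rewrite scalerA mulVu// scale1r.
move=> g Ag gz; have [Ag' Ng'] := A2_rotate u1 Ag.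
by rewrite Nf' -Ng'; exact: fm.
Qed.

Lemma K2_rotate u zeta z : normc u = 1 -> Omega zeta -> Omega z ->
  K2 zeta (u *: z) = K2 ((conjc u) *: zeta) z.
Proof.
move=> u1 Ozeta Oz; have Ouz : Omega (u *: z) by apply: balanced; rewrite ?u1.
have mr := minimal_rotate u1 (m2P Oz).
have e1 : m_min 2 Omega zeta (u *: z) = m_min 2 Omega ((conjc u) *: zeta) z.
  exact: (minimal_unique oO (m2P Ouz) mr Ozeta).
have e2 : N2 (m2 (u *: z)) = N2 (m2 z).
  have u1' : normc (conjc u) = 1 by rewrite nconj.
  have [Az _ _] := m2P Oz; have [_ <-] := A2_rotate u1' Az.
  have [Au uz1 h1] := m2P Ouz; have [Ar rz h2] := mr.
  by apply/eqP; rewrite eq_le (h1 _ Ar rz) (h2 _ Au uz1).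
by rewrite (K2E zeta Ouz) (K2E ((conjc u) *: zeta) Oz) e1 e2.
Qed.

Lemma differentiable_conj (h : C -> C) (a : C) : differentiable h (conjc a) ->
  differentiable (fun l => conjc (h (conjc l))) a.
Proof.
move=> /differentiable_cderiv[k hk]; apply/differentiable_cderiv; exists (conjc k) => e e0.
have [d d0 dP] := hk e e0; exists d => // x xd.
have := dP (conjc x); rewrite nconj => /(_ xd).
rewrite -[in X in X -> _]nconj !rmorphB rmorphM/= conjcK -rmorphD/=.
exact.
Qed.

Lemma open_dilate z : Omega z -> exists2 rho : R, 1 < rho &
  forall l : C, normc l < rho -> Omega (l *: z).
Proof.
move=> Oz; have [r r0 rP] := open_polydisc oO Oz.
have n1 : 0 < nr z + 1 by rewrite ltr_wpDl ?nr_ge0.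
pose rho := 1 + r / 2 / (nr z + 1).
have rho1 : 1 < rho by rewrite ltrDl divr_gt0// divr_gt0.
exists rho => // l lr.
have O1 : Omega (rho%:C *: z).
  apply: rP; rewrite /polydisc/= /rho rmorphD rmorph1 scalerDl scale1r addrC addKr nrZ.
  rewrite normc_real ger0_norm; last by rewrite divr_ge0 ?divr_ge0// ltW.
  rewrite mulrAC ltr_pdivrMr//; have := nr_ge0 z; nra.
have rC : rho%:C != 0 :> C by rewrite -normc_eq0 normc_real gtr0_norm ?gt_eqF//; lra.
have -> : l *: z = (l / rho%:C) *: (rho%:C *: z) by rewrite scalerA divfK.
apply: balanced => //; rewrite normcM normcV normc_real gtr0_norm; last lra.
by rewrite ler_pdivrMr ?mul1r ?ltW//; lra.
Qed.

(* Both sides extend holomorphically to complex [t] and agree for [|t| = 1] by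
   invariance under rotations. *)
Lemma K2_dilate (t : R) zeta z : 0 <= t <= 1 -> Omega zeta -> Omega z ->
  K2 (t%:C *: zeta) z = K2 zeta (t%:C *: z).
Proof.
move=> /andP[t0 t1] Ozeta Oz.
have [r1 r11 r1P] := open_dilate Ozeta; have [r2 r21 r2P] := open_dilate Oz.
pose rho := Num.min r1 r2.
have rho1 : 1 < rho by rewrite lt_min r11.
pose g1 (l : C) := K2 (l *: zeta) z.
pose h (l : C) := K2 (l *: z) zeta.
(* Since [K2] is antiholomorphic in its second variable, it is evaluated at [(conjc l) *: z];
   Hermitian symmetry brings it to this form. *)
pose g2 (l : C) := conjc (h (conjc l)).
have d1 l : normc l < rho -> differentiable g1 l.
  rewrite lt_min => /andP[lr _].
  have : differentiable (fun l : C => (fun w => K2 w z) (0 + l *: zeta)) l.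
    by apply: (@differentiable_slice R n (fun w => K2 w z)); rewrite add0r; apply: K2_holomorphic => //; exact: r1P.
  by under eq_fun do rewrite add0r.
have d2 l : normc l < rho -> differentiable g2 l.
  rewrite lt_min => /andP[_ lr]; apply: differentiable_conj.
  have : differentiable (fun l : C => (fun w => K2 w zeta) (0 + l *: z)) (conjc l).
    apply: (@differentiable_slice R n (fun w => K2 w zeta)); rewrite add0r; apply: K2_holomorphic => //.
    by apply: r2P; rewrite nconj.
  by under eq_fun do rewrite add0r.
have g2E l : Omega ((conjc l) *: z) -> g2 l = K2 zeta ((conjc l) *: z).
  by move=> Ol; rewrite /g2 /h -K2_hermitian.
have circ l : normc l = 1 -> normc (g1 l - g2 l) <= 0.
  move=> l1; rewrite g2E; last by apply: balanced; rewrite ?nconj ?l1.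
  have nl : normc (conjc l) = 1 by rewrite nconj.
  by have := K2_rotate nl Ozeta Oz; rewrite conjcK => ->; rewrite subrr normc0.
have d12 l : normc l < rho -> differentiable (fun l => g1 l - g2 l) l.
  by move=> lr; exact: (differentiable_sub (d1 l lr) (d2 l lr)).
have nt : normc (t%:C : C) <= 1 by rewrite normc_real ger0_norm.
have := max_principle d12 ltr01 rho1 circ nt => h0.
have : g1 t%:C - g2 t%:C = 0.
  by apply/eqP; rewrite -normc_eq0 eq_le h0 normc_ge0.
have tc : conjc t%:C = t%:C :> C by rewrite conjc_real.
move/eqP; rewrite subr_eq0 => /eqP; rewrite g2E tc //; exact: balanced.
Qed.

(** Dilation by [0] gives [K2 0 z = K2 0 0], the inverse of a positive squared norm. *)
Lemma K2_0_neq0 z : Omega z -> K2 0 z != 0.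
Proof.
move=> Oz; have O0 := balanced0 Oz.
have := @K2_dilate 0 0 z; rewrite lexx ler01 scaler0 => -> //.
have [_ m1 _] := m2P O0; rewrite scale0r (K2E 0 O0) m1.
by rewrite mulr1 -normc_eq0 normc_real normr_eq0 invr_eq0 gt_eqF// N2_gt0.
Qed.

End kernel.

(** * Square roots of zero-free functions *)

Section sqrt.
Variables (R : realType) (n : nat).
Local Notation C := R[i].
Local Notation Cn := 'rV[R[i]]_n.
Implicit Types (x y : C) (w z : Cn).

Lemma Re_sqrtc_gt0 x : 0 < Re x -> 0 < Re (sqrtc x).
Proof.
case: x => a b /= a0; by rewrite sqrtr_gt0 divr_gt0// ltr_wpDl// sqrtr_ge0.
Qed.

Lemma sqr_ratio x y a : x ^+ 2 = a -> y ^+ 2 = a -> a != 0 -> (x / y) ^+ 2 = 1.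
Proof. by move=> xa ya a0; rewrite expr_div_n xa ya divff. Qed.

(** With [S] and [S'] the roots at [x] and [x + h], [S' - S = h / (S' + S)], and positive real parts
    keep the modulus of [S' + S] above [Re S]. *)
Lemma differentiable_sqrtc x : 0 < Re x -> differentiable (@sqrtc R) x.
Proof.
move=> x0; pose S := sqrtc x; have m0 : 0 < Re S := Re_sqrtc_gt0 x0.
have Re_nz y : 0 < Re y -> y != 0.
  by move=> y0; apply: contraTneq y0 => ->; rewrite ltxx.
have S0 := Re_nz _ m0.
apply/differentiable_cderiv; exists (2 * S)^-1 => e e0.
have mS : Re S <= normc S := le_Re_normc S.
have c0 : 0 < e * (Re S ^+ 2 * 2 * Re S) by rewrite !mulr_gt0// exprn_gt0.
exists (Num.min (Re x) (e * (Re S ^+ 2 * 2 * Re S))); first by rewrite lt_min x0.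
move=> h; rewrite lt_min => /andP[hx he].
have xh0 : 0 < Re (x + h).
  have := le_absRe_normc h; have := ler_norm (- Re h); rewrite normrN raddfD/=; lra.
pose S' := sqrtc (x + h); have m0' : 0 < Re S' := Re_sqrtc_gt0 xh0.
have SS : Re S <= normc (S' + S).
  by apply: le_trans (le_Re_normc _); rewrite raddfD/=; lra.
have SS0 : S' + S != 0 by apply: Re_nz; rewrite raddfD/=; lra.
have hE : h = (S' - S) * (S' + S).
  have := sqr_sqrtc (x + h); have := sqr_sqrtc x; rewrite -/S -/S' => s1 s2.
  have -> : (S' - S) * (S' + S) = S' ^+ 2 - S ^+ 2 by ring.
  by rewrite s1 s2; ring.
have dE : S' - S = h / (S' + S) by rewrite hE mulfK.
have two0 : (2 : C) != 0 by rewrite pnatr_eq0.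
have -> : sqrtc (x + h) - sqrtc x - (2 * S)^-1 * h = h * (- h / ((S' + S) * (S' + S) * (2 * S))).
  rewrite -/S -/S' dE.
  have -> : - h / ((S' + S) * (S' + S) * (2 * S)) = - (S' - S) / ((S' + S) * (2 * S)).
    by rewrite dE; field; rewrite S0 SS0.
  have -> : - (S' - S) / ((S' + S) * (2 * S)) = (S' + S)^-1 - (2 * S)^-1.
    by field; rewrite S0 SS0.
  by ring.
rewrite normcM mulrC ler_wpM2r ?normc_ge0//.
have n2 : normc (2 : C) = 2 by rewrite -[2 : C](rmorph_nat (real_complex R) 2) normc_real normr_nat.
rewrite normcM normcV !normcM normcNr n2 ler_pdivrMr ?mulr_gt0 ?normc_gt0//.
apply: le_trans (ltW he) _; rewrite ler_pM2l// -mulrA expr2.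
apply: ler_pM; [by rewrite mulr_ge0 ?ltW|by rewrite mulr_ge0 ?ltW| |by rewrite ler_pM2l].
by apply: ler_pM => //; exact: ltW.
Qed.

Variable Omega : set Cn.
Hypotheses (oO : open Omega) (bal : forall (c : C) z, Omega z -> normc c <= 1 -> Omega (c *: z)).

Section root.
Variable f : Cn -> C.
Hypotheses (hf : holomorphic_on Omega f) (f0 : forall z, Omega z -> f z != 0).

Let sc (s : R) : 0 <= s <= 1 -> normc (s%:C : C) <= 1.
Proof. by move=> /andP[s0 s1]; rewrite normc_real ger0_norm. Qed.

(* For [good N w] consecutive values of [f] at the points [(j / N.+1) w] have their
   ratio in the right half-plane, where the principal square root is holomorphic;
   [hN N w] multiplies the roots of these ratios. *)
Let good N w := forall s s' : R, 0 <= s <= 1 -> 0 <= s' <= 1 -> `|s - s'| <= N.+1%:R^-1 ->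
  normc (f (s%:C *: w) - f (s'%:C *: w)) < normc (f (s'%:C *: w)).

Let good_scale N w t : 0 <= t <= 1 -> good N w -> good N (t%:C *: w).
Proof.
move=> /andP[t0 t1] gN s s' /andP[s0 s1] /andP[s0' s1'] ss.
rewrite !scalerA -!rmorphM; apply: gN.
- by rewrite mulr_ge0//= mulr_ile1.
- by rewrite mulr_ge0//= mulr_ile1.
- by rewrite -mulrBl normrM (ger0_norm t0); apply: le_trans ss; rewrite ler_piMr.
Qed.

(** Compactness of [[0, 1]] with the product filter on [(N, w)] yields the subdivision and the
    neighbourhood of [w0] together. *)
Let good_near w0 : Omega w0 -> exists N, exists2 d : R, 0 < d &
  forall w, nr (w - w0) < d -> good N w.
Proof.
move=> Ow0.
pose P (i : nat * Cn) (s : R) := 0 <= s <= 1 -> forall s' : R, 0 <= s' <= 1 ->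
  `|s - s'| <= i.1.+1%:R^-1 ->
  normc (f (s%:C *: i.2) - f (s'%:C *: i.2)) < normc (f (s'%:C *: i.2)).
have cK : compact (`[0%R, 1%R]%classic : set R) by exact: segment_compact.
have cov := (compact_near_coveringP _).1 cK (nat * Cn)%type (filter_prod \oo (nbhs w0)) P _.
have {cov}[|[A B] /= [[N _ NA] /nbhs_nrP[d d0 dB]] AB] := cov.
  move=> s0; rewrite /= in_itv/= => s01.
  have Os0 : Omega (s0%:C *: w0) by apply: bal => //; exact: sc.
  (* Two values within a third of [F0] differ by less than two thirds of its modulus, and each has
     modulus above two thirds. *)
  pose et := normc (f (s0%:C *: w0)) / 3.
  have et0 : 0 < et by rewrite divr_gt0// normc_gt0 f0.
  have /continuous_nrP/(_ _ et0)[d d0 dP] : {for s0%:C *: w0, continuous f}.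
    by apply: differentiable_continuous; exact: hf.
  have w1 : 0 < nr w0 + 1 by rewrite ltr_wpDl// nr_ge0.
  pose e1 := d / (4 * (nr w0 + 1)).
  have e10 : 0 < e1 by rewrite divr_gt0// mulr_gt0.
  have e1w : e1 * nr w0 <= d / 4.
    have -> : d / 4 = e1 * (nr w0 + 1) by rewrite /e1; field; rewrite gt_eqF.
    by rewrite ler_pM2l// lerDl.
  have [N _ NP] := near_infty_natSinv_lt (PosNum e10).
  exists ([set s | `|s - s0| < e1], [set i | (N <= i.1)%N /\ nr (i.2 - w0) < d / 2]).
    split=> /=.
      apply/nbhs_ballP; exists e1 => // t; rewrite /ball/= distrC; exact.
    exists ([set j | (N <= j)%N], [set w | nr (w - w0) < d / 2]) => //=.
    split; first by exists N.
    by apply/nbhs_nrP; exists (d / 2) => //; exact: divr2_gt0.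
  move=> [s [M w]] /= [ss0 [NM ww]] s01' s' s01'' ss'.
  have M1 : `|s - s'| < e1 by apply: le_lt_trans ss' (NP M NM).
  have close (t : R) : 0 <= t <= 1 -> `|t - s0| < 2 * e1 ->
      normc (f (t%:C *: w) - f (s0%:C *: w0)) < et.
    move=> t01 ts0.
    have := dP (t%:C *: w - s0%:C *: w0); rewrite subrKC nr_C; apply.
    have -> : t%:C *: w - s0%:C *: w0 = t%:C *: (w - w0) + (t - s0)%:C *: w0.
      by rewrite scalerBr rmorphB/= scalerBl addrA subrK.
    apply: le_lt_trans (nrD _ _) _; rewrite !nrZ [normc (t - s0)%:C]normc_real.
    have h1 : normc t%:C * nr (w - w0) <= nr (w - w0) by rewrite ler_piMl ?nr_ge0// sc.
    have h2 : `|t - s0| * nr w0 <= 2 * (e1 * nr w0).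
      by rewrite mulrA ler_wpM2r ?nr_ge0// ltW.
    lra.
  have c1 := close s s01'; have c2 := close s' s01''.
  have {}c1 : normc (f (s%:C *: w) - f (s0%:C *: w0)) < et by apply: c1; lra.
  have {}c2 : normc (f (s'%:C *: w) - f (s0%:C *: w0)) < et.
    apply: c2; have := ler_normD (s' - s) (s - s0); rewrite addrA subrK [`|s' - s|]distrC; lra.
  set F1 := f (s%:C *: w) in c1 *; set F2 := f (s'%:C *: w) in c2 *.
  clear close; move: c1 c2; rewrite /et; set F0 := f (s0%:C *: w0) => c1 c2.
  have h1 := normcB (F1 - F0) (F2 - F0).
  have -> : F1 - F2 = (F1 - F0) - (F2 - F0) by ring.
  have h2 := normcB F2 (F2 - F0); rewrite subKr in h2.
  clear -c1 c2 h1 h2; lra.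
exists N; exists d => // w wd s s' s01 s01'.
apply: (AB (N, w) _ s _ s01 s' s01'); last by rewrite /= in_itv/= s01.
by split; [exact: (NA N (leqnn N))|exact: dB].
Qed.

Let ratio N w j := f ((j.+1%:R / N.+1%:R)%:C *: w) / f ((j%:R / N.+1%:R)%:C *: w).

Let frac N j : (j <= N.+1)%N -> 0 <= (j%:R / N.+1%:R : R) <= 1.
Proof. by move=> jN; rewrite divr_ge0//= ler_pdivrMr// mul1r ler_nat. Qed.

Let hN N w := sqrtc (f 0) * \prod_(0 <= j < N.+1) sqrtc (ratio N w j).

(** The product of the ratios telescopes from [f 0] to [f w]. *)
Let hN_sqr N w : Omega w -> hN N w ^+ 2 = f w.
Proof.
move=> Ow; rewrite exprMn sqr_sqrtc.
suff h m : (m <= N.+1)%N ->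
    f 0 * (\prod_(0 <= j < m) sqrtc (ratio N w j)) ^+ 2 = f ((m%:R / N.+1%:R)%:C *: w).
  by rewrite h// divff ?pnatr_eq0// scale1r.
elim: m => [_|m ih mN]; first by rewrite big_geq// mul0r scale0r expr1n mulr1.
rewrite big_nat_recr// exprMn sqr_sqrtc mulrA (ih (ltnW mN)).
rewrite /ratio mulrC divfK//.
by apply: f0; apply: bal => //; apply: sc; apply: frac; exact: ltnW.
Qed.

Let ratio_gt0 N w j : Omega w -> good N w -> (j < N.+1)%N -> 0 < Re (ratio N w j).
Proof.
move=> Ow gN jN; have fj : f ((j%:R / N.+1%:R)%:C *: w) != 0.
  by apply: f0; apply: bal => //; apply: sc; apply: frac; exact: ltnW.
have : normc (ratio N w j - 1) < 1.
  rewrite /ratio -[X in _ - X](divff fj) -mulrBl.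
  rewrite normcM normcV ltr_pdivrMr ?normc_gt0// mul1r; apply: gN.
  - exact: frac.
  - by apply: frac; exact: ltnW.
  - by rewrite -mulrBl -natrB// subSnn mul1r ger0_norm// invr_ge0.
by move=> h; have := le_absRe_normc (ratio N w j - 1); have := ler_norm (- Re (ratio N w j - 1));
  rewrite normrN raddfB/=; lra.
Qed.

Let hN_diff N w : Omega w -> good N w -> differentiable (hN N) w.
Proof.
move=> Ow gN.
have dscale (c : C) : differentiable (fun w : Cn => c *: w) w by apply: differentiableZ.
have df (s : R) : 0 <= s <= 1 -> differentiable (fun w : Cn => f (s%:C *: w)) w.
  move=> s01; apply: (@differentiable_comp _ _ _ _ (fun w : Cn => s%:C *: w) f) => //.
  by apply: hf; apply: bal => //; exact: sc.
have dr j : (j < N.+1)%N -> differentiable (fun w => sqrtc (ratio N w j)) w.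
  move=> jN; apply: (@differentiable_comp _ _ _ _ (fun w => ratio N w j) (@sqrtc R)).
    apply: (differentiable_mul (df _ (frac jN))).
    apply: (differentiable_inv (df _ (frac (ltnW jN)))).
    by apply: f0; apply: bal => //; apply: sc; apply: frac; exact: ltnW.
  by apply: differentiable_sqrtc; exact: ratio_gt0.
have dp m : (m <= N.+1)%N -> differentiable (fun w => \prod_(0 <= j < m) sqrtc (ratio N w j)) w.
  elim: m => [_|m ih mN]; first by under eq_fun do rewrite big_geq//; exact: differentiable_cst.
  under eq_fun do rewrite big_nat_recr//.
  exact: (differentiable_mul (ih (ltnW mN)) (dr m mN)).
exact: (differentiable_mul (differentiable_cst _ w) (dp _ (leqnn _))).
Qed.

Let hN0 N : Omega 0 -> hN N 0 = sqrtc (f 0).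
Proof.
move=> O0; rewrite /hN big1 ?mulr1// => j _.
by rewrite /ratio !scaler0 divff ?sqrtc1// f0.
Qed.

(** On the segment from [0] to [w] the quotient of the two roots is continuous, equals [1] or [-1],
    and is [1] at [0]; the intermediate value theorem excludes a jump of its real part. *)
Let hN_consistent N N' w : Omega w -> good N w -> good N' w -> hN N w = hN N' w.
Proof.
move=> Ow gN gN'.
have Os (s : R) : 0 <= s <= 1 -> Omega (s%:C *: w) by move=> s01; apply: bal => //; exact: sc.
pose q (s : R) := hN N (s%:C *: w) / hN N' (s%:C *: w).
have O0 : Omega 0 by rewrite -(scale0r w); apply: bal; rewrite ?normc0.
have hn0 M s : 0 <= s <= 1 -> hN M (s%:C *: w) != 0.
  move=> s01; have : hN M (s%:C *: w) ^+ 2 != 0 by rewrite hN_sqr; [exact: f0 (Os s s01)|exact: Os].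
  by rewrite expf_eq0.
have q2 s : 0 <= s <= 1 -> q s = 1 \/ q s = -1.
  move=> s01; have : q s ^+ 2 = 1.
    exact: sqr_ratio (hN_sqr N (Os s s01)) (hN_sqr N' (Os s s01)) (f0 (Os s s01)).
  by move/eqP; rewrite sqrf_eq1 => /orP[/eqP|/eqP]; [left|right].
have q0 : q 0 = 1.
  by rewrite /q !scale0r !hN0// divff// -(hN0 N)// -(scale0r w); apply: hn0; rewrite lexx ler01.
have cq : {within `[0%R, 1%R : R], continuous (fun s => Re (q s))}.
  apply: continuous_in_subspaceT => s; rewrite inE/= in_itv/= => s01.
  have dh : differentiable (fun w => hN N w / hN N' w) (s%:C *: w).
    apply: (differentiable_mul (hN_diff (Os s s01) (good_scale s01 gN))).
    by apply: (differentiable_inv (hN_diff (Os s s01) (good_scale s01 gN'))); exact: hn0.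
  have /continuous_nrP ch := differentiable_continuous dh.
  apply/cvgrPdist_lt => e e0; have [d d0 dP] := ch e e0.
  apply/nbhs_ballP; exists (d / (nr w + 1)) => /=; first by rewrite divr_gt0// ltr_wpDl ?nr_ge0.
  move=> t; rewrite /ball/= distrC ltr_pdivlMr ?ltr_wpDl ?nr_ge0// => ts.
  have := dP ((t - s)%:C *: w); rewrite -scalerDl -rmorphD subrKC nr_C nrZ normc_real => h.
  rewrite -raddfB; apply: le_lt_trans (le_absRe_normc _) _; rewrite distcC; apply: h.
  by have := nr_ge0 w; have := normr_ge0 (t - s); nra.
have i01 : (0 : R) <= 1 := ler01.
have r1 : 0 <= (1 : R) <= 1 by rewrite ler01 lexx.
have [q1|qN1] := q2 1 r1.
  move: q1; rewrite /q scale1r => q1.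
  by have := hn0 N' 1 r1; rewrite scale1r => h; rewrite -[hN N w](divfK h) q1 mul1r.
have [|c cI c0] := @IVT R (fun s => Re (q s)) 0 1 0 i01 cq.
  by rewrite q0 qN1/= ge_min le_max/= oppr_le0 ler01 orbT.
by exfalso; move: c0; move: cI; rewrite in_itv/= => /q2[] -> /= /eqP; rewrite ?oppr_eq0 oner_eq0.
Qed.

(** The subdivision is chosen point by point, but by consistency the root agrees near each point
    with a single [hN M]. *)
Lemma holomorphic_sqrt : exists2 h, holomorphic_on Omega h & forall z, Omega z -> h z ^+ 2 = f z.
Proof.
have ex w : exists N, Omega w -> good N w.
  have [Ow|nO] := pselect (Omega w); last by exists 0%N.
  have [N [d d0 dP]] := good_near Ow; exists N => _.
  by apply: dP; rewrite subrr nr0.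
have [N NP] := choice ex.
exists (fun w => hN (N w) w); last by move=> z Oz; exact: hN_sqr.
move=> w Ow; have [M [d d0 dP]] := good_near Ow.
have [d' d'0 d'P] := (open_nrP Omega).1 oO w Ow.
apply: (@differentiable_eq_near R Cn C (hN M)); last first.
  by apply: hN_diff => //; apply: dP; rewrite subrr nr0.
exists (Num.min d d'); first by rewrite lt_min d0.
move=> h; rewrite lt_min => /andP[hd hd'].
have Owh : Omega (w + h) by apply: d'P; rewrite addrC addKr.
by apply: hN_consistent => //; [apply: dP; rewrite addrC addKr|exact: NP].
Qed.

End root.
End sqrt.

(** * Roots of the Bergman kernel *)

Section roots.
Variables (R : realType) (n : nat) (Omega : set 'rV[R[i]]_n).
Local Notation C := R[i].
Local Notation Cn := 'rV[R[i]]_n.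
Hypotheses (oO : open Omega) (bO : bounded_set Omega) (rO : complete_Reinhardt Omega).
Implicit Types (f g h : Cn -> C) (z w zeta : Cn) (j k : nat).
Local Notation N2 := (N2 Omega).
Local Notation K2 := (K_off 2 Omega).
Local Notation m2 z := (fun zeta => m_min 2 Omega zeta z).

Lemma holomorphic_root j f : holomorphic_on Omega f -> (forall z, Omega z -> f z != 0) ->
  exists2 h, holomorphic_on Omega h & forall z, Omega z -> h z ^+ (2 ^ j) = f z.
Proof.
elim: j f => [|j ih] f hf f0; first by exists f.
have [g hg gf] := holomorphic_sqrt oO (balanced rO) hf f0.
have [|h hh hE] := ih g hg.
  by move=> z Oz; have := f0 z Oz; rewrite -(gf z Oz) expf_eq0.
by exists h => // z Oz; rewrite expnSr exprM hE// gf.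
Qed.

(* If [h] is a root of order [2 ^ j] of the minimizer for [p = 2], then [h] is the
   minimizer for [p = 2 * 2 ^ j], as [g |-> g ^+ (2 ^ j)] maps its competitors to
   competitors for [p = 2]. *)
Lemma normc_K2_root j z zeta : Omega z -> Omega zeta ->
  (forall w, Omega w -> K2 w z != 0) ->
  normc (K2 zeta z) =
    N2 (m2 z) ^+ (2 ^ j).-1 * normc (K_off (2 * 2 ^ j)%:R Omega zeta z) ^+ (2 ^ j).
Proof.
move=> Oz Ozeta K0; set k := (2 ^ j)%N; have k0 : (0 < k)%N by rewrite expn_gt0.
have m0 w : Omega w -> m2 z w != 0.
  by move=> Ow; have := K0 w Ow; rewrite (K2E oO bO _ Oz) mulf_eq0 negb_or => /andP[].
have A0 : 0 < N2 (m2 z) := N2_gt0 oO bO Oz.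
have := m2P oO bO Oz; move: m0 A0 => /=; set f := fun w => m_min 2 Omega w z => m0 A0 fm.
have [[hf Af] fz fmin] := fm.
have [h0 hh0 h0E] := holomorphic_root j hf m0.
(* [h0 z] is only a root of unity; the division normalizes the value at [z] to [1]. *)
pose h w := (h0 z)^-1 * h0 w.
have hz1 : h0 z ^+ k = 1 by rewrite (h0E z Oz).
have hE w : Omega w -> h w ^+ k = f w.
  by move=> Ow; rewrite /h exprMn exprVn hz1 invr1 mul1r; exact: h0E.
have hh : holomorphic_on Omega h.
  by move=> w Ow; exact: (differentiable_mul (differentiable_cst _ w) (hh0 w Ow)).
have IE : I2 Omega (fun w => h w ^+ k) = I2 Omega f by exact: eq_I2.
have NE : N2 (fun w => h w ^+ k) = N2 f by exact: eq_N2 IE.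
have h00 : h0 z != 0.
  by apply/eqP => h00; move: hz1; rewrite h00 expr0n gtn_eqF// => /eqP; rewrite eq_sym oner_eq0.
have mh : minimal_pow Omega k z h.
  split.
  - apply: (Ap_pow Omega h k0).2; split; first exact: hh.
    split; last by rewrite IE; exact: Af.
    by move=> w Ow; apply: differentiable_pow; exact: hh.
  - by rewrite /h mulVf.
  - move=> g /(Ap_pow Omega g k0)[_ Ag] gz; rewrite NE; apply: (fmin _ Ag).
    by rewrite gz expr1n.
have A0' : 0 < N2 (fun w => h w ^+ k) by rewrite NE.
have KE := K_diagE oO k0 mh A0'.
have [Ag gz gm] := m_minP k0 mh.
(* Uniqueness is used for [p = 2] only: it identifies the [k]-th power of the chosen minimizer with
   [f], which is enough to compare moduli. *)
have gE : minimal Omega z (fun w => m_min (2 * k)%:R Omega w z ^+ k).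
  have [_ Ag2] := (Ap_pow Omega _ k0).1 Ag; split.
  - exact: Ag2.
  - by rewrite gz expr1n.
  - move=> g' Ag' gz'; apply: le_trans (fmin g' Ag' gz'); rewrite -NE.
    by have [Ah hz _] := mh; exact: gm.
transitivity ((N2 f)^-1 * normc (f zeta)).
  by rewrite (K2E oO bO _ Oz) normcM normc_real ger0_norm// invr_ge0 ltW.
rewrite /K_off KE NE normcM normc_real ger0_norm; last by rewrite invr_ge0 ltW.
rewrite exprMn -normcX (minimal_unique oO gE fm Ozeta) mulrA; congr (_ * _).
by rewrite -[in X in _ * X](prednK k0) exprS mulrCA -exprMn divff ?gt_eqF// expr1n mulr1.
Qed.

Lemma N2_le_volume z : Omega z -> N2 (m2 z) <= N2 (fun=> 1).
Proof. by move=> Oz; have [_ _ h] := m2P oO bO Oz; apply: h => //; exact: A2_const. Qed.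

End roots.

(** * Compactness of the closure and the least dilation with a zero *)

Section closure.
Variables (R : realType) (n : nat) (Omega : set 'rV[R[i]]_n).
Local Notation C := R[i].
Local Notation Cn := 'rV[R[i]]_n.

Let square (M : R) : set C :=
  (fun p : R * R => p.1 +i* p.2) @` (`[- M, M]%classic `*` `[- M, M]%classic).

Let square_compact M : compact (square M).
Proof.
apply: continuous_compact; last by apply: compact_setX; exact: segment_compact.
apply: continuous_subspaceT => -[a b] P /nbhs_nrP[d d0 dP].
have d2 := divr2_gt0 d0.
exists ([set x | `|x - a| < d / 2], [set x | `|x - b| < d / 2]) => /=.
  by split; apply/nbhs_ballP; exists (d / 2) => // x; rewrite /ball/= distrC.
move=> -[x y] /= [xa yb]; apply: dP; rewrite nr_C.
by apply: le_lt_trans (normc_le_ReIm _) _ => /=; lra.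
Qed.

Lemma compact_closure : bounded_set Omega -> compact (closure Omega).
Proof.
move=> /bounded_polydisc[M M0 OM].
have sub : closure Omega `<=` [set v : Cn | forall j, square (M + 1) (v ord0 j)].
  move=> z /(_ [set w | nr (w - z) < 1]) [|w [/OM wM /= wz] j].
    by apply/nbhs_nrP; exists 1.
  have zM : normc (z 0 j) <= M + 1.
    apply: le_trans (normc_coord_le _ _) _.
    have := nrD (z - w) w; rewrite subrK -[in X in _ <= X]nrN opprB.
    by move: wM wz; rewrite /polydisc/= subr0; lra.
  exists (Re (z 0 j), Im (z 0 j)); last by case: (z 0 j).
  have := le_absRe_normc (z 0 j); have := le_absIm_normc (z 0 j).
  by rewrite /= !in_itv/= -!ler_norml => h1 h2; split; apply: le_trans zM.
apply: (subclosed_compact _ _ sub); first exact: closed_closure.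
exact: (rV_compact (fun=> @square_compact (M + 1))).
Qed.

Lemma closure_scale (c : C) z : complete_Reinhardt Omega -> closure Omega z -> normc c < 1 ->
  Omega (c *: z).
Proof.
(* A point of [Omega] within [e] of [z] dominates [c *: z] in every coordinate. Zero coordinates
   impose nothing, and the default [1] covers [z = 0]. *)
move=> rO Oz c1; pose e := \big[Num.min/1]_(j | z 0 j != 0) ((1 - normc c) * normc (z 0 j)).
have e0 : 0 < e.
  apply: lt_bigmin; first exact: ltr01.
  move=> j zj.
  by rewrite mulr_gt0 ?subr_gt0 ?normc_gt0.
have [|w [Ow /= wz]] := Oz [set w | nr (w - z) < e]; first by apply/nbhs_nrP; exists e.
apply: rO Ow _ => j; rewrite mxE normcM.
have [->|zj] := eqVneq (z 0 j) 0; first by rewrite normc0 mulr0 normc_ge0.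
have ej : e <= (1 - normc c) * normc (z 0 j) by exact: bigmin_le_cond.
have wzj := normc_coord_le (w - z) j; rewrite !mxE in wzj.
have := normcD (z 0 j - w 0 j) (w 0 j); rewrite subrK distcC.
lra.
Qed.

End closure.

Section first_zero.
Variables (R : realType) (n : nat) (Omega : set 'rV[R[i]]_n).
Local Notation C := R[i].
Local Notation Cn := 'rV[R[i]]_n.
Hypotheses (oO : open Omega) (bO : bounded_set Omega) (rO : complete_Reinhardt Omega).

Lemma first_zero (F : Cn -> C) : (forall z, Omega z -> {for z, continuous F}) ->
  F 0 != 0 -> (exists2 z, Omega z & F z = 0) ->
  exists (t : R) (z : Cn), [/\ 0 < t < 1, closure Omega z, ~ Omega z, F (t%:C *: z) = 0 &
    forall s w, 0 <= s <= t -> Omega w -> F (s%:C *: w) != 0].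
Proof.
move=> cF F0 [z1 Oz1 Fz1].
pose S := [set t : R | 0 <= t < 1 /\ exists2 z, closure Omega z & F (t%:C *: z) = 0].
(* For [w] inside [Omega], [l *: w] is still inside for some [l > 1], and the same zero is reached
   with the smaller factor [s / l]. Hence the minimal factor is reached only from boundary
   points. *)
have descend (s : R) w : 0 <= s <= 1 -> Omega w -> F (s%:C *: w) = 0 -> exists2 t, S t & t < s.
  move=> /andP[s0 s1] Ow Fsw.
  have {}s0 : 0 < s.
    rewrite lt_neqAle s0 andbT; apply/eqP => s00.
    by move: Fsw F0; rewrite -s00 scale0r => ->; rewrite eqxx.
  have [rho rho1 rP] := open_dilate oO rO Ow.
  pose l := (1 + rho) / 2.
  have l1 : 1 < l by rewrite /l; lra.
  have lr : l < rho by rewrite /l; lra.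
  have l0 : 0 < l by exact: lt_trans l1.
  have lC : l%:C != 0 :> C by rewrite -normc_eq0 normc_real normr_eq0 gt_eqF.
  have sl : s / l < s by rewrite ltr_pdivrMr// ltr_pMr.
  exists (s / l) => //; split; first by rewrite divr_ge0 ?ltW//= (lt_le_trans sl).
  exists (l%:C *: w); first by apply: subset_closure; apply: rP; rewrite normc_real gtr0_norm.
  by rewrite scalerA -rmorphM/= divfK ?gt_eqF.
have r01 : 0 <= (1 : R) <= 1 by rewrite ler01 lexx.
have [t1 St1 t11] : exists2 t, S t & t < 1 by apply: descend r01 Oz1 _; rewrite scale1r.
have hS : has_inf S by split; [exists t1|exists 0 => t [/andP[]]].
pose t0 := inf S.
have t0S s : S s -> t0 <= s by move=> Ss; apply: ge_inf => //; case: hS.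
have t00 : 0 <= t0 by apply: lb_le_inf; [exists t1|move=> s [/andP[]]].
have t01 : t0 < 1 by apply: le_lt_trans (t0S _ St1) t11.
have zf s w : 0 <= s <= t0 -> Omega w -> F (s%:C *: w) != 0.
  move=> /andP[s0 st] Ow; apply/eqP => Fs.
  have [|t St ts] := descend s w _ Ow Fs; first by rewrite s0 (le_trans st)// ltW.
  by have := t0S t St; rewrite leNgt (lt_le_trans ts st).
have [z [Oz Fz]] : exists z, closure Omega z /\ F (t0%:C *: z) = 0.
  (* The infimum is attained: without a zero at [t0], compactness of the closure excludes zeros for
     all [t] near [t0]. *)
  apply: contrapT => nz.
  have cov := (compact_near_coveringP _).1 (compact_closure bO) R (nbhs t0)
    (fun t z => 0 <= t < 1 -> F (t%:C *: z) != 0) _.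
  have /nbhs_ballP[d /= d0 dP] : nbhs t0 (fun t => closure Omega `<=`
      (fun z => 0 <= t < 1 -> F (t%:C *: z) != 0)).
    apply: cov => z Oz.
    have Ot0z : Omega (t0%:C *: z) by apply: closure_scale; rewrite ?normc_real ?ger0_norm.
    have Ft : 0 < normc (F (t0%:C *: z)).
      by rewrite normc_gt0; apply/eqP => Fz; apply: nz; exists z.
    have /continuous_nrP/(_ _ Ft)[d d0 dP] := cF _ Ot0z.
    have z1p : 0 < nr z + 1 by rewrite ltr_wpDl ?nr_ge0.
    pose e := Num.min 1 (d / 2 / (nr z + 1)).
    have e0 : 0 < e by rewrite lt_min ltr01 !divr_gt0.
    exists ([set w | nr (w - z) < d / 2], [set t | `|t - t0| < e]) => /=.
      split; first by apply/nbhs_nrP; exists (d / 2) => //; exact: divr2_gt0.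
      by apply/nbhs_ballP; exists e => // x; rewrite /ball/= distrC.
    move=> -[w t] /= [wz]; rewrite lt_min => /andP[_ tt0] /andP[t0' t1'].
    apply/eqP => Ftw; have := dP (t%:C *: w - t0%:C *: z).
    rewrite subrKC nr_C Ftw sub0r normcNr ltxx => h.
    suff : nr (t%:C *: w - t0%:C *: z) < d by move/h.
    have -> : t%:C *: w - t0%:C *: z = t%:C *: (w - z) + (t - t0)%:C *: z.
      by rewrite scalerBr rmorphB/= scalerBl addrA subrK.
    apply: le_lt_trans (nrD _ _) _; rewrite !nrZ !normc_real (ger0_norm t0').
    have h1 : t * nr (w - z) <= nr (w - z) by rewrite ler_piMl ?nr_ge0// ltW.
    have h2 : `|t - t0| * nr z <= d / 2.
      have -> : d / 2 = d / 2 / (nr z + 1) * (nr z + 1) by rewrite divfK// gt_eqF.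
      by apply: ler_pM; [exact: normr_ge0|exact: nr_ge0|exact: ltW|rewrite lerDl].
    lra.
  have [s Ss st] := inf_adherent d0 hS.
  have [s01 [w Ow Fw]] := Ss.
  have := dP s _ w Ow s01; rewrite Fw eqxx => h; suff : false by [].
  apply: h; rewrite /ball/= distrC ger0_norm ?subr_ge0 ?t0S//; rewrite -/t0 in st; lra.
exists t0, z; have nOz : ~ Omega z.
  move=> Oz'; have := zf t0 z _ Oz'; rewrite Fz eqxx t00 lexx => /(_ isT).
  by [].
split=> //; rewrite t01 andbT lt_neqAle t00 andbT; apply/eqP => t0E.
by move: Fz F0; rewrite -t0E scale0r => ->; rewrite eqxx.
Qed.

End first_zero.

(** * Hoelder continuity along rays *)

Section ray.
Variables (R : realType) (n : nat).
Local Notation C := R[i].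
Local Notation Cn := 'rV[R[i]]_n.
Implicit Types (g h u : Cn -> C) (x y : Cn).

(** A mode of approach that needs only the points [s%:C *: x] with [s < 1], which lie in [Omega] for
    every [x] in its closure. *)
Definition ray_limit g x := forall e : R, 0 < e -> exists2 d : R, 0 < d &
  forall s : R, 0 < s < 1 -> 1 - s < d -> normc (g (s%:C *: x) - g x) < e.

Lemma scale_subr (s : R) x : s%:C *: x - x = (s - 1)%:C *: x.
Proof. by rewrite rmorphB rmorph1 scalerBl scale1r. Qed.

Lemma ray_limit_within A g x : {within A, continuous g} -> A x ->
  (forall s : R, 0 < s < 1 -> A (s%:C *: x)) -> ray_limit g x.
Proof.
move=> cg Ax As e e0.
have cx := (subspace_continuousP _ _).1 cg x Ax.
have /cx/nbhs_nrP[d d0 dP] : nbhs (g x) [set c | nr (c - g x) < e].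
  by apply/nbhs_nrP; exists e.
exists (d / (nr x + 1)) => [|s /andP[s0 s1]]; first by rewrite divr_gt0// ltr_wpDl ?nr_ge0.
rewrite ltr_pdivlMr ?ltr_wpDl ?nr_ge0// => sd; rewrite -nr_C; apply: dP; last by apply: As; rewrite s0.
rewrite scale_subr nrZ normc_real distrC ger0_norm ?subr_ge0 ?ltW//.
by apply: le_lt_trans sd; rewrite ler_pM2l ?subr_gt0// lerDl.
Qed.

Lemma ray_limit_cvg g x : ray_limit g x ->
  (fun s : R => normc (g (s%:C *: x))) @ 1^'- --> normc (g x).
Proof.
move=> gx; apply/cvgrPdist_lt => e e0; have [d d0 dP] := gx e e0.
near=> s.
have s0 : 0 < s by near: s; exact: nbhs_left_gt.
have s1 : s < 1 by near: s; exact: nbhs_left_lt.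
have sd : 1 - s < d by near: s; exact: nbhs_left_ltBl.
apply: le_lt_trans (dP s _ sd); last by rewrite s0.
set a := g x; set b := g (s%:C *: x).
have h1 := normcD (a - b) b; have h2 := normcD (b - a) a.
rewrite subrK in h1; rewrite subrK in h2; rewrite distcC in h1.
by rewrite ler_norml; apply/andP; split; lra.
Unshelve. all: by end_near. Qed.

Lemma ray_limit_eq g h x y (c : R) k : ray_limit g x -> ray_limit h y ->
  (forall s : R, 0 < s < 1 -> normc (g (s%:C *: x)) = c * normc (h (s%:C *: y)) ^+ k) ->
  normc (g x) = c * normc (h y) ^+ k.
Proof.
move=> /ray_limit_cvg gx /ray_limit_cvg hy gh.
have hx : (fun s : R => normc (g (s%:C *: x))) @ 1^'- --> c * normc (h y) ^+ k.
  have : (fun s : R => c * normc (h (s%:C *: y)) ^+ k) @ 1^'- --> c * normc (h y) ^+ k.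
    apply: cvgM; first exact: cvg_cst.
    by apply: (@cvg_comp _ _ _ _ (fun r : R => r ^+ k) _ _ _ hy); exact: exprn_continuous.
  apply: cvg_trans; apply: near_eq_cvg; near=> s.
  rewrite gh//; apply/andP; split; first by near: s; exact: nbhs_left_gt.
  by near: s; exact: nbhs_left_lt.
exact: (norm_cvg_unique gx hx).
Unshelve. all: by end_near. Qed.

Lemma enormZ (c : C) x : enorm (c *: x) = normc c * enorm x.
Proof.
rewrite /enorm; under eq_bigr do rewrite mxE normcM exprMn.
by rewrite -mulr_sumr sqrtrM ?sqr_ge0// sqrtr_sqr ger0_norm// normc_ge0.
Qed.

Lemma Holder_ray (alpha : R) A u x : Holder alpha A u -> A x ->
  (forall s : R, 0 < s < 1 -> A (s%:C *: x)) -> exists2 D : R, 0 < D &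
  forall s : R, 0 < s < 1 -> normc (u (s%:C *: x) - u x) <= D * (1 - s) `^ alpha.
Proof.
(* The Hoelder constant may be negative or zero; this one is positive, so that [Holder_ray_limit]
   can divide by it. *)
move=> [M MP] Ax As; exists (`|M| * enorm x `^ alpha + 1).
  by rewrite ltr_wpDl// mulr_ge0// powR_ge0.
move=> s s01; apply: le_trans (MP _ _ (As s s01) Ax) _.
have /andP[s0 s1] := s01.
have s1' : 0 <= 1 - s by rewrite subr_ge0 ltW.
rewrite scale_subr enormZ normc_real distrC ger0_norm// powRM ?sqrtr_ge0//.
rewrite mulrDl mul1r; have := powR_ge0 (1 - s) alpha; have := powR_ge0 (enorm x) alpha.
set p := (1 - s) `^ alpha; set q := enorm x `^ alpha => q0 p0.
have : M * (p * q) <= `|M| * (p * q) by rewrite ler_wpM2r ?ler_norm// mulr_ge0.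
by move=> h; apply: le_trans h _; rewrite [p * q]mulrC mulrA lerDl.
Qed.

Lemma Holder_ray_limit (alpha D : R) u x : 0 < alpha -> 0 < D ->
  (forall s : R, 0 < s < 1 -> normc (u (s%:C *: x) - u x) <= D * (1 - s) `^ alpha) ->
  ray_limit u x.
Proof.
move=> a0 D0 uD e e0; exists ((e / D) `^ alpha^-1); first by rewrite powR_gt0// divr_gt0.
move=> s s01 sd; apply: le_lt_trans (uD s s01) _; rewrite mulrC -ltr_pdivlMr//.
have -> : e / D = ((e / D) `^ alpha^-1) `^ alpha.
  by rewrite -powRrM mulVf ?gt_eqF// powRr1// divr_ge0 ?ltW.
by apply: gt0_ltr_powR => //; rewrite nnegrE ?powR_ge0// subr_ge0 ltW//; case/andP: s01.
Qed.

End ray.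

(** * Loss of regularity *)

Section regularity.
Variables (R : realType) (n : nat) (Omega : set 'rV[R[i]]_n).
Local Notation C := R[i].
Local Notation Cn := 'rV[R[i]]_n.
Hypotheses (oO : open Omega) (bO : bounded_set Omega) (rO : complete_Reinhardt Omega).
Implicit Types (z w zeta : Cn) (j k : nat).
Local Notation N2 := (N2 Omega).
Local Notation K2 := (K_off 2 Omega).
Local Notation m2 z := (fun zeta => m_min 2 Omega zeta z).

Variables (z1 zeta0 : Cn) (t0 : R).
Hypotheses (Oz1 : Omega z1) (t001 : 0 < t0 < 1) (clz : closure Omega zeta0).
Hypothesis K2z : K2 (t0%:C *: zeta0) z1 = 0.
Hypothesis K2_neq0 : forall (s : R) w, 0 <= s <= t0 -> Omega w -> K2 (s%:C *: w) z1 != 0.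

Let p := t0%:C *: zeta0.
Let q := t0%:C *: z1.

Let t00 : 0 < t0. Proof. by case/andP: t001. Qed.
Let t01 : t0 < 1. Proof. by case/andP: t001. Qed.

Let le1 (s : R) : 0 <= s <= t0 -> 0 <= s <= 1.
Proof. by move=> /andP[s0 st]; rewrite s0/= (le_trans st)// ltW. Qed.

Let normc_lt1 (s : R) : 0 <= s < 1 -> normc (s%:C : C) < 1.
Proof. by move=> /andP[s0 s1]; rewrite normc_real ger0_norm. Qed.

Let Oscale (s : R) w : 0 <= s <= t0 -> Omega w -> Omega (s%:C *: w).
Proof.
move=> /le1/andP[s0 s1] Ow; apply: (balanced rO) Ow _.
by rewrite normc_real ger0_norm.
Qed.

Let Ozeta (s : R) : 0 <= s < 1 -> Omega (s%:C *: zeta0).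
Proof. by move=> s01; exact: (closure_scale rO clz (normc_lt1 s01)). Qed.

Let ray_limit_K2 w : Omega w -> ray_limit (fun x => K2 x z1) w.
Proof.
move=> Ow; apply: (@ray_limit_within _ _ Omega) => //; last first.
  by move=> s /andP[s0 s1]; apply: (balanced rO Ow); apply: ltW; apply: normc_lt1; rewrite ltW.
apply: continuous_in_subspaceT => x; rewrite inE => Ox.
exact: (differentiable_continuous (K2_holomorphic oO bO Oz1 Ox)).
Qed.

(** [K2_dilate] moves [s] to the second variable, where [K2_neq0] says that the kernel is
    zero-free. *)
Lemma K2_root_interior j (s : R) w : 0 <= s <= t0 -> Omega w ->
  normc (K2 (s%:C *: w) z1) = N2 (m2 (s%:C *: z1)) ^+ (2 ^ j).-1 *
    normc (K_off (2 * 2 ^ j)%:R Omega w (s%:C *: z1)) ^+ (2 ^ j).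
Proof.
move=> s01 Ow; have Osz := Oscale s01 Oz1.
transitivity (normc (K2 w (s%:C *: z1))).
  by congr normc; exact: (K2_dilate oO bO rO (le1 s01) Ow Oz1).
apply: (normc_K2_root oO bO rO j Osz Ow) => x Ox.
rewrite -(K2_dilate oO bO rO (le1 s01) Ox Oz1); exact: K2_neq0.
Qed.

(** The left side is continuous at [s%:C *: zeta0], an interior point since [s <= t0 < 1]; the right
    side has a radial limit by assumption. *)
Lemma K2_root_boundary j (s : R) (g : Cn -> C) : 0 <= s <= t0 ->
  (forall w, Omega w -> g w = K_off (2 * 2 ^ j)%:R Omega w (s%:C *: z1)) ->
  ray_limit g zeta0 ->
  normc (K2 (s%:C *: zeta0) z1) =
    N2 (m2 (s%:C *: z1)) ^+ (2 ^ j).-1 * normc (g zeta0) ^+ (2 ^ j).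
Proof.
move=> s01 gE gl; have Os : Omega (s%:C *: zeta0).
  by have /andP[s0 s1] := s01; apply: Ozeta; rewrite s0/= (le_lt_trans s1).
apply: (ray_limit_eq (ray_limit_K2 Os) gl) => r /andP[r0 r1].
have Or : Omega (r%:C *: zeta0) by apply: Ozeta; rewrite ltW.
rewrite (gE _ Or) scalerA mulrC -scalerA; exact: K2_root_interior.
Qed.

Lemma K2_not_flat : ~ flat_at1 (fun l : C => K2 (l *: p) z1).
Proof.
(* A radius strictly between [1] and [t0^-1], as [flat_center_eq0] requires. *)
move=> fl; pose r := (1 + t0^-1) / 2.
have ti : 1 < t0^-1 by rewrite invf_gt1.
have r1 : 1 < r by rewrite /r; lra.
have rt : r < t0^-1 by rewrite /r; lra.
have r0 : 0 < r := lt_trans ltr01 r1.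
have Op (l : C) : normc l < t0^-1 -> Omega (l *: p).
  move=> lt; rewrite scalerA; apply: (closure_scale rO clz).
  by rewrite normcM normc_real gtr0_norm// -ltr_pdivlMr// mul1r.
have dG (l : C) : normc l < t0^-1 -> differentiable (fun l : C => K2 (l *: p) z1) l.
  move=> /Op Ol; have : differentiable (fun l : C => (fun w => K2 w z1) (0 + l *: p)) l.
    by apply: (@differentiable_slice R n (fun w => K2 w z1)); rewrite add0r; exact: K2_holomorphic.
  by under eq_fun do rewrite add0r.
have A2K : A2 Omega (fun w => K2 w z1).
  under eq_fun do rewrite (K2E oO bO _ Oz1).
  by apply: (A2_Z oO); have [] := m2P oO bO Oz1.
have nr_r : normc (r%:C : C) < t0^-1 by rewrite normc_real gtr0_norm.
have [d d0 dP] := open_polydisc oO (Op _ nr_r).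
pose V := fine (@lebesgue_Cn R n (@to_Cn R n @^-1` polydisc 0 d)).
have V0 : 0 < V.
  rewrite fine_gt0//; apply/andP; split; first exact: polydisc_volume_gt0.
  exact: polydisc_volume_lty.
(* Point evaluation bounds the square of the modulus, and [x <= 1 + x ^+ 2]. *)
have bound (l : C) : normc l = r -> normc (K2 (l *: p) z1) <= 1 + N2 (fun w => K2 w z1) / V.
  move=> lr; have rC : r%:C != 0 :> C by rewrite -normc_eq0 normc_real normr_eq0 gt_eqF.
  have l0 : l != 0 by rewrite -normc_eq0 lr gt_eqF.
  (* [Omega] is invariant under rotations, so [d] works at every point of the circle. *)
  have sub : polydisc (l *: p) d `<=` Omega.
    move=> w; rewrite /polydisc/= => wl.
    have -> : w = (l / r%:C) *: ((r%:C / l) *: w).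
      by rewrite scalerA mulrA divfK// divff// scale1r.
    apply: (balanced rO); last by rewrite normcM normcV lr normc_real gtr0_norm// divff// gt_eqF.
    apply: dP; rewrite /polydisc/=.
    have -> : (r%:C / l) *: w - r%:C *: p = (r%:C / l) *: (w - l *: p).
      by rewrite scalerBr (scalerA _ l p) divfK.
    by rewrite nrZ normcM normcV lr normc_real gtr0_norm// divff ?mul1r// gt_eqF.
  have := point_eval_N2 oO d0 A2K sub; rewrite -/V -ler_pdivlMr// => h.
  have := sqr_ge0 (normc (K2 (l *: p) z1) - 1); nra.
have := flat_center_eq0 r1 rt dG fl bound; rewrite scale0r.
by move/eqP; apply/negP; exact: (K2_0_neq0 oO bO rO Oz1).
Qed.

(** The common core of both properties. The constants may depend on [j]: each order [N] of flatness
    uses a single [j] with [alpha * 2 ^ j >= N]. *)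
Lemma K2_root_bound_false (alpha : R) : 0 < alpha ->
  ~ (forall j, exists c D : R, [/\ 0 <= c, 0 <= D & forall s : R, 0 < s < 1 ->
      exists b, [/\ 0 <= b, normc (K2 (s%:C *: p) z1) <= c * b ^+ (2 ^ j) &
                    b <= D * (1 - s) `^ alpha]]).
Proof.
move=> a0 H; apply: K2_not_flat => N.
have Na : 0 <= N%:R / alpha by rewrite divr_ge0// ltW.
pose j := Num.bound (N%:R / alpha).
have Nj : N%:R <= alpha * (2 ^ j)%:R.
  rewrite mulrC -ler_pdivrMr//; apply: le_trans (ltW (archi_boundP Na)) _.
  by rewrite ler_nat ltnW// ltn_expl.
have [c [D [c0 D0 cD]]] := H j; exists (c * D ^+ (2 ^ j)) => s s0 s1.
have [|b [b0 Kb bD]] := cD (1 - s); first by rewrite subr_gt0 s1 gtrBl.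
apply: le_trans Kb _; rewrite -mulrA ler_wpM2l//.
apply: le_trans (_ : (D * s `^ alpha) ^+ (2 ^ j) <= _).
  apply: lerXn2r; rewrite ?nnegrE ?mulr_ge0 ?powR_ge0//.
  by move: bD; rewrite opprB addrC subrK.
rewrite exprMn ler_wpM2l ?exprn_ge0//.
rewrite -(powR_mulrn N (ltW s0)) -(powR_mulrn (2 ^ j) (powR_ge0 s alpha)) -powRrM.
by apply: ger_powR => //; rewrite s0 ltW.
Qed.

Let t0t0 : 0 <= t0 <= t0. Proof. by rewrite lexx ltW. Qed.

Let boundary_zero j g : (forall w, Omega w -> g w = K_off (2 * 2 ^ j)%:R Omega w q) ->
  ray_limit g zeta0 -> g zeta0 = 0.
Proof.
move=> gE gl; have := K2_root_boundary t0t0 gE gl; rewrite K2z normc0.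
have A0 := N2_gt0 oO bO (Oscale t0t0 Oz1).
move/esym/eqP; rewrite mulf_eq0 !expf_eq0 (gt_eqF A0) andbF/= => /andP[_].
by rewrite normc_eq0 => /eqP.
Qed.

(** The second variable stays at [q], so the constant in the root identity is fixed, while the first
    runs radially to [zeta0]. *)
Lemma not_Holder_closure (alpha : R) : 0 < alpha -> ~ (forall k, (0 < k)%N ->
  Holder_closure alpha Omega (fun zeta => K_off (2 * k)%:R Omega zeta q)).
Proof.
move=> a0 H; apply: (K2_root_bound_false a0) => j.
have [|g Hg gE] := H (2 ^ j)%N; first by rewrite expn_gt0.
have Or (s : R) : 0 < s < 1 -> Omega (s%:C *: zeta0).
  by move=> /andP[s0 s1]; apply: Ozeta; rewrite ltW.
have [D D0 DP] := Holder_ray Hg clz (fun s s01 => subset_closure (Or s s01)).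
have g0 := boundary_zero gE (Holder_ray_limit a0 D0 DP).
exists (N2 (m2 q) ^+ (2 ^ j).-1), D; split; [by rewrite exprn_ge0// N2_ge0|exact: ltW|].
move=> s s01; exists (normc (g (s%:C *: zeta0))); split; first exact: normc_ge0.
  rewrite (gE _ (Or s s01)) scalerA mulrC -scalerA.
  by rewrite (K2_root_interior j t0t0 (Or s s01)).
by have := DP s s01; rewrite g0 subr0.
Qed.

(** Now the first variable stays at [zeta0] and the second runs to [q] inside the compact segment
    [E]. The constant in the root identity varies along it and is replaced by a power of the
    volume. *)
Lemma not_Holder_loc (alpha : R) : 0 < alpha -> ~ (forall k, (0 < k)%N ->
  exists Kbar : Cn -> Cn -> C,
    (forall z, Omega z -> continuous_extension Omega
       (fun zeta => K_off (2 * k)%:R Omega zeta z) (Kbar ^~ z)) /\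
    Holder_loc alpha Omega (Kbar zeta0)).
Proof.
move=> a0 H; apply: (K2_root_bound_false a0) => j.
have [|Kbar [Kext KH]] := H (2 ^ j)%N; first by rewrite expn_gt0.
have KE (s : R) : 0 <= s <= t0 -> normc (K2 (s%:C *: zeta0) z1) =
    N2 (m2 (s%:C *: z1)) ^+ (2 ^ j).-1 * normc (Kbar zeta0 (s%:C *: z1)) ^+ (2 ^ j).
  move=> s01; have [Kc KE] := Kext _ (Oscale s01 Oz1).
  apply: (K2_root_boundary s01 KE); apply: (ray_limit_within Kc clz) => r /andP[r0 r1].
  by apply: subset_closure; apply: Ozeta; rewrite ltW.
pose E : set Cn := (fun s : R => s%:C *: z1) @` `[0, t0]%classic.
have cE : compact E.
  apply: continuous_compact; last exact: segment_compact.
  apply: continuous_subspaceT => s P /nbhs_nrP[d d0 dP].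
  apply/nbhs_ballP; exists (d / (nr z1 + 1)) => /=; first by rewrite divr_gt0// ltr_wpDl ?nr_ge0.
  move=> r; rewrite /ball/= distrC ltr_pdivlMr ?ltr_wpDl ?nr_ge0// => rs; apply: dP.
  rewrite -scalerBl -rmorphB nrZ normc_real; apply: le_lt_trans rs.
  by rewrite ler_wpM2l// lerDl.
have EO : E `<=` Omega by move=> _ [s + <-]; rewrite /= in_itv/= => s01; exact: Oscale.
have sq (s : R) : s%:C *: q = (s * t0)%:C *: z1 by rewrite scalerA -rmorphM.
have st (s : R) : 0 < s < 1 -> 0 <= s * t0 <= t0.
  by move=> /andP[/ltW s0 /ltW s1]; rewrite mulr_ge0 ?(ltW t00)//= ler_piMl// ltW.
have Eq : E q by exists t0 => //; rewrite /= in_itv/= lexx ltW.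
have [D D0 DP] : exists2 D : R, 0 < D & forall s : R, 0 < s < 1 ->
    normc (Kbar zeta0 (s%:C *: q) - Kbar zeta0 q) <= D * (1 - s) `^ alpha.
  apply: (Holder_ray (KH E cE EO) Eq) => s s01; rewrite sq; exists (s * t0) => //.
  by rewrite /= in_itv/= st.
have [Kc KEq] := Kext _ (Oscale t0t0 Oz1).
have K0 : Kbar zeta0 q = 0.
  apply: (boundary_zero KEq); apply: (ray_limit_within Kc clz) => r /andP[r0 r1].
  by apply: subset_closure; apply: Ozeta; rewrite ltW.
exists (N2 (fun=> 1) ^+ (2 ^ j).-1), D; split; [by rewrite exprn_ge0// N2_ge0|exact: ltW|].
move=> s s01; exists (normc (Kbar zeta0 (s%:C *: q))); split; first exact: normc_ge0.
  have -> : s%:C *: p = (s * t0)%:C *: zeta0 by rewrite scalerA -rmorphM.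
  rewrite (KE _ (st s s01)) sq ler_wpM2r ?exprn_ge0 ?normc_ge0//.
  apply: lerXn2r; rewrite ?nnegrE ?N2_ge0//.
  exact: (N2_le_volume oO bO (Oscale (st s s01) Oz1)).
by have := DP s s01; rewrite K0 subr0.
Qed.

End regularity.

Theorem theorem1p6 (R : realType) (n : nat) (Omega : set 'rV[R[i]]_n) :
  (0 < n)%N ->
  bounded_domain Omega -> complete_Reinhardt Omega -> smooth_boundary Omega ->
  (exists zeta z, [/\ Omega zeta, Omega z & K_off 2 Omega zeta z = 0]) ->
  (forall alpha : R, 0 < alpha ->
     exists (k : nat) (z : 'rV[R[i]]_n),
       [/\ (0 < k)%N, Omega z &
           ~ Holder_closure alpha Omega (fun zeta => K_off (2 * k)%:R Omega zeta z)])
  /\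
  (forall alpha : R, 0 < alpha ->
     exists k : nat, (0 < k)%N /\
       ((exists2 z, Omega z &
           ~ C_closure Omega (fun zeta => K_off (2 * k)%:R Omega zeta z))
        \/
        (exists Kbar : 'rV[R[i]]_n -> 'rV[R[i]]_n -> R[i],
           (forall z, Omega z ->
              continuous_extension Omega
                (fun zeta => K_off (2 * k)%:R Omega zeta z) (Kbar ^~ z)) /\
           (exists2 zeta, boundary Omega zeta &
              ~ Holder_loc alpha Omega (Kbar zeta))))).
Proof.
move=> _ [_ oO _ bO] rO _ [zeta1 [z1 [Ozeta1 Oz1 K0]]].
have [t0 [zeta0 [t01 cz nz Kz zf]]] : exists (t : R) (z : 'rV[R[i]]_n),
    [/\ 0 < t < 1, closure Omega z, ~ Omega z, K_off 2 Omega (t%:C *: z) z1 = 0 &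
      forall s w, 0 <= s <= t -> Omega w -> K_off 2 Omega (s%:C *: w) z1 != 0].
  apply: (first_zero oO bO rO (F := fun w => K_off 2 Omega w z1)).
  - by move=> z Oz; exact: (differentiable_continuous (K2_holomorphic oO bO Oz1 Oz)).
  - exact: (K2_0_neq0 oO bO rO Oz1).
  - by exists zeta1.
split=> alpha a0; apply: contrapT => H.
  apply: (not_Holder_closure oO bO rO Oz1 t01 cz Kz zf a0) => k k0.
  apply: contrapT => nH; apply: H; exists k, (t0%:C *: z1); split; [exact: k0| |exact: nH].
  have /andP[/ltW t0ge /ltW t0le] := t01.
  by apply: (balanced rO Oz1); rewrite normc_real ger0_norm.
apply: (not_Holder_loc oO bO rO Oz1 t01 cz Kz zf a0) => k k0.
(* Unless the first alternative holds, every [z] in [Omega] has an extension; they are collected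
   into one function of two variables. *)
have ext z : exists g, Omega z ->
    continuous_extension Omega (fun zeta => K_off (2 * k)%:R Omega zeta z) g.
  have [Oz|nOz] := pselect (Omega z); last by exists (fun=> 0).
  apply: contrapT => ng; apply: H; exists k; split; first exact: k0.
  left; exists z; first exact: Oz.
  by move=> [g gP]; apply: ng; exists g.
have [G GP] := choice ext.
exists (fun zeta z => G z zeta); split; first exact: GP.
apply: contrapT => nH; apply: H; exists k; split; first exact: k0.
right; exists (fun zeta z => G z zeta); split; first exact: GP.
exists zeta0; last exact: nH.
by split; [exact: cz|move=> /interior_subset].
Qed.
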